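(* Let $s\geq 3$ be an integer. There exist constants $C,\beta,\gamma>0$, depending only on $s$, such that the following holds for every sufficiently large $n$. (a) If $b\geq C n^{1-1/\lceil s/2\rceil}$, then Breaker wins the $(1:b)$ rainbow-connectivity game $\mathcal{C}_{s,n}$. (b) If $b\leq \gamma n^{1-1/\lceil s/2\rceil}$, then Maker wins the $(1:b)$ game $\mathcal{C}_{s,n}$. Moreover, she has a strategy with which she obtains, for every pair of vertices and for every ordering of the $s$ colors, at least $\beta n^{s-1}b^{-s}$ rainbow paths of length $s$ between these two vertices whose edges have the colors in that order. In particular, the threshold bias of $\mathcal{C}_{s,n}$ is of order $n^{1-1/\lceil s/2\rceil}$.
   Context: A $(1:b)$ Maker-Breaker game on a finite board $X$ with a family of winning sets: Maker and Breaker alternately claim unclaimed elements of $X$, Maker $1$ per round and Breaker $b$ per round, until all are claimed; Maker wins if she claims all elements of some winning set, otherwise Breaker wins. The threshold bias is the unique integer $b_0$ such that Breaker wins the $(1:b)$ game iff $b\geq b_0$. For integers $1\leq s\leq n$, the rainbow-connectivity game $\mathcal{C}_{s,n}$ is played on the board $X=\bigcup_{i\in[s]}E(G_i)$, where $G_1,\dots,G_s$ are distinct copies of $K_n$ on the common vertex set $V=[n]$; an edge of $G_i$ is said to have color $i$. A path is rainbow if its edges have pairwise distinct colors. Maker wins iff at the end every two vertices of $V$ are joined by a rainbow path consisting of Maker's edges. *)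

(* Defs.v *)
From mathcomp Require Import all_boot all_fingroup.
From Stdlib Require Import Reals.

Set Implicit Arguments.
Unset Strict Implicit.
Unset Printing Implicit Defensive.

Inductive mwin (T : finType) (X : {set T}) (b : nat) (P : {set T} -> Prop)
  : {set T} -> {set T} -> Prop :=
| mwin_end M B :
    X \subset M :|: B -> P M -> mwin X b P M B
| mwin_step M B x :
    x \in X :\: (M :|: B) ->
    (forall S : {set T},
        S \subset X :\: ((x |: M) :|: B) ->
        #|S| = minn b #|X :\: ((x |: M) :|: B)| ->
        mwin X b P (x |: M) (B :|: S)) ->
    mwin X b P M B.

Definition maker_wins (T : finType) (X : {set T}) (b : nat)
  (P : {set T} -> Prop) : Prop := mwin X b P set0 set0.

(* The rainbow-connectivity board C_{s,n}: an element (i, e) is the edge e  *)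
(* (a 2-subset of V = 'I_n) of the copy G_i of K_n, i.e. of colour i.      *)

Definition cboard (s n : nat) : {set ('I_s * {set 'I_n})} :=
  [set e : 'I_s * {set 'I_n} | #|e.2| == 2].

Definition rainbow_path (s n : nat) (M : {set ('I_s * {set 'I_n})})
  (u v : 'I_n) (w : seq 'I_n) (c : seq 'I_s) : bool :=
  [&& size c == size w, uniq (u :: w), last u w == v, uniq c &
      all (fun p : 'I_s * ('I_n * 'I_n) => (p.1, [set p.2.1; p.2.2]) \in M)
          (zip c (zip (u :: w) w))].

Definition rainbow_connected (s n : nat) (M : {set ('I_s * {set 'I_n})})
  : Prop :=
  forall u v : 'I_n, u != v -> exists w c, rainbow_path M u v w c.

Definition ordered_paths_count (s n : nat) (M : {set ('I_s * {set 'I_n})})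
  (u v : 'I_n) (sigma : 'S_s) : nat :=
  #|[set w : {ffun 'I_s.+1 -> 'I_n} |
      [&& w ord0 == u, w ord_max == v, injectiveb w &
          [forall j : 'I_s,
             (sigma j, [set w (inord j); w (inord j.+1)]) \in M]]]|.

Definition many_paths (s n : nat) (beta : R) (b : nat)
  (M : {set ('I_s * {set 'I_n})}) : Prop :=
  forall u v : 'I_n, u != v -> forall sigma : 'S_s,
    (beta * INR n ^ (s.-1) * / (INR b ^ s) <= INR (ordered_paths_count M u v sigma))%R.

Definition thr (s n : nat) : R := Rpower (INR n) (1 - / INR (uphalf s)).

(* Submission.v *)
Require Import Defs.
From mathcomp Require Import all_boot all_fingroup.
From Stdlib Require Import Reals.
From mathcomp Require Import ssrnat all_order all_algebra zify ring lra Rstruct.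

Set Implicit Arguments.
Unset Strict Implicit.
Unset Printing Implicit Defensive.

(** Write k = ceil(s/2).

    Breaker: with bias C n^(1 - 1/k) he fixes two vertices u, v outside Maker's
    first edge and, in k - 1 stages, claims what is left of the edges leaving the
    current balls around u and v, half of his bias keeping the two parts Maker has
    touched completely separated.  Each stage freezes the balls of the next radius
    and multiplies their size by O(n / b), so the balls of radius k - 1 end up with
    O(b) vertices.  Since s <= 2 k, a path would then have to join the two frozen
    balls by at most two edges, and he can answer every first such edge.

    Maker: she plays two games in alternation.  In the first she builds a random
    multigraph: the vertices are split into s + 1 classes of size m, and for every
    vertex x, colour c and class a she owns a box of D ~ n/b slots, each asking
    for an edge of colour c from x into class a.  A potential keeps Breaker's
    degree in every unfinished box below em = eps n; the value of a revealed slot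
    is chosen by derandomisation, a sum of exponential supermartingales being kept
    below 1, so that at the end everything holds which a random choice would give.
    From u grow walks of length i = s - k and from v walks of length j = k - 1, all
    with prescribed colours and classes.  A pair of walks with ends x, z needs the
    middle edge xz.  Either that edge is still not Breaker's when both walks
    are complete, and then in the second game (a potential of the form
    exp(- lambda Y)) Maker claims a fraction about 1/b of such edges; or Breaker
    took it before, and the classification by the last revealed slot shows that for
    a constant proportion of the pairs it was still available to the middle box
    at x or at z, so that these boxes produce about D^s / n paths themselves. *)

(** The obstacle on Maker's side is that Breaker sees every revealed slot and adapts to it, so the
    walks cannot be treated as independent samples. The keys resolve this: the keys met along a pair
    of walks are distinct, so each potential watches the slots of one key and is a supermartingale
    for every fixed choice of the values at all other keys, unrevealed ones included. Counts of
    walks through other keys then behave as constants, and the sum over all completions replaces the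
    conditional expectation.

    The second obstacle is logarithms. There are fewer than n^4 potentials, so a deviation costs L =
    4 log n, and a Chernoff bound with constant tilt would lose a factor log n at each step of a
    walk, hence the order of the threshold. The multiplicities of ends are therefore tilted by ell =
    log T with T = n^(1/(4k)). Then L / ell is a constant, and the factor T falls only on the mean,
    which is affordable because D is at least of order T^4 = n^(1/k). *)

Lemma subset_of_card (T : finType) (A C : {set T}) k : A \subset C -> #|A| <= k <= #|C| ->
  exists S : {set T}, [/\ A \subset S, S \subset C & #|S| = k].
Proof.
elim: k => [|k IH] sAC /andP[h1 h2].
  by exists A; split=> //; apply/eqP; rewrite -leqn0.
case: (ltnP #|A| k.+1) => h; last first.
  by exists A; split=> //; apply/eqP; rewrite eqn_leq h1 h.
have [|S [h3 h4 h5]] := IH sAC; first by rewrite -ltnS h ltnW.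
have : 0 < #|C :\: S| by rewrite cardsD (setIidPr h4) h5 subn_gt0.
case/card_gt0P=> x; rewrite inE => /andP[xS xC].
exists (x |: S); split.
- exact: subset_trans h3 (subsetUr _ _).
- by rewrite subUset sub1set xC.
- by rewrite cardsU1 xS h5.
Qed.

Lemma disjointUl (T : finType) (A B C : {set T}) :
  [disjoint A :|: B & C] = [disjoint A & C] && [disjoint B & C].
Proof. by rewrite -!setI_eq0 setIUl setU_eq0. Qed.

(** * Strategies as invariants *)

Section Strategy.
Variables (T : finType) (X : {set T}) (b : nat) (P : {set T} -> Prop).

(* Maker plays in blocks of two rounds; E1 and E2 are the edges she needs, which
   she may already own, and I must survive additional Maker edges. *)
Lemma mwin_strategy (I : nat -> {set T} -> {set T} -> Prop) :
  (forall r M B x, I r M B -> x \notin B -> I r (x |: M) B) ->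
  (forall r M B, I r M B -> [disjoint M & B] ->
     exists E1 : {set T}, [/\ #|E1| <= 1, E1 \subset X :\: B &
       forall F1 : {set T}, F1 \subset X :\: (E1 :|: M :|: B) -> #|F1| <= b ->
       exists E2 : {set T}, [/\ #|E2| <= 1, E2 \subset X :\: (B :|: F1) &
         forall F2 : {set T}, F2 \subset X :\: (E2 :|: E1 :|: M :|: B :|: F1) ->
           #|F2| <= b -> I r.-1 (E2 :|: E1 :|: M) (B :|: F1 :|: F2)]]) ->
  (forall M B, I 0 M B -> [disjoint M & B] -> X \subset M :|: B -> P M) ->
  forall r, I r set0 set0 -> mwin X b P set0 set0.
Proof.
move=> Imono Istep Ifin.
(* [J] is the invariant in the middle of a block: the first edge has been answered and [E2] is still
   owed. *)
pose J r M B := exists E2 : {set T}, [/\ #|E2| <= 1, E2 \subset X :\: B &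
         forall F2 : {set T}, F2 \subset X :\: (E2 :|: M :|: B) ->
           #|F2| <= b -> I r.-1 (E2 :|: M) (B :|: F2)].
have monoU r (M B E : {set T}) : I r M B -> [disjoint E & B] -> I r (E :|: M) B.
  have [k le_k] := ubnP #|E|; elim: k E M le_k => // k IH E M le_k IM dE.
  have [->|[x xE]] := set_0Vmem E; first by rewrite set0U.
  have xB : x \notin B by rewrite (disjointFr dE xE).
  rewrite -(setD1K xE) -setUA setUCA; apply: IH.
  - by move: le_k; rewrite (cardsD1 x E) xE.
  - exact: Imono.
  - exact: disjointWl (subsetDl _ _) dE.
have Jmono r (M B : {set T}) x : J r M B -> x \notin B -> J r (x |: M) B.
  case=> E2 [h1 h2 h3] xB; exists E2; split=> // F2 sF2 cF2.
  rewrite setUCA.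
  apply: monoU; last first.
    rewrite disjoints1 inE (negbTE xB) /=.
    by apply/negP=> /(subsetP sF2); rewrite !inE eqxx /= orbT.
  apply: h3 => //; apply: (subset_trans sF2); apply: setDS.
  by rewrite setUCA -!setUA; exact: subsetUr.
(* On a full board the remaining blocks are run with empty Breaker moves; the edges asked for are
   already Maker's, so the counter reaches 0. *)
have mark r (M B : {set T}) : I r M B -> [disjoint M & B] -> X \subset M :|: B -> P M.
  elim: r => [|r IH] in M B * => IM dMB sX; first exact: Ifin IM _ sX.
  have [E1 [_ sE1 h]] := Istep _ _ _ IM dMB.
  have inM (E : {set T}) : E \subset X :\: B -> E \subset M.
    move=> sE; apply/subsetP=> x /(subsetP sE); rewrite inE => /andP[xB xX].
    by move: (subsetP sX _ xX); rewrite inE (negbTE xB) orbF.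
  have [||E2 [_ sE2 h']] := h set0; rewrite ?sub0set ?cards0 //.
  have := h' set0; rewrite sub0set cards0 => /(_ isT isT); rewrite !setU0 /=.
  rewrite -setUA (setUidPr (inM _ sE1)) (setUidPr (inM E2 _)).
    by move=> IM'; apply: IH IM' _ _.
  by rewrite setU0 in sE2.
have dE (E M B : {set T}) : [disjoint M & B] -> E \subset X :\: B -> [disjoint E :|: M & B].
  move=> d s; rewrite disjointUl d andbT; apply/pred0P=> x /=; apply/negP=> /andP[xE xB].
  by move: (subsetP s _ xE); rewrite inE xB.
move=> r0 I0.
suff main k : forall r (M B : {set T}), #|X :\: (M :|: B)| < k -> [disjoint M & B] ->
    (I r M B -> mwin X b P M B) /\ (J r M B -> mwin X b P M B).
  have d0 : [disjoint (set0 : {set T}) & (set0 : {set T})] by rewrite -setI_eq0 setI0.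
  by have [h _] := main _ r0 set0 set0 (ltnSn _) d0; apply: h.
elim: k => // k IH r M B lk dMB.
have cov : X :\: (M :|: B) = set0 -> X \subset M :|: B by move/eqP; rewrite setD_eq0.
have disj2 x (S : {set T}) : x \in X :\: (M :|: B) -> S \subset X :\: (x |: M :|: B) ->
     [disjoint x |: M & B :|: S].
  rewrite !inE negb_or => /andP[/andP[xM xB] xX] sS.
  rewrite disjoint_sym disjointUl; apply/andP; split; last first.
    apply/pred0P=> y /=; apply/negP=> /andP[/(subsetP sS)]; rewrite !inE.
    by case/andP=> /norP[/norP[/negbTE-> /negbTE->]].
  by rewrite disjoint_sym disjointUl dMB disjoints1 xB.
have meas x (S : {set T}) : x \in X :\: (M :|: B) ->
     #|X :\: (x |: M :|: (B :|: S))| < k.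
  move=> xf; apply: leq_trans (_ : #|X :\: (M :|: B)| <= k); last by rewrite -ltnS.
  apply: proper_card; apply/properP; split.
    by apply: setDS; rewrite setUA -setUA setUACA; apply/subsetP=> y; rewrite !inE => /orP[]->; rewrite ?orbT.
  by exists x => //; rewrite !inE eqxx.
(* If [E] is already owned, any free element is played instead, which [Imono] allows. *)
have pickx (E : {set T}) : #|E| <= 1 -> E \subset X :\: B -> X :\: (M :|: B) <> set0 ->
   exists2 x, x \in X :\: (M :|: B) & E :|: M \subset x |: M.
  move=> c1 sE ne.
  have [sEM|] := boolP (E \subset M).
    have [//|[x xf]] := set_0Vmem (X :\: (M :|: B)).
    by exists x => //; rewrite (setUidPr sEM) subsetUr.
  case/subsetPn=> x xE xM; exists x.
    by move: (subsetP sE _ xE); rewrite !inE (negbTE xM).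
  apply: setSU; apply/subsetP=> y yE; rewrite inE.
  by move/card_le1_eqP: c1; move/(_ _ _ yE xE)=> ->.
split.
  move=> IM; have [E0|ne] := eqVneq (X :\: (M :|: B)) set0.
    by apply: mwin_end; [exact: cov | exact: mark IM dMB (cov E0)].
  have [E1 [c1 s1 h]] := Istep _ _ _ IM dMB.
  have [|x xf sx] := pickx _ c1 s1; first exact/eqP.
  apply: (mwin_step xf) => S sS cS.
  apply: (proj2 (IH r _ _ (meas _ _ xf) (disj2 _ _ xf sS))).
  have sS' : S \subset X :\: (E1 :|: M :|: B).
    by apply: (subset_trans sS); apply: setDS; apply: setSU.
  have [|E2 [c2 s2 h2]] := h S sS'; first by rewrite cS geq_minl.
  have -> : x |: M = x |: (E1 :|: M).
    apply/eqP; rewrite eqEsubset (setUS _ (subsetUr _ _)) /=.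
    by rewrite subUset sub1set setU11.
  apply: Jmono.
    exists E2; split=> // F2 sF2 cF2; rewrite setUA.
    by apply: h2 => //; move: sF2; rewrite !setUA.
  have := disjointFr (disj2 _ _ xf sS) (setU11 x M) => ->; by [].
move=> [E2 [c2 s2 h2]]; have [E0|ne] := eqVneq (X :\: (M :|: B)) set0.
  apply: mwin_end; first exact: cov.
  have := h2 set0; rewrite sub0set cards0 => /(_ isT isT).
  have -> : E2 :|: M = M.
    apply/setUidPr/subsetP=> x /(subsetP s2); rewrite inE => /andP[xB xX].
    by move: (subsetP (cov E0) _ xX); rewrite inE (negbTE xB) orbF.
  by rewrite setU0 => IM; exact: mark IM dMB (cov E0).
have [|x xf sx] := pickx _ c2 s2; first exact/eqP.
apply: (mwin_step xf) => S sS cS.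
apply: (proj1 (IH r.-1 _ _ (meas _ _ xf) (disj2 _ _ xf sS))).
have -> : x |: M = x |: (E2 :|: M).
  apply/eqP; rewrite eqEsubset (setUS _ (subsetUr _ _)) /=.
  by rewrite subUset sub1set setU11.
apply: Imono.
  apply: h2; last by rewrite cS geq_minl.
  by apply: (subset_trans sS); apply: setDS; apply: setSU.
have := disjointFr (disj2 _ _ xf sS) (setU11 x M) => ->; by [].
Qed.

(** A reply must have the exact size prescribed by the rules, so the planned set [S0] is padded
    arbitrarily and the invariant has to survive the surplus. *)
Lemma breaker_strategy (I : {set T} -> {set T} -> Prop) :
  (forall M B, I M B -> X \subset M :|: B -> ~ P M) ->
  (forall M B x, I M B -> x \in X :\: (M :|: B) ->
     exists S0 : {set T}, [/\ S0 \subset X :\: (x |: M :|: B), #|S0| <= b &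
       forall S : {set T}, S0 \subset S -> S \subset X :\: (x |: M :|: B) ->
       #|S| = minn b #|X :\: (x |: M :|: B)| ->
       I (x |: M) (B :|: S)]) ->
  forall M B, I M B -> ~ mwin X b P M B.
Proof.
move=> Iend Istep M B IM W; elim: W IM => {M B} [M B sX PM IM|M B x xf _ IH IM].
  exact: Iend IM sX PM.
have [S0 [s0 c0 h]] := Istep _ _ _ IM xf.
have [|S [h1 h2 h3]] := @subset_of_card _ _ _ (minn b #|X :\: (x |: M :|: B)|) s0.
  by rewrite leq_min c0 geq_minr subset_leq_card.
by apply: (IH S) => //; apply: h.
Qed.
End Strategy.

(** * Breaker's strategy *)

Lemma mem_cboard s n (c : 'I_s) (x y : 'I_n) : ((c, [set x; y]) \in cboard s n) = (x != y).
Proof. by rewrite inE /= cards2; case: (x == y). Qed.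

Lemma cboardP s n (e : 'I_s * {set 'I_n}) : e \in cboard s n ->
  exists c x y, x != y /\ e = (c, [set x; y]).
Proof.
case: e => c S; rewrite inE /= => /cards2P[x [y [xy ->]]].
by exists c, x, y.
Qed.

Lemma sub_minn_le a h c : a <= h + c -> a - minn h a <= c.
Proof. lia. Qed.

Section Breaker.
Variables (s n b : nat).
Notation V := 'I_n.
Notation Edge := ('I_s * {set V})%type.
Implicit Types (M B : {set Edge}) (x y z u v : V) (U T Z W A C : {set V}).
Let X := cboard s n.

Definition adj M x y := [exists c : 'I_s, (c, [set x; y]) \in M].

Lemma adj_sym M x y : adj M x y = adj M y x.
Proof. by rewrite /adj setUC. Qed.

(** Quantifying over all graphs [M'] that Maker can still reach, those avoiding the present [B],
    makes the bound on the ball permanent. *)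
Definition ball_in M B i u U := forall M' w, M \subset M' -> [disjoint M' & B] ->
  path (adj M') u w -> size w <= i -> last u w \in U.

Definition allB B Z W := forall z w (c : 'I_s), z \in Z -> w \in W -> (c, [set z; w]) \in B.

Lemma allB_sym B Z W : allB B Z W -> allB B W Z.
Proof. by move=> h z w c zW wZ; rewrite setUC; apply: h. Qed.

Lemma allBS B B' Z W : B \subset B' -> allB B Z W -> allB B' Z W.
Proof. by move=> sB h z w c zZ wW; apply: (subsetP sB); apply: h. Qed.

Definition estar A C : {set Edge} :=
  [set (t.1, [set t.2.1; t.2.2]) | t in setX [set: 'I_s] (setX A C)].

Lemma mem_estar A C c x y : x \in A -> y \in C -> (c, [set x; y]) \in estar A C.
Proof. by move=> xA yC; apply/imsetP; exists (c, (x, y)); rewrite // !inE xA yC. Qed.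

Lemma card_estar A C : #|estar A C| <= s * (#|A| * #|C|).
Proof. by apply: leq_trans (leq_imset_card _ _) _; rewrite !cardsX cardsT card_ord. Qed.

Lemma ball_inS M B M' B' i u U : M \subset M' -> B \subset B' ->
  ball_in M B i u U -> ball_in M' B' i u U.
Proof.
move=> sM sB h M1 w s1 d1; apply: h; first exact: subset_trans s1.
by rewrite disjoint_sym (disjointWl sB) // disjoint_sym.
Qed.

Lemma path_adj M u w c : size c = size w ->
  all (fun p : 'I_s * (V * V) => (p.1, [set p.2.1; p.2.2]) \in M)
          (zip c (zip (u :: w) w)) -> path (adj M) u w.
Proof.
elim: w u c => [|y w IH] u [|c0 c] //= [sz] /andP[h1 h2].
apply/andP; split; first by apply/existsP; exists c0.
exact: IH h2.
Qed.

Let half := b./2.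

(** Bounds the number of Maker edges played by the time the balls of radius [i] are frozen. After
    [t] edges at most [2 + 2 * t] vertices are touched, so at most [2 * s * n * (1 + horizon j)]
    edges leave the balls of radius [j], and [half] of them are claimed per round. *)
Fixpoint horizon i := if i is j.+1 then
  (horizon j + (2 * s * n * (1 + horizon j)) %/ half).+1 else 1.

Lemma horizon_bound i : 0 < half -> 1 + horizon i <= 2 * (4 + (2 * s * n) %/ half) ^ i.
Proof.
move=> h0; elim: i => [|i IH]; first by rewrite expn0.
rewrite expnS mulnCA; apply: leq_trans (leq_mul (leqnn _) IH).
set K := _ %/ half; set y := 1 + horizon i.
have H : 2 * s * n * y %/ half <= (K + 1) * y.
  have h1 : 2 * s * n <= (K + 1) * half by rewrite addn1 ltnW // /K ltn_ceil.
  by rewrite -(@mulnK ((K + 1) * y) half h0); apply: leq_div2r; rewrite [_ * half]mulnAC leq_mul2r h1 orbT.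
have y1 : 0 < y by [].
rewrite [horizon i.+1]/= -/y; move: H; set Q := _ %/ half; move: Q => Q.
have -> : horizon i = y - 1 by rewrite /y addKn.
by move: K y y1 => a c; nia.
Qed.

(** * Separating two frozen balls *)

Section Endgame.
Variables (u v : V) (k : nat).
Hypotheses (uv : u != v) (hk : 0 < k) (sk : s <= k.*2) (s_gt0 : 0 < s).

(** The two symmetric clauses say that each Maker edge from one ball to a vertex [y] has been
    answered by all edges from [y] to the other ball. The last bound is the size of such an answer
    at both ends of a Maker edge. *)
Definition late M B := exists U T,
  [/\ [disjoint M & B], ball_in M B k.-1 u U /\ ball_in M B k.-1 v T,
      [disjoint U & T] /\ allB B U T,
      (forall x y z c c', x \in U -> (c, [set x; y]) \in M -> z \in T -> (c', [set y; z]) \in B) /\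
      (forall x y z c c', x \in T -> (c, [set x; y]) \in M -> z \in U -> (c', [set y; z]) \in B)
    & s * (2 * (#|U| + #|T|)) <= b].

Lemma late_end M B : late M B -> ~ rainbow_connected M.
Proof.
case=> U [T [dMB [bU bT] [dUT UT] [hU hT] _]] rc.
have [w [c]] := rc _ _ uv.
case/and5P=> /eqP sz _ /eqP lw uc /(path_adj sz) pw.
have sw : size w <= k.*2.
  apply: leq_trans sk; rewrite -sz -[s in X in _ <= X]card_ord.
  by rewrite -(card_uniqP uc) max_card.
have disj x : x \in U -> x \in T -> False.
  by move=> xU xT; move: (disjointFr dUT xU); rewrite xT.
pose nd a := last u (take a w).
have ndU a : a <= k.-1 -> nd a \in U.
  move=> ak; apply: (bU M) => //; last by rewrite size_take_min (leq_trans (geq_minl _ _)).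
  by move: pw; rewrite -{1}(cat_take_drop a w) cat_path => /andP[].
(* The tail of the path, reversed, is a walk from [v]. *)
have ndT a : size w - a <= k.-1 -> nd a \in T.
  move=> ak; move: pw lw; rewrite -{1 2}(cat_take_drop a w) cat_path last_cat -/(nd a).
  case/andP=> _ p2 l2.
  have E : last (last (nd a) (drop a w)) (rev (belast (nd a) (drop a w))) = nd a.
    by case: (drop a w) => //= q q'; rewrite rev_cons last_rcons.
  rewrite -E l2; apply: (bT M) => //; last by rewrite size_rev size_belast size_drop.
  by rewrite -l2 rev_path (eq_path (e' := adj M)) // => p q; rewrite /= adj_sym.
have step a : a < size w -> adj M (nd a) (nd a.+1).
  move=> aw; have := pw; rewrite -{1}(cat_take_drop a.+1 w) cat_path => /andP[+ _].
  by rewrite (take_nth u) // rcons_path => /andP[_]; rewrite /nd (take_nth u) ?last_rcons.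
(* Distinct colours leave at most [k.*2] edges. Up to [k.*2 - 2] edges some vertex lies in both
   balls; one edge more means a Maker edge between the balls, against [allB]; two more give a
   crossing whose second edge was Breaker's answer to the first. *)
have [h|h] := leqP (size w) (k.-1).*2.
  apply: (disj (nd (minn k.-1 (size w)))); [apply: ndU | apply: ndT]; lia.
have [h'|h'] := eqVneq (size w) (k.-1).*2.+1.
  have /existsP[c0] : adj M (nd k.-1) (nd k.-1.+1) by apply: step; lia.
  have := UT (nd k.-1) (nd k.-1.+1) c0 (ndU _ (leqnn _)).
  by rewrite ndT; [move=> /(_ isT) eB eM; move: (disjointFr dMB eM); rewrite eB | lia].
have /existsP[c0 e0] : adj M (nd k.-1) (nd k.-1.+1) by apply: step; lia.
have /existsP[c1 e1] : adj M (nd k.-1.+1) (nd k.-1.+2) by apply: step; lia.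
have := hU _ _ (nd k.-1.+2) _ c1 (ndU _ (leqnn _)) e0.
rewrite ndT; last by lia.
by move=> /(_ isT) eB; move: (disjointFr dMB e1); rewrite eB.
Qed.

Lemma late_lose M B : late M B -> ~ mwin X b (@rainbow_connected s n) M B.
Proof.
apply: breaker_strategy => {M B} [M B L _|M B e]; first exact: late_end L.
case=> U [T [dMB [bU bT] [dUT UT] [hU hT] cs]]; rewrite in_setD in_setU negb_or => /andP[/andP[eM eB] eX].
have [c [x [y [xy ee]]]] := cboardP eX.
exists (estar [set x; y] (U :|: T) :&: (X :\: (e |: M :|: B))); split.
- exact: subsetIr.
- apply: leq_trans (subset_leq_card (subsetIl _ _)) _.
  apply: leq_trans (card_estar _ _) _; apply: leq_trans cs; rewrite leq_mul2l; apply/orP; right.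
  by rewrite cards2 xy leq_mul2l /= cardsU leq_subr.
move=> S S0 S1 _; exists U, T; split.
- rewrite disjoint_sym disjointUl; apply/andP; split.
    by rewrite disjoint_sym disjointUl disjoints1 eB.
  apply/pred0P=> f /=; apply/negP=> /andP[/(subsetP S1)]; rewrite inE => /andP[+ _].
  by rewrite !inE => /norP[/norP[/negbTE-> /negbTE->]].
- by split; [apply: ball_inS bU | apply: ball_inS bT]; rewrite ?subsetUr ?subsetUl.
- by split=> //; apply: allBS UT; exact: subsetUl.
- split.
  move=> x' y' z c1 c2 xU; rewrite in_setU1 => /orP[/eqP eq|eM'] zT; last first.
    by rewrite inE (hU _ _ _ _ _ xU eM').
  have [eB'|nB] := boolP ((c2, [set y'; z]) \in B); first by rewrite inE eB'.
  rewrite inE (subsetP S0) ?orbT // inE; apply/andP; split.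
    apply: mem_estar; last by rewrite inE zT orbT.
    by have := set22 x' y'; move: eq; rewrite ee => -[_ ->].
  (* Edges between the balls are already Breaker's, whereas [e] was free. *)
  have y'T : y' \notin T.
    by apply/negP=> yT; move: eB; rewrite -eq UT.
  rewrite in_setD mem_cboard !inE (negbTE nB) orbF negb_or; apply/andP; split; last first.
    by apply: contraNneq y'T => ->.
  apply/andP; split.
    apply/eqP; rewrite -eq => -[_ /setP/(_ z)]; rewrite !inE eqxx orbT => /esym/orP[/eqP zx|/eqP zy].
      by move: (disjointFr dUT xU); rewrite -zx zT.
    by move: y'T; rewrite -zy zT.
  (* If Maker already owned the edge from [y'] to [z], the answer to it, recorded in [hT], would
     contain [e]. *)
  apply/negP=> eM'; move: eB; rewrite -eq setUC (hT z y' x' c2) //.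
  by rewrite setUC.
  move=> x' y' z c1 c2 xT; rewrite in_setU1 => /orP[/eqP eq|eM'] zU; last first.
    by rewrite inE (hT _ _ _ _ _ xT eM').
  have [eB'|nB] := boolP ((c2, [set y'; z]) \in B); first by rewrite inE eB'.
  rewrite inE (subsetP S0) ?orbT // inE; apply/andP; split.
    apply: mem_estar; last by rewrite inE zU.
    by have := set22 x' y'; move: eq; rewrite ee => -[_ ->].
  have y'U : y' \notin U.
    by apply/negP=> yU; move: eB; rewrite -eq setUC UT.
  rewrite in_setD mem_cboard !inE (negbTE nB) orbF negb_or; apply/andP; split; last first.
    by apply: contraNneq y'U => ->.
  apply/andP; split.
    apply/eqP; rewrite -eq => -[_ /setP/(_ z)]; rewrite !inE eqxx orbT => /esym/orP[/eqP zx|/eqP zy].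
      by move: (disjointFr dUT zU); rewrite zx xT.
    by move: y'U; rewrite -zy zU.
  apply/negP=> eM'; move: eB; rewrite -eq setUC (hU z y' x' c2) //.
  by rewrite setUC.
- exact: cs.
Qed.

(** * Growing the balls stage by stage *)

(** [Z] and [W] contain the ends of all Maker edges, separated completely by Breaker, and [t] counts
    her edges. Thus [u] and [v] lie in different components of her graph, and a play that ends
    during these stages is won by Breaker. *)
Definition early_at i t U T M B := exists Z W,
  [/\ [disjoint M & B],
      [/\ U \subset Z, T \subset W & [disjoint Z & W]],
      (forall c x y, (c, [set x; y]) \in M ->
         x \in Z /\ y \in Z \/ x \in W /\ y \in W) /\ allB B Z W,
      #|Z| + #|W| <= 2 + 2 * t
    & ball_in M B i u U /\ ball_in M B i v T].

Definition early i t M B := exists U T, early_at i t U T M B.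

Lemma early_end i t M B : early i t M B -> ~ rainbow_connected M.
Proof.
case=> U [T [Z [W [dMB [UZ TW dZW] [eM _] _ [bU bT]]]]] rc.
have [w [c /and5P[/eqP sz _ /eqP lw uc /(path_adj sz) pw]]] := rc _ _ uv.
have uZ : u \in Z by apply: (subsetP UZ); apply: (bU M [::]).
have vW : v \in W by apply: (subsetP TW); apply: (bT M [::]).
have : last u w \in Z.
  elim: w u uZ {c sz uc lw} pw => //= y w IH x xZ /andP[/existsP[c /eM[[_ yZ]|[xW _]]]].
    exact: IH.
  by move: (disjointFr dZW xZ); rewrite xW.
by rewrite lw => vZ; move: (disjointFr dZW vZ); rewrite vW.
Qed.

(** Once every edge at [U] is claimed, Maker's neighbours of [U] can no longer change, so one more
    radius is frozen. *)
Lemma ball_in_step M B i x U : [disjoint M & B] -> ball_in M B i x U ->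
  estar U setT :&: X \subset M :|: B ->
  ball_in M B i.+1 x (U :|: [set y | [exists z in U, adj M z y]]).
Proof.
move=> dMB bU cl M' w sM d'; case/lastP: w => [|w y] pw sw.
  by rewrite inE (bU M').
move: pw; rewrite last_rcons rcons_path => /andP[pw /existsP[c e]].
have lU : last x w \in U by apply: (bU M') => //; rewrite size_rcons in sw.
rewrite inE; have [<-|ne] := eqVneq (last x w) y; first by rewrite lU.
rewrite !inE; apply/orP; right; apply/existsP; exists (last x w); rewrite lU /=.
apply/existsP; exists c.
have : (c, [set last x w; y]) \in M :|: B.
  by apply: (subsetP cl); rewrite in_setI mem_cboard ne andbT; apply: mem_estar; rewrite ?inE.
by rewrite inE => /orP[//|eB]; move: (disjointFr d' e); rewrite eB.
Qed.

Lemma early_step i t M B U T : early_at i t U T M B ->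
  estar (U :|: T) setT :&: X \subset M :|: B -> early i.+1 t M B.
Proof.
case=> Z [W [dMB [UZ TW dZW] [eM ZW] cs [bU bT]]] cl.
exists (U :|: [set y | [exists z in U, adj M z y]]), (T :|: [set y | [exists z in T, adj M z y]]).
have sE A C : A \subset C -> estar A setT :&: X \subset estar C setT :&: X.
  by move=> sAC; apply: setSI; apply: imsetS; apply: setXS => //; apply: setXS.
exists Z, W; split=> //; last first.
  by split; apply: ball_in_step => //; apply: subset_trans cl; apply: sE; rewrite ?subsetUl ?subsetUr.
split=> //; rewrite subUset ?UZ ?TW /=; apply/subsetP=> y; rewrite inE => /existsP[x /andP[xU /existsP[c e]]].
  case: (eM _ _ _ e) => [[_ //]|[xW _]]; move: (disjointFr dZW (subsetP UZ _ xU)); by rewrite xW.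
case: (eM _ _ _ e) => [[xZ _]|[_ //]]; move: (disjointFr dZW xZ); by rewrite (subsetP TW _ xU).
Qed.

(** The clauses of [late] hold because a Maker edge leaving [U] stays in [Z], and all edges from [Z]
    to [W] are Breaker's. *)
Lemma early_late t M B : early k.-1 t M B -> s * (2 * (2 + 2 * t)) <= b -> late M B.
Proof.
case=> U [T [Z [W [dMB [UZ TW dZW] [eM ZW] cs [bU bT]]]]] hb.
have nZ (x : V) : x \in Z -> x \in W -> False by move=> xZ xW; move: (disjointFr dZW xZ); rewrite xW.
exists U, T; split=> //.
- split; last by move=> z w c zU wT; apply: ZW; [apply: (subsetP UZ)|apply: (subsetP TW)].
  by rewrite (disjointWl UZ) // disjoint_sym (disjointWl TW) // disjoint_sym.
- split=> x y z c c' xU e zT.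
    apply: ZW; last exact: (subsetP TW).
    by case: (eM _ _ _ e) => [[]//|[xW _]]; case: (nZ x) => //; apply: (subsetP UZ).
  apply: (allB_sym ZW); last exact: (subsetP UZ).
  by case: (eM _ _ _ e) => [[xZ _]|[]//]; case: (nZ x) => //; apply: (subsetP TW).
apply: leq_trans hb; rewrite !leq_mul2l; apply/orP; right=> /=.
apply: leq_trans cs; exact: leq_add (subset_leq_card UZ) (subset_leq_card TW).
Qed.

(** A single round: the invariant changes with the stage, so the induction runs over stages and over
    the rounds left in them, not over the play. *)
Lemma not_mwin_step M B : ~ rainbow_connected M ->
  (forall e, e \in X :\: (M :|: B) -> exists S0 : {set Edge},
     [/\ S0 \subset X :\: (e |: M :|: B), #|S0| <= b &
       forall S : {set Edge}, S0 \subset S -> S \subset X :\: (e |: M :|: B) ->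
       ~ mwin X b (@rainbow_connected s n) (e |: M) (B :|: S)]) ->
  ~ mwin X b (@rainbow_connected s n) M B.
Proof.
move=> nP h W; case: W nP h => {M B} [M B _ PM nP _|M B e ef W nP h]; first exact: nP PM.
have [S0 [s0 c0 hS]] := h _ ef.
have [|S [h1 h2 h3]] := @subset_of_card _ _ _ (minn b #|X :\: (e |: M :|: B)|) s0.
  by rewrite leq_min c0 geq_minr subset_leq_card.
by apply: (hS S) => //; apply: W.
Qed.


(** [q] bounds the rounds left in the stage. Half of each reply separates the ends of Maker's new
    edge from the opposite part, the other half reduces the set of free edges at the balls. *)
Lemma early_stage i t1 :
  4 * s * (1 + t1) <= half ->
  (forall t M B, early i.+1 t M B -> t <= t1 -> ~ mwin X b (@rainbow_connected s n) M B) ->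
  forall q t M B U T, early_at i t U T M B ->
    #|(estar (U :|: T) setT :&: X) :\: (M :|: B)| <= half * q -> t + q <= t1 ->
    ~ mwin X b (@rainbow_connected s n) M B.
Proof.
move=> ht1 next; elim=> [|q IH] t M B U T ea fr tq.
  apply: (next t); last by rewrite addn0 in tq.
  by apply: early_step ea _; rewrite -setD_eq0 -cards_eq0 -leqn0 -[0](muln0 half).
apply: not_mwin_step; first by apply: (@early_end i t M B); exists U, T.
move=> e; rewrite in_setD in_setU negb_or => /andP[/andP[eM eB] eX].
have [c [x [y [xy ee]]]] := cboardP eX.
case: (ea) => Z [W [dMB [UZ TW dZW] [hM ZW] cs [bU bT]]].
set Fr := (estar (U :|: T) setT :&: X) :\: (M :|: B) in fr.
(* The new edge joins [W] if it meets [W], and [Z] otherwise. It cannot meet both, the edges between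
   them being Breaker's. *)
have [Z' [W' [sZ sW dZW' eZW [cs' sZW]]]] : exists Z' W', [/\ Z \subset Z', W \subset W',
    [disjoint Z' & W'], x \in Z' /\ y \in Z' \/ x \in W' /\ y \in W' &
    #|Z'| + #|W'| <= 2 + 2 * t.+1 /\
    (forall p q, p \in Z' -> q \in W' -> p \in Z /\ q \in W \/
       p \in [set x; y] /\ q \in Z :|: W \/ q \in [set x; y] /\ p \in Z :|: W)].
  have c2 A : #|[set x; y] :|: A| <= 2 + #|A|.
    by apply: leq_trans (leq_card_setU _ _) _; rewrite cards2 xy.
  case: (boolP ((x \in W) || (y \in W))) => hW.
    exists Z, ([set x; y] :|: W); split=> //; rewrite ?subsetUr //.
    - rewrite disjoint_sym disjointUl disjoint_sym [in X in _ && X]disjoint_sym dZW andbT.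
      apply/pred0P=> p /=; rewrite !inE; apply/negP=> /andP[pZ /orP[] /eqP ep]; subst p.
        case/orP: hW => [xW|yW]; first by move: (disjointFr dZW pZ); rewrite xW.
        by move: eB; rewrite ee ZW.
      case/orP: hW => [xW|yW]; last by move: (disjointFr dZW pZ); rewrite yW.
      by move: eB; rewrite ee (allB_sym ZW).
    - by right; rewrite !inE !eqxx ?orbT.
    - split; first by apply: leq_trans (leq_add (leqnn _) (c2 W)) _; rewrite addnCA mulnS leq_add2l.
      by move=> p r pZ /setUP[rxy|rW]; [right; right; rewrite [p \in _ :|: _]inE pZ|left].
  case/norP: hW => xW yW; exists ([set x; y] :|: Z), W; split=> //; rewrite ?subsetUr //.
  - rewrite disjointUl dZW andbT; apply/pred0P=> p /=; rewrite !inE; apply/negP.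
    by case/andP=> /orP[] /eqP->; apply/negP.
  - by left; rewrite !inE !eqxx ?orbT.
  - split; first by apply: leq_trans (leq_add (c2 Z) (leqnn _)) _; rewrite -addnA mulnS leq_add2l.
    move=> p r /setUP[pxy|pZ] rW; last by left.
    by right; left; rewrite [r \in _ :|: _]inE rW orbT.
have hM' c0 p r : (c0, [set p; r]) \in e |: M -> p \in Z' /\ r \in Z' \/ p \in W' /\ r \in W'.
  rewrite in_setU1 => /orP[/eqP|/hM[] [h1 h2]].
  - rewrite ee => -[_ E]; have := set21 p r; have := set22 p r; rewrite E.
    have in_xy A r0 : x \in A /\ y \in A -> r0 \in [set x; y] -> r0 \in A.
      by move=> [xA yA]; rewrite !inE => /orP[] /eqP->.
    by move=> h1 h2; case: eZW => h; [left|right]; split; apply: in_xy h _.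
  - by left; rewrite !(subsetP sZ).
  - by right; rewrite !(subsetP sW).
set Th := estar [set x; y] (Z :|: W) :&: (X :\: (e |: M :|: B)).
set Fr' := Fr :\: (e |: M :|: B).
have [Q [_ sQ cQ]] := @subset_of_card _ set0 Fr' (minn half #|Fr'|) (sub0set _)
   ltac:(by rewrite cards0 geq_minr).
have sFr' : Fr' \subset X :\: (e |: M :|: B).
  by apply: setSD; apply: (subset_trans (subsetDl _ _)); exact: subsetIr.
exists (Th :|: Q); split.
- by rewrite subUset subsetIr (subset_trans sQ).
- apply: leq_trans (leq_card_setU _ _) _; apply: (@leq_trans (half + half)).
    apply: leq_add; last by rewrite cQ geq_minl.
    apply: leq_trans (subset_leq_card (subsetIl _ _)) _.
    apply: leq_trans (card_estar _ _) _; apply: leq_trans ht1.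
    have := leq_card_setU Z W; rewrite cards2 xy => hZW.
    apply: (@leq_trans (s * (2 * (2 + 2 * t)))); first by rewrite !leq_mul2l (leq_trans hZW) ?orbT.
    have -> : s * (2 * (2 + 2 * t)) = 4 * s * (1 + t) by ring.
    by rewrite leq_mul2l leq_add2l (leq_trans (leq_addr _ _) tq) orbT.
  by rewrite addnn /half halfK leq_subr.
move=> S; rewrite subUset => /andP[sTh sQS] S1.
have ea' : early_at i t.+1 U T (e |: M) (B :|: S).
  exists Z', W'; split=> //.
  - rewrite disjoint_sym disjointUl; apply/andP; split.
      by rewrite disjoint_sym disjointUl disjoints1 eB.
    apply/pred0P=> f /=; apply/negP=> /andP[/(subsetP S1)]; rewrite inE => /andP[+ _].
    by rewrite !inE => /norP[/norP[/negbTE-> /negbTE->]].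
  - by split=> //; [apply: subset_trans sZ|apply: subset_trans sW].
  - split=> // p r c0 pZ rW.
    have [h|nB] := boolP ((c0, [set p; r]) \in B); first by rewrite inE h.
    rewrite inE (subsetP sTh) ?orbT // in_setI; apply/andP; split.
      case: (sZW _ _ pZ rW) => [[h1 h2]|[[h1 h2]|[h1 h2]]].
      - by rewrite ZW in nB.
      - exact: mem_estar.
      - by rewrite setUC; exact: mem_estar.
    have npr : p != r by apply: contraTneq rW => <-; rewrite (disjointFr dZW' pZ).
    rewrite in_setD mem_cboard npr in_setU (negbTE nB) orbF andbT.
    apply/negP=> /hM'[[_ h]|[h _]].
      by move: (disjointFr dZW' h); rewrite rW.
    by move: (disjointFr dZW' pZ); rewrite h.
  - by split; [apply: ball_inS bU|apply: ball_inS bT]; rewrite ?subsetUr ?subsetUl.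
apply: (IH t.+1 _ _ U T ea'); last by rewrite addSnnS.
have : (estar (U :|: T) setT :&: X) :\: (e |: M :|: (B :|: S)) \subset Fr' :\: Q.
  apply/subsetP=> f; rewrite in_setD => /andP[+ fE].
  rewrite in_setU negb_or => /andP[f1]; rewrite in_setU negb_or => /andP[fB fS].
  rewrite in_setD (contra (subsetP sQS f)) //= in_setD in_setU negb_or f1 fB /=.
  rewrite in_setD fE andbT in_setU negb_or fB andbT.
  by apply: contra f1; rewrite in_setU1 => ->; rewrite orbT.
move/subset_leq_card/leq_trans; apply; rewrite cardsD (setIidPr sQ) cQ.
have : #|Fr'| <= half * q.+1 by apply: leq_trans fr; apply: subset_leq_card; exact: subsetDl.
rewrite mulnS; exact: sub_minn_le.
Qed.

Lemma early_lose i t M B : 4 * s * (1 + horizon (k.-1)) <= half -> i <= k.-1 ->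
  early i t M B -> t <= horizon i -> ~ mwin X b (@rainbow_connected s n) M B.
Proof.
move=> hh; have [j ej] : exists j, j = k.-1 - i by exists (k.-1 - i).
elim: j i t M B ej => [|j IH] i t M B ej ik ea ti.
  apply: late_lose; apply: (@early_late t).
    by have -> : k.-1 = i by lia.
  have tk : t <= horizon k.-1 by have -> : k.-1 = i by lia.
    have -> : s * (2 * (2 + 2 * t)) = 4 * s * (1 + t) by ring.
  apply: (@leq_trans half); last by rewrite /half -{2}[b]odd_double_half -addnn addnCA leq_addr.
  by apply: leq_trans hh; rewrite leq_mul2l leq_add2l tk orbT.
have hpos : 0 < half by apply: leq_trans hh; rewrite !muln_gt0 s_gt0.
case: ea => U [T ea].
have ik' : i < k.-1 by rewrite -subn_gt0 -ej.
apply: (@early_stage i (horizon i.+1) _ _ (2 * s * n * (1 + horizon i) %/ half).+1 t _ _ U T ea).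
- apply: leq_trans hh; rewrite leq_mul2l leq_add2l; apply/orP; right.
  elim: k.-1 ik' => // l IHl; rewrite ltnS leq_eqVlt => /orP[/eqP->|/IHl] //.
  by move/leq_trans; apply; apply: leqW; exact: leq_addr.
- by move=> t' M' B' ea' t't; apply: (IH i.+1 t') => //; rewrite subnS -ej.
- apply: leq_trans (subset_leq_card (subsetDl _ _)) _.
  apply: leq_trans (subset_leq_card (subsetIl _ _)) _.
  apply: leq_trans (card_estar _ _) _; rewrite cardsT card_ord.
  case: ea => Z [W [_ [UZ TW _] _ cs _]].
  have cUT : #|U :|: T| <= 2 * (1 + horizon i).
    apply: leq_trans (leq_card_setU _ _) _.
    apply: leq_trans (leq_add (subset_leq_card UZ) (subset_leq_card TW)) _.
    by apply: leq_trans cs _; rewrite mulnDr leq_add2l leq_mul2l ti.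
  apply: (@leq_trans (2 * s * n * (1 + horizon i))).
    have -> : 2 * s * n * (1 + horizon i) = s * ((2 * (1 + horizon i)) * n) by ring.
    by rewrite leq_mul2l leq_mul2r cUT !orbT.
  by rewrite [half * _]mulnC ltnW // ltn_ceil.
- by rewrite /= -addnS leq_add2r.
Qed.

End Endgame.

(* Maker may start by joining any two vertices, so Breaker chooses the pair to
   separate only after her first move. *)
Lemma breaker_wins k : 0 < k -> s <= k.*2 -> 0 < s -> 3 < n ->
  12 * s <= b -> 8 * s * (4 + (2 * s * n) %/ half) ^ k.-1 <= half ->
  ~ maker_wins X b (@rainbow_connected s n).
Proof.
move=> hk sk s0 n4 b12 hb.
have h0 : 0 < half by rewrite /half half_gt0; lia.
have c3 x y u : #|[set u; x; y]| <= 3.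
  by apply: leq_trans (leq_card_setU _ _) _; rewrite cards1 cards2; case: (_ != _).
apply: not_mwin_step.
  move=> rc; have n0 : 0 < n by lia.
  have n1 : 1 < n by lia.
  have [|w [c /and5P[/eqP sz _ /eqP lw _ /(path_adj sz)]]] := rc (Ordinal n0) (Ordinal n1) => //.
  by case: w lw {sz} => //= y w _ /andP[/existsP[c']]; rewrite inE.
move=> e; rewrite in_setD => /andP[_ eX]; have [c [x [y [xy ee]]]] := cboardP eX.
have : 1 < #|~: [set x; y]|.
  by have := cardsC [set x; y]; rewrite card_ord cards2 xy; lia.
case/card_gt1P=> u [v [uxy vxy uv]].
have dZW : [disjoint [set u; x; y] & [set v]].
  by rewrite disjoint_sym disjoints1 !inE eq_sym (negbTE uv) /=; move: vxy; rewrite !inE.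
exists (estar [set u; x; y] [set v] :&: (X :\: (e |: set0 :|: set0))); split.
- exact: subsetIr.
- apply: leq_trans (subset_leq_card (subsetIl _ _)) _.
  apply: leq_trans (card_estar _ _) _; rewrite cards1 muln1; apply: leq_trans b12.
  by rewrite mulnC leq_mul2r (leq_trans (c3 x y u)) ?orbT.
(* Maker's first edge is put on the side of [u]: the parts [{u, x, y}] and [{v}] have four vertices,
   hence [t = 1]. *)
move=> S S0 S1; apply: (@early_lose u v k uv hk sk s0 0 1).
- apply: leq_trans hb; have -> : 8 * s = 4 * s * 2 by ring.
  by rewrite -[4 * s * 2 * _]mulnA leq_mul2l horizon_bound ?orbT.
- by [].
- exists [set u], [set v], [set u; x; y], [set v]; split.
  - rewrite setU0 set0U disjoints1; apply/negP=> /(subsetP S1).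
    by rewrite !inE eqxx.
  - by split=> //; apply/subsetP=> z; rewrite !inE => ->.
  - split=> [c' p q|z w c'].
      rewrite in_setU1 in_set0 orbF => /eqP; rewrite ee => -[_ E]; left.
      have := set21 p q; have := set22 p q; rewrite E !inE.
      by case/orP=> /eqP-> /orP[] /eqP->; rewrite !eqxx ?orbT.
    move=> zZ wW; rewrite set0U (subsetP S0) // in_setI mem_estar //=.
    have wv : w = v by apply/set1P.
    rewrite in_setD mem_cboard !setU0 in_set1; apply/andP; split.
      apply/eqP; rewrite ee => -[_ E]; move: vxy; rewrite -E !inE wv eqxx orbT //.
    by apply: contraTneq zZ => ->; rewrite (disjointFl dZW).
  - by rewrite cards1; apply: (@leq_add _ _ 3 1) => //; exact: c3.
  - by split=> M' [|z w] //= _ _ _ _; rewrite inE.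
- by [].
Qed.
End Breaker.

Import Order.TTheory GRing.Theory Num.Theory.
Local Open Scope ring_scope.

(** * Exponential-like functions and random walks *)

Section ExpLike.
Variables (R : realFieldType) (ex : R -> R).
Hypotheses (exD : forall x y, ex (x + y) = ex x * ex y) (ex_ge : forall x, 1 + x <= ex x).

(** The functional equation leaves the values 0 and 1, and [1 + 0 <= ex 0] excludes 0. The estimates
    below rest on these two properties alone. *)
Lemma ex0 : ex 0 = 1.
Proof.
have h : ex 0 * (ex 0 - 1) = 0 by rewrite mulrBr -exD addr0 mulr1 subrr.
have := ex_ge 0; rewrite addr0 => h1; nra.
Qed.

Lemma ex_gt0 x : 0 < ex x.
Proof.
have h : ex x * ex (- x) = 1 by rewrite -exD subrr ex0.
have h2 : ex x = ex (x / 2) ^+ 2 by rewrite expr2 -exD -splitr.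
rewrite lt0r {2}h2 sqr_ge0 andbT; apply: contra_eq_neq h => ->.
by rewrite mul0r eq_sym oner_neq0.
Qed.

Lemma exN x : ex (- x) = (ex x)^-1.
Proof.
apply: (mulfI (lt0r_neq0 (ex_gt0 x))).
by rewrite -exD subrr ex0 divff // lt0r_neq0 // ex_gt0.
Qed.

Lemma ex_le x y : x <= y -> ex x <= ex y.
Proof.
move=> xy; rewrite -(subrK x y) exD ler_peMl ?(ltW (ex_gt0 _)) //.
by apply: le_trans (ex_ge _); lra.
Qed.

Lemma ex_lt x y : x < y -> ex x < ex y.
Proof.
move=> xy; rewrite -(subrK x y) exD ltr_pMl ?ex_gt0 //.
by apply: lt_le_trans (ex_ge _); lra.
Qed.

Lemma ex_ltP x y : ex x < ex y -> x < y.
Proof. by move=> h; rewrite ltNge; apply/negP=> /ex_le; lra. Qed.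

Lemma ex_inv_bound x : x < 1 -> ex x <= (1 - x)^-1.
Proof.
move=> x1; have h := ex_ge (- x).
rewrite -[x]opprK exN lef_pV2 ?posrE ?ex_gt0 //; [lra|lra].
Qed.

Lemma ex_neg_half x : 0 <= x <= 1 -> ex (- x) <= 1 - x / 2.
Proof.
case/andP=> x0 x1; have h := ex_ge x; have p : 0 < 1 - x / 2 by lra.
rewrite exN -[1 - x / 2]invrK lef_pV2 ?posrE ?invr_gt0 ?ex_gt0 //.
apply: le_trans h; rewrite -[leLHS]mul1r ler_pdivrMr //; nra.
Qed.

Lemma ex_pos_double x : 0 <= x <= 1 / 2 -> ex x <= 1 + 2 * x.
Proof.
case/andP=> x0 x1; apply: le_trans (ex_inv_bound _) _; first lra.
rewrite -[leLHS]mul1r ler_pdivrMr; [nra|lra].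
Qed.

Lemma ex_pos3 x : 0 <= x <= 1 -> ex x <= 1 + 3 * x.
Proof.
case/andP=> x0 x1; rewrite (splitr x) exD.
have h : 0 <= x / 2 <= 1 / 2 by lra.
have := ex_pos_double h; have := ex_gt0 (x / 2); nra.
Qed.
End ExpLike.

(** * Walks through random slots, and derandomisation *)

Section Walks.
Variables (R : realFieldType) (n s D m : nat) (emb : 'I_s.+1 -> 'I_m -> 'I_n).
Hypothesis emb_inj : forall a y a' y', emb a y = emb a' y' -> (a, y) = (a', y').

(* A key (c, a) asks for an edge of colour c into class a, the vertices of class a
   being emb a y.  A box is an apex with a key; it has D slots, and w maps each
   slot to the index of the vertex it leads to.  A history lists the revealed
   slots, latest first, with Breaker's edges at the time of the revelation. *)
Notation V := 'I_n.
Notation Edge := ('I_s * {set V})%type.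
Notation Key := ('I_s * 'I_s.+1)%type.
Notation Box := (V * Key)%type.
Notation Slot := (V * Key * 'I_D)%type.
Notation Om := {ffun Slot -> 'I_m}.
Notation hist := (seq (Slot * {set Edge})).
Implicit Types (w : Om) (p : seq Key) (x : V) (q : seq Slot) (sl : Slot) (h : hist) (B : {set Edge}) (be : Box).

Definition tgt (w : Om) (sl : Slot) : V := emb sl.1.2.2 (w sl).
Definition sedge (be : Box) (y : V) : Edge := (be.2.1, [set be.1; y]).

Fixpoint walks (w : Om) (p : seq Key) (x : V) : seq (seq Slot) :=
  if p is k :: p' then
    [seq sl :: q | sl <- [seq (x, k, l) | l <- enum 'I_D], q <- walks w p' (tgt w sl)]
  else [:: [::]].

Definition wend (w : Om) (x : V) (q : seq Slot) : V := last x (map (tgt w) q).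

Lemma sum_walks0 w x (F : seq Slot -> R) : \sum_(q <- walks w [::] x) F q = F [::].
Proof. by rewrite big_seq1. Qed.

Lemma sum_walks_cons w k p x (F : seq Slot -> R) : \sum_(q <- walks w (k :: p) x) F q =
  \sum_(l < D) \sum_(q <- walks w p (tgt w (x, k, l))) F ((x, k, l) :: q).
Proof. by rewrite /= big_allpairs_dep big_map big_enum. Qed.

Lemma sum_walks_cat w p p' x (F : seq Slot -> R) : \sum_(q <- walks w (p ++ p') x) F q =
  \sum_(q <- walks w p x) \sum_(q' <- walks w p' (wend w x q)) F (q ++ q').
Proof.
elim: p x F => [|k p IH] x F; first by rewrite sum_walks0.
rewrite cat_cons !sum_walks_cons; apply: eq_bigr => l _.
by rewrite (IH _ (fun q => F ((x, k, l) :: q))).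
Qed.

Lemma size_walks w p x : size (walks w p x) = expn D (size p).
Proof.
elim: p x => [|k p IH] x //=; rewrite size_allpairs_dep -map_comp.
rewrite (eq_map (g := fun=> expn D (size p))) => [|l /=]; last exact: IH.
rewrite expnS; transitivity (size (enum 'I_D) * expn D (size p))%N.
  by elim: (enum _) => //= a e ->; rewrite mulSn.
by rewrite size_enum_ord.
Qed.

Lemma walks_keys w p x q : q \in walks w p x -> map (fun sl => sl.1.2) q = p.
Proof.
elim: p x q => [|k p IH] x q /=; first by rewrite inE => /eqP->.
by case/allpairsPdep=> sl [q' [/mapP[l _ ->] /IH <- ->]].
Qed.

Lemma walks_uniq w p x : uniq (walks w p x).
Proof.
elim: p x => //= k p IH x; apply: allpairs_uniq_dep => //.
- by rewrite map_inj_uniq ?enum_uniq // => l l' [].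
- by move=> [a q] [a' q'] _ _ /= [-> ->].
Qed.

Lemma walks_eq w w' p x : (forall sl, sl.1.2 \in p -> w sl = w' sl) ->
  walks w p x = walks w' p x.
Proof.
elim: p x => //= k p IH x h; congr flatten.
rewrite -!map_comp; apply: eq_map => l /=.
rewrite /tgt (h (x, k, l)) ?mem_head // IH // => sl hs.
by apply: h; rewrite inE hs orbT.
Qed.

Lemma wend_eq w w' x q : {in q, forall sl, w sl = w' sl} -> wend w x q = wend w' x q.
Proof. by move=> h; rewrite /wend; congr (last x _); apply/eq_in_map => sl /h; rewrite /tgt => ->. Qed.

Lemma sum_walks_agree (S : pred Slot) w w' p x (F : seq Slot -> R) :
  (forall sl, S sl -> w sl = w' sl) ->
  \sum_(q <- walks w p x | all S q) F q = \sum_(q <- walks w' p x | all S q) F q.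
Proof.
move=> h; rewrite big_mkcond [RHS]big_mkcond /=.
elim: p x F => [|k p IH] x F; first by rewrite !sum_walks0.
rewrite !sum_walks_cons; apply: eq_bigr => l _ /=.
case: (boolP (S _)) => [hS|_] /=; last by rewrite !big1.
by rewrite (IH _ (fun q => F (_ :: q))) /tgt h.
Qed.

Definition upd (w : Om) (sl : Slot) y : Om := [ffun z => if z == sl then y else w z].

Lemma updE w sl y z : upd w sl y z = if z == sl then y else w z.
Proof. by rewrite ffunE. Qed.

Lemma upd_id w sl y : upd w sl y sl = y.
Proof. by rewrite updE eqxx. Qed.

Lemma upd_out w sl y z : z != sl -> upd w sl y z = w z.
Proof. by rewrite updE => /negbTE->. Qed.

Definition rvl (h : hist) : seq Slot := map fst h.

Fixpoint ents (h : hist) : seq (Slot * {set Edge} * hist) :=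
  if h is e :: h0 then (e, h0) :: ents h0 else [::].

(** Repeated values count as waste so that an unwasted walk can be recovered from its vertices
    ([walks_inj]). *)
Definition wasted (h : hist) (sl : Slot) (B : {set Edge}) (w : Om) :=
  (sedge sl.1 (tgt w sl) \in B) || has (fun e => (e.1.1 == sl.1) && (w e.1 == w sl)) h.

Definition complete (h : hist) (be : Box) := [forall l : 'I_D, (be, l) \in rvl h].

Variable em : nat.

Definition valid (h : hist) (B : {set Edge}) := forall be, ~~ complete h be ->
  (#|[set y : 'I_m | sedge be (emb be.2.2 y) \in B]| <= em)%N.

Fixpoint hist_ok (h : hist) : Prop := if h is e :: h0 then
  [/\ e.1 \notin rvl h0, valid h0 e.2, (forall e', e' \in h0 -> e'.2 \subset e.2) & hist_ok h0]
  else True.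

(** The supermartingale inequality for the slot just revealed, demanded for every fixed choice of
    the other values, unrevealed ones included. This is stronger than an inequality in conditional
    mean, and lets functions of slots with other keys pass as constants. *)
Definition super (F : hist -> Om -> R) := forall h e w, hist_ok (e :: h) ->
  \sum_y F (e :: h) (upd w e.1 y) <= \sum_y F h (upd w e.1 y).

Lemma super_sum (I : Type) (r : seq I) (F : I -> hist -> Om -> R) :
  (forall i, super (F i)) -> super (fun h w => \sum_(i <- r) F i h w).
Proof.
move=> hF h e w he; rewrite exchange_big [leRHS]exchange_big /=.
by apply: ler_sum => i _; apply: hF.
Qed.

Lemma super_add F G : super F -> super G -> super (fun h w => F h w + G h w).
Proof. by move=> hF hG h e w he; rewrite !big_split /= lerD ?hF ?hG. Qed.

Definition agree (h : hist) (w w' : Om) := all (fun e => w' e.1 == w e.1) h.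

Lemma agree_cons h e w y w' : e.1 \notin rvl h ->
  agree (e :: h) (upd w e.1 y) w' = (w' e.1 == y) && agree h w w'.
Proof.
move=> eh; rewrite /agree /= upd_id; congr andb; apply: eq_in_all => e' he'.
rewrite upd_out //; apply: contraNneq eh => <-; exact: map_f.
Qed.

(** Resampling one unrevealed slot; [y0] merely selects a representative of each fibre. *)
Lemma agree_fiber h sl w y0 (F : Om -> R) : sl \notin rvl h ->
  \sum_(w' | agree h w w') F w' =
  \sum_(w' | agree h w w' && (w' sl == y0)) \sum_y F (upd w' sl y).
Proof.
move=> slh; rewrite exchange_big /= (partition_big (fun w' : Om => w' sl) xpredT) //=.
have upd_agree w1 y : agree h w (upd w1 sl y) = agree h w w1.
  apply: eq_in_all => e' he'; rewrite upd_out //; apply: contraNneq slh => <-; exact: map_f.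
apply: eq_bigr => y _; rewrite (reindex_onto (fun w' => upd w' sl y) (fun w' => upd w' sl y0)) /=.
  apply: eq_bigl => w'; rewrite upd_agree upd_id eqxx andbT; congr andb.
  apply/eqP/eqP=> [<-|<-]; first by rewrite upd_id.
  by apply/ffunP=> z; rewrite !updE; case: eqP => // ->.
move=> w' /andP[_ /eqP <-]; apply/ffunP=> z; rewrite !updE; case: eqP => // ->.
by [].
Qed.

(** The method of conditional expectations. A negative sum of [F - 1] over all completions says that
    their mean is below 1 without dividing by their number. *)
Lemma choose_value F h e w : super F -> hist_ok (e :: h) -> (0 < m)%N ->
  \sum_(w' | agree h w w') (F h w' - 1) < 0 ->
  exists y, \sum_(w' | agree (e :: h) (upd w e.1 y) w') (F (e :: h) w' - 1) < 0.
Proof.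
move=> sF he m0 hneg; have y0 := Ordinal m0; have eh : e.1 \notin rvl h by case: he.
have : \sum_y \sum_(w' | agree (e :: h) (upd w e.1 y) w') (F (e :: h) w' - 1) < 0.
  have -> : \sum_y \sum_(w' | agree (e :: h) (upd w e.1 y) w') (F (e :: h) w' - 1) =
     \sum_(w' | agree h w w') (F (e :: h) w' - 1).
    rewrite [RHS](partition_big (fun w' : Om => w' e.1) xpredT) //=.
    by apply: eq_bigr => y _; apply: eq_bigl => w'; apply: etrans (agree_cons _ _ _ eh) (andbC _ _).
  apply: le_lt_trans hneg; rewrite !(agree_fiber _ y0 _ eh); apply: ler_sum => w' _.
  by rewrite !sumrB lerB // sF.
move=> hs; case: (pickP (fun y => \sum_(w' | agree (e :: h) (upd w e.1 y) w') (F (e :: h) w' - 1) < 0))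
  => [y hy|h0]; first by exists y.
move: hs; rewrite ltNge => /negP[]; apply: sumr_ge0 => y _.
by rewrite leNgt h0.
Qed.
End Walks.

(** * Supermartingale estimates *)

Lemma sum_bool_card (T : finType) (P : pred T) : (\sum_x (P x : nat) = #|[set x | P x]|)%N.
Proof. by rewrite -sum1dep_card [RHS]big_mkcond; apply: eq_bigr => x _; case: (P x). Qed.

Section Mean.
Variables (R : realFieldType) (ex : R -> R).
Hypotheses (exD : forall x y, ex (x + y) = ex x * ex y) (ex_ge : forall x, 1 + x <= ex x).
Variable m : nat.
Hypothesis m_gt0 : (0 < m)%N.

Let mR_gt0 : 0 < m%:R :> R. Proof. by rewrite ltr0n. Qed.

(** On the unit interval [ex f <= 1 + 3 * f], so the mean of [ex f] is at most [ex (3 * mu)]: upper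
    tails pay three times the mean. *)
Lemma mean_upper (f : 'I_m -> R) mu : (forall y, 0 <= f y <= 1) -> \sum_y f y <= m%:R * mu ->
  \sum_y ex (f y - 3 * mu) <= m%:R.
Proof.
move=> f01 fm; under eq_bigr do rewrite exD; rewrite -mulr_suml.
have h1 : \sum_y ex (f y) <= m%:R * ex (3 * mu).
  apply: (@le_trans _ _ (\sum_y (1 + 3 * f y))).
    by apply: ler_sum => y _; apply: ex_pos3.
  rewrite big_split /= sumr_const card_ord -mulr_sumr.
  by apply: (@le_trans _ _ (m%:R * (1 + 3 * mu))); [lra|rewrite ler_wpM2l ?ex_ge ?ler0n].
apply: le_trans (ler_wpM2r (ltW (ex_gt0 exD ex_ge _)) h1) _.
by rewrite -mulrA -exD subrr (ex0 exD ex_ge) mulr1.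
Qed.

(** On the unit interval [ex (- f) <= 1 - f / 2], so lower tails keep half of the mean. *)
Lemma mean_lower (f : 'I_m -> R) : (forall y, 0 <= f y <= 1) ->
  \sum_y ex (- f y + (\sum_y f y) / (2 * m%:R)) <= m%:R.
Proof.
move=> f01; set S := \sum_y f y; under eq_bigr do rewrite exD; rewrite -mulr_suml.
set mu := _ / _; have Smu : S = 2 * m%:R * mu.
  by rewrite /mu mulrC divfK // mulf_neq0 ?lt0r_neq0 // pnatr_eq0.
have h1 : \sum_y ex (- f y) <= m%:R * ex (- mu).
  apply: (@le_trans _ _ (\sum_y (1 - f y / 2))).
    by apply: ler_sum => y _; apply: ex_neg_half.
  rewrite big_split /= sumr_const card_ord sumrN -mulr_suml -/S Smu.
  by apply: (@le_trans _ _ (m%:R * (1 - mu))); [lra|rewrite ler_wpM2l ?ex_ge ?ler0n].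
apply: le_trans (ler_wpM2r (ltW (ex_gt0 exD ex_ge _)) h1) _.
by rewrite -mulrA -exD addNr (ex0 exD ex_ge) mulr1.
Qed.

(** Convexity from the tangent at [t * x]: its bound at [x] with weight [t] plus its bound at 0 with
    weight [1 - t]. *)
Lemma ex_chord t x : 0 <= t <= 1 -> ex (t * x) <= 1 + t * (ex x - 1).
Proof.
case/andP=> t0 t1; have e0 := ex_gt0 exD ex_ge (t * x).
have h1 : ex (t * x) * (1 + (x - t * x)) <= ex x.
  have -> : ex x = ex (t * x) * ex (x - t * x) by rewrite -exD; congr ex; ring.
  by apply: ler_wpM2l; [exact: ltW|exact: ex_ge].
have h2 : ex (t * x) * (1 - t * x) <= 1.
  have E1 : ex (t * x) * ex (- (t * x)) = 1 by rewrite -exD subrr (ex0 exD ex_ge).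
  rewrite -[leRHS]E1.
  by apply: ler_wpM2l; [exact: ltW|exact: ex_ge].
have q0 : 0 <= 1 - t by lra.
by have := ler_wpM2l t0 h1; have := ler_wpM2l q0 h2; lra.
Qed.
End Mean.

(** * Exponential potentials attached to one key *)

Section Comps.
Variables (R : realFieldType) (ex : R -> R).
Hypotheses (exD : forall x y, ex (x + y) = ex x * ex y) (ex_ge : forall x, 1 + x <= ex x).
Variables (n s D m : nat) (emb : 'I_s.+1 -> 'I_m -> 'I_n).
Hypothesis emb_inj : forall a y a' y', emb a y = emb a' y' -> (a, y) = (a', y').
Hypotheses (m_gt0 : (0 < m)%N) (D_gt0 : (0 < D)%N).
Variables (em : nat) (L : R).
Hypothesis L_ge0 : 0 <= L.

Notation V := 'I_n.
Notation Edge := ('I_s * {set V})%type.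
Notation Key := ('I_s * 'I_s.+1)%type.
Notation Box := (V * Key)%type.
Notation Slot := (V * Key * 'I_D)%type.
Notation Om := {ffun Slot -> 'I_m}.
Notation hist := (seq (Slot * {set Edge})).
Notation tgt := (tgt emb).
Notation walks := (walks emb).
Notation wend := (wend emb).
Notation wasted := (wasted emb).
Notation hist_ok := (hist_ok emb em).
Notation valid := (valid emb em).
Notation super := (@super R n s D m emb em).
Implicit Types (w : Om) (p : seq Key) (x u v z : V) (q : seq Slot) (sl : Slot) (h : hist) (B : {set Edge}) (be : Box) (k : Key).

Let mR_gt0 : 0 < m%:R :> R. Proof. by rewrite ltr0n. Qed.
Let DR_gt0 : 0 < D%:R :> R. Proof. by rewrite ltr0n. Qed.

Lemma rvl_ents h : [seq e.1.1 | e <- ents h] = rvl h.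
Proof. by elim: h => //= e h ->. Qed.

Lemma ents_rvl h e : e \in ents h -> e.1.1 \in rvl h.
Proof. by move=> he; rewrite -rvl_ents; apply/mapP; exists e. Qed.

Lemma ents_sub h e : e \in ents h -> {subset rvl e.2 <= rvl h}.
Proof.
elim: h e => //= e0 h IH e; rewrite inE => /orP[/eqP->|/IH sub] sl /= hs; rewrite inE ?hs ?orbT //.
by rewrite sub ?orbT.
Qed.

Lemma rvl_uniq h : hist_ok h -> uniq (rvl h).
Proof. by elim: h => //= e h IH [-> _ _ /IH]. Qed.

Lemma ents_ok h e : hist_ok h -> e \in ents h -> hist_ok (e.1 :: e.2).
Proof. by elim: h e => //= e0 h IH e hok; rewrite inE => /orP[/eqP->//|]; apply: IH; case: hok. Qed.

Lemma ents_inj h e e' : hist_ok h -> e \in ents h -> e' \in ents h -> e.1.1 = e'.1.1 -> e = e'.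
Proof.
elim: h e e' => //= e0 h IH e e' [ne _ _ hok]; rewrite !inE.
case/orP=> [/eqP->|he] /orP[/eqP->|he'] //= E; last exact: IH.
  by move: ne; rewrite E ents_rvl.
by move: ne; rewrite -E ents_rvl.
Qed.

Lemma ents_ex h sl : sl \in rvl h -> exists2 e, e \in ents h & e.1.1 = sl.
Proof. by rewrite -rvl_ents => /mapP[e he ->]; exists e. Qed.

Definition Scomp k (g : hist -> Slot -> {set Edge} -> Om -> R) h w :=
  \sum_(e <- ents h | e.1.1.1.2 == k) g e.2 e.1.1 e.1.2 w.

(** It starts at [ex (- L)], and a final value below 1 certifies that the increments sum to less
    than [L]. So [L] is the common price of the union bound. *)
Definition Jcomp k g h w := ex (Scomp k g h w - L).

(** By the first hypothesis the increments already present do not see the new slot; by the second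
    the new factor has mean at most 1. Slots of other keys add no term. *)
Lemma Jcomp_super k g :
  (forall h sl B w sl' y, sl.1.2 = k -> sl'.1.2 = k -> sl' \notin rvl h -> sl' != sl ->
     g h sl B (upd w sl' y) = g h sl B w) ->
  (forall h sl B w, hist_ok ((sl, B) :: h) -> sl.1.2 = k ->
     \sum_y ex (g h sl B (upd w sl y)) <= m%:R) ->
  super (Jcomp k g).
Proof.
move=> loc mean h [sl B] w hok; case: (hok) => slh _ _ _.
rewrite /Jcomp /Scomp /=.
case: (eqVneq sl.1.2 k) => [ek|nk]; last first.
  by apply: ler_sum => y _; rewrite big_cons /= (negbTE nk).
have E y : \sum_(e <- ents h | e.1.1.1.2 == k) g e.2 e.1.1 e.1.2 (upd w sl y) = Scomp k g h w.
  rewrite /Scomp big_seq_cond [RHS]big_seq_cond; apply: eq_bigr => e /andP[he /eqP ke].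
  apply: loc => //; first by apply: contra slh; apply: ents_sub.
  by apply: contraNneq slh => ->; apply: ents_rvl.
under eq_bigr => y _ do rewrite big_cons /= ek eqxx E -addrA exD.
rewrite -mulr_suml; under [leRHS]eq_bigr do rewrite E.
rewrite sumr_const card_ord -[_ *+ m]mulr_natl; apply: ler_wpM2r.
  exact: ltW (ex_gt0 exD ex_ge _).
exact: mean.
Qed.

Lemma Jcomp_lt1 k g h w : Jcomp k g h w < 1 -> Scomp k g h w < L.
Proof. by rewrite /Jcomp -(ex0 exD ex_ge) => /(ex_ltP exD ex_ge); lra. Qed.

Definition cw w p x z : R := \sum_(q <- walks w p x) (wend w x q == z)%:R.

Lemma cw_ge0 w p x z : 0 <= cw w p x z.
Proof. exact: sumr_ge0. Qed.

Lemma sum_wend w p x (G : V -> R) : \sum_(q <- walks w p x) G (wend w x q) = \sum_z cw w p x z * G z.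
Proof.
under [RHS]eq_bigr do rewrite mulr_suml.
rewrite exchange_big /=; apply: eq_bigr => q _.
rewrite (bigD1 (wend w x q)) //= eqxx mul1r big1 ?addr0 // => z.
by rewrite eq_sym => /negbTE->; rewrite mul0r.
Qed.

Lemma sum_cw w p x : \sum_z cw w p x z = D%:R ^+ size p.
Proof.
under eq_bigr do rewrite -[cw _ _ _ _]mulr1.
rewrite -(sum_wend _ _ _ (fun=> 1)) big_const_seq count_predT size_walks.
by rewrite -natrX iter_addr_0.
Qed.

Lemma cw_le w p x z : cw w p x z <= D%:R ^+ size p.
Proof. by rewrite -(sum_cw w p x) (bigD1 z) //= lerDl sumr_ge0 // => ? _; apply: cw_ge0. Qed.

Lemma cw_nil w x z : cw w [::] x z = (x == z)%:R.
Proof. by rewrite /cw sum_walks0. Qed.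

Lemma cw_cons w k p x z : cw w (k :: p) x z = \sum_(l < D) cw w p (tgt w (x, k, l)) z.
Proof. by rewrite /cw sum_walks_cons. Qed.

Lemma wend_cat w x q q' : wend w x (q ++ q') = wend w (wend w x q) q'.
Proof. by rewrite /wend map_cat last_cat. Qed.

Lemma cw_cat w p p' x z : cw w (p ++ p') x z = \sum_y cw w p x y * cw w p' y z.
Proof.
rewrite /cw sum_walks_cat -(sum_wend w p x (fun y => \sum_(q' <- walks w p' y) (wend w y q' == z)%:R)).
by apply: eq_bigr => q _; apply: eq_bigr => q' _; rewrite wend_cat.
Qed.

Lemma walks_upd w sl y p x : sl.1.2 \notin p -> walks (upd w sl y) p x = walks w p x.
Proof. by move=> hk; apply: walks_eq => sl' hs; rewrite upd_out //; apply: contraNneq hk => <-. Qed.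

Lemma wend_upd w sl y p x q : sl.1.2 \notin p -> q \in walks w p x ->
  wend (upd w sl y) x q = wend w x q.
Proof.
move=> hk hq; apply: wend_eq => sl' hs; rewrite upd_out //; apply: contraNneq hk => <-.
by rewrite -(walks_keys hq); apply/mapP; exists sl'.
Qed.

Lemma cw_upd w sl y p x z : sl.1.2 \notin p -> cw (upd w sl y) p x z = cw w p x z.
Proof.
move=> hk; rewrite /cw walks_upd // big_seq [RHS]big_seq; apply: eq_bigr => q hq.
by rewrite (wend_upd _ hk hq).
Qed.

Definition full h := forall sl : Slot, sl \in rvl h.

Lemma sum_key k (G : Slot -> R) : \sum_(sl | sl.1.2 == k) G sl = \sum_x \sum_(l < D) G (x, k, l).
Proof.
rewrite pair_big /= (reindex_onto (fun xl : V * 'I_D => (xl.1, k, xl.2)) (fun sl => (sl.1.1, sl.2))) /=.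
  by apply: eq_bigl => -[x l] /=; rewrite !eqxx.
by move=> [[x k'] l] /= /eqP->.
Qed.

Lemma sum_ents_full h k (G : Slot -> R) (hok : hist_ok h) (hf : full h) :
  \sum_(e <- ents h | e.1.1.1.2 == k) G e.1.1 = \sum_x \sum_(l < D) G (x, k, l).
Proof.
rewrite -sum_key -(big_map (fun e => e.1.1) (fun sl : Slot => sl.1.2 == k) G) rvl_ents.
rewrite -big_filter -[RHS]big_filter; apply: perm_big; apply: uniq_perm.
- by rewrite filter_uniq // rvl_uniq.
- by rewrite filter_uniq // index_enum_uniq.
- by move=> sl; rewrite !mem_filter hf mem_index_enum.
Qed.

Definition wst h w sl := has (fun e => (e.1.1 == sl) && wasted e.2 sl e.1.2 w) (ents h).

Lemma wst_ents h w e : hist_ok h -> e \in ents h -> wst h w e.1.1 = wasted e.2 e.1.1 e.1.2 w.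
Proof.
move=> hok he; apply/hasP/idP=> [[e' he' /andP[/eqP E]]|hw].
  by rewrite (ents_inj hok he' he E).
by exists e => //; rewrite eqxx.
Qed.

(** * Wasted slots *)

Section Waste.
Variables (u : V) (p1 : seq Key) (k : Key).
Hypothesis kp1 : k \notin p1.

(** Of the [m] values of a slot at most [em] lead to Breaker's edges, the box being unfinished, and
    at most [D] repeat an earlier value. *)
Definition waste_bound : R := (em + D)%:R / m%:R.

(** A slot is weighted by the share of walks along [p1] that arrive at its box, so that the sum
    counts wasted steps of walks from [u]. *)
Definition gwaste h sl B w : R := cw w p1 u sl.1.1 / D%:R ^+ size p1 * (wasted h sl B w)%:R
   - 3 * (cw w p1 u sl.1.1 / D%:R ^+ size p1 * waste_bound).

Let cw01 w x : 0 <= cw w p1 u x / D%:R ^+ size p1 <= 1.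
Proof.
rewrite divr_ge0 ?cw_ge0 ?exprn_ge0 ?ler0n //=.
by rewrite ler_pdivrMr ?exprn_gt0 // mul1r cw_le.
Qed.

Lemma wasted_upd h sl B w sl' y : sl' \notin rvl h -> sl' != sl ->
  wasted h sl B (upd w sl' y) = wasted h sl B w.
Proof.
move=> hs ne; rewrite /wasted /tgt !upd_out 1?eq_sym //; congr orb; apply: eq_in_has => e he.
by rewrite upd_out //; apply: contraNneq hs => <-; apply: map_f.
Qed.

Lemma sum_wasted h sl B w : hist_ok ((sl, B) :: h) ->
  \sum_y (wasted h sl B (upd w sl y))%:R <= (em + D)%:R :> R.
Proof.
case=> /= slh hv _ _; rewrite -natr_sum ler_nat sum_bool_card.
have hb := hv sl.1; set A := [set y | _] in hb.
have sub : [set y | wasted h sl B (upd w sl y)] \subset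
     A :|: [set w (sl.1, l) | l : 'I_D].
  apply/subsetP=> y; rewrite !inE /wasted /tgt upd_id => /orP[->//|/hasP[e he /andP[/eqP e1 /eqP e2]]].
  apply/orP; right; apply/imsetP; exists e.1.2 => //.
  rewrite -e2 upd_out -?e1; last by apply: contraNneq slh => <-; apply: map_f.
  by case: (e) => -[].
apply: leq_trans (subset_leq_card sub) _; apply: leq_trans (leq_card_setU _ _) _.
apply: leq_add; last by apply: leq_trans (leq_imset_card _ _) _; rewrite card_ord.
apply: hb; apply: contra slh => /forallP/(_ sl.2); by case: (sl).
Qed.

Lemma waste_super : super (Jcomp k gwaste).
Proof.
apply: Jcomp_super => [h sl B w sl' y e1 e2 hs ne|h sl B w hok ek].
  by rewrite /gwaste cw_upd ?e2 // wasted_upd.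
rewrite /gwaste; under eq_bigr do rewrite cw_upd ?ek //.
have /andP[c0 c1] := cw01 w sl.1.1.
apply: (mean_upper exD ex_ge
  (f := fun y => cw w p1 u sl.1.1 / D%:R ^+ size p1 * (wasted h sl B (upd w sl y))%:R)) => [y|].
  by case: (wasted _ _ _ _); rewrite ?mulr1 ?mulr0 ?c0 ?lexx ?ler01.
rewrite -mulr_sumr mulrCA ler_wpM2l // /waste_bound mulrC divfK ?lt0r_neq0 //.
exact: sum_wasted.
Qed.

Lemma waste_final h w : hist_ok h -> full h -> Jcomp k gwaste h w < 1 ->
  \sum_x \sum_(l < D) cw w p1 u x * (wst h w (x, k, l))%:R <=
    D%:R ^+ (size p1).+1 * (3 * waste_bound + L / D%:R).
Proof.
move=> hok hf /Jcomp_lt1; rewrite /Scomp sumrB.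
set S1 := \sum_(e <- ents h | _) _; set S2 := \sum_(e <- ents h | _) _.
have E1 : S1 = (\sum_x \sum_(l < D) cw w p1 u x * (wst h w (x, k, l))%:R) / D%:R ^+ size p1.
  rewrite mulr_suml; under [RHS]eq_bigr do rewrite mulr_suml.
  rewrite -(sum_ents_full k (fun sl => cw w p1 u sl.1.1 * (wst h w sl)%:R / D%:R ^+ size p1) hok hf).
  rewrite /S1 [LHS]big_seq_cond [RHS]big_seq_cond; apply: eq_bigr => e /andP[he _].
  by rewrite wst_ents // mulrAC.
have E2 : S2 = 3 * waste_bound * D%:R.
  rewrite /S2 (sum_ents_full k (fun sl => 3 * (cw w p1 u sl.1.1 / D%:R ^+ size p1 * waste_bound)) hok hf) /=.
  under eq_bigr do rewrite sumr_const card_ord.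
  rewrite sumrMnl -mulr_sumr -!mulr_suml sum_cw divff ?mul1r ?mulr_natr //.
  by rewrite expf_neq0 // lt0r_neq0.
rewrite E1 E2 => /ltW; rewrite lerBlDr ler_pdivrMr ?exprn_gt0 // => /le_trans; apply.
have -> // : D%:R ^+ (size p1).+1 * (3 * waste_bound + L / D%:R) =
  (L + 3 * waste_bound * D%:R) * D%:R ^+ size p1.
by rewrite exprS; field; rewrite lt0r_neq0.
Qed.
End Waste.
End Comps.

Section Concentration.
Variables (R : realFieldType) (ex : R -> R).
Hypotheses (exD : forall x y, ex (x + y) = ex x * ex y) (ex_ge : forall x, 1 + x <= ex x).
Variables (n s D m : nat) (emb : 'I_s.+1 -> 'I_m -> 'I_n).
Hypothesis emb_inj : forall a y a' y', emb a y = emb a' y' -> (a, y) = (a', y').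
Hypotheses (m_gt0 : (0 < m)%N) (D_gt0 : (0 < D)%N).
Variables (em : nat) (L : R).
Hypothesis L_ge0 : 0 <= L.

Notation V := 'I_n.
Notation Edge := ('I_s * {set V})%type.
Notation Key := ('I_s * 'I_s.+1)%type.
Notation Box := (V * Key)%type.
Notation Slot := (V * Key * 'I_D)%type.
Notation Om := {ffun Slot -> 'I_m}.
Notation hist := (seq (Slot * {set Edge})).
Notation tgt := (tgt emb).
Notation walks := (walks emb).
Notation wend := (wend emb).
Notation wasted := (wasted emb).
Notation hist_ok := (hist_ok emb em).
Notation valid := (valid emb em).
Notation super := (@super R n s D m emb em).
Notation cw := (@cw R n s D m emb).
Notation Jcomp := (@Jcomp R ex n s D m L).
Notation wst := (wst emb).
Implicit Types (w : Om) (p : seq Key) (x u v z : V) (q : seq Slot) (sl : Slot) (h : hist) (B : {set Edge}) (be : Box) (k : Key).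

Let mR_gt0 : 0 < m%:R :> R. Proof. by rewrite ltr0n. Qed.
Let DR_gt0 : 0 < D%:R :> R. Proof. by rewrite ltr0n. Qed.

(** * Multiplicity of the ends of walks *)

Section Cap.
Variables (u : V) (p1 : seq Key) (k : Key) (x0 : V) (kap Lam ell : R).
Hypotheses (kp1 : k \notin p1) (kap_gt0 : 0 < kap) (ell_gt0 : 0 < ell) (Lam_ell : ex ell = Lam).

Definition capb w := [forall x, cw w p1 u x <= kap].

(** A slot at [x] adds [cw w p1 u x], at most [kap], to the multiplicity of [x0] with probability at
    most [1 / m]. Scaling by [kap] and tilting by [ell] gives a Chernoff bound that multiplies the
    mean by [Lam] and the cap by [L / ell]. The flag [capb] depends on other keys only and switches
    the potential off where increments could exceed the scale. *)
Definition gcap (h : hist) sl (B : {set Edge}) w : R := (capb w)%:R *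
  (ell / kap * cw w p1 u sl.1.1 * (tgt w sl == x0)%:R - Lam / (kap * m%:R) * cw w p1 u sl.1.1).

Lemma cap_super : super (Jcomp k gcap).
Proof.
have cb w sl y : sl.1.2 = k -> capb (upd w sl y) = capb w.
  by move=> e; apply: eq_forallb => x; rewrite cw_upd ?e.
apply: (Jcomp_super exD ex_ge) => [h sl B w sl' y e1 e2 hs ne|h sl B w hok ek].
  by rewrite /gcap cw_upd ?e2 // cb // /tgt upd_out // eq_sym.
rewrite /gcap; under eq_bigr do rewrite cw_upd ?ek // cb //.
have [/forallP cap|_] := boolP (capb w); last first.
  under eq_bigr do rewrite mul0r (ex0 exD ex_ge).
  by rewrite sumr_const card_ord.
set c := cw w p1 u sl.1.1; have c0 : 0 <= c by exact: cw_ge0.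
under eq_bigr do rewrite mul1r exD; rewrite -mulr_suml.
have Lam1 : 1 <= Lam by rewrite -Lam_ell; apply: le_trans (ex_ge _); rewrite lerDl ltW.
set mu := Lam / (kap * m%:R) * c.
have mu0 : 0 <= mu by rewrite mulr_ge0 ?divr_ge0 ?mulr_ge0 ?(ltW kap_gt0) ?(ltW mR_gt0) //; lra.
have h1 : \sum_y ex (ell / kap * c * (tgt (upd w sl y) sl == x0)%:R) <= m%:R * ex mu.
  apply: (@le_trans _ _ (m%:R * (1 + mu))); last by rewrite ler_wpM2l ?ex_ge ?(ltW mR_gt0).
  rewrite /tgt; case: (pickP (fun y => emb sl.1.2.2 y == x0)) => [y0 /eqP E0|hn]; last first.
    under eq_bigr do rewrite upd_id hn mulr0 (ex0 exD ex_ge).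
    by rewrite sumr_const card_ord mulrDr mulr1 lerDl mulr_ge0 ?ler0n.
  rewrite (bigD1 y0) //= upd_id E0 eqxx mulr1.
  have -> : \sum_(y | y != y0) ex (ell / kap * c * (emb sl.1.2.2 (upd w sl y sl) == x0)%:R) = m%:R - 1.
    transitivity (\sum_(y : 'I_m | y != y0) (1 : R)).
      apply: eq_bigr => y ne; rewrite upd_id -E0; case: eqP => [/emb_inj[E]|_]; last first.
        by rewrite mulr0 (ex0 exD ex_ge).
      by rewrite E eqxx in ne.
    rewrite sumr_const (cardC1 y0) card_ord; case: (m) m_gt0 => // m' _.
    by rewrite /= -[m'.+1]addn1 natrD addrK.
  have t01 : 0 <= c / kap <= 1.
    by rewrite divr_ge0 ?(ltW kap_gt0) //= ler_pdivrMr // mul1r; apply: cap.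
  have := ex_chord exD ex_ge ell t01; rewrite Lam_ell.
  have -> : ell / kap * c = c / kap * ell by ring.
  have -> : m%:R * (1 + mu) = m%:R + c / kap * Lam.
    by rewrite /mu; field; rewrite !lt0r_neq0.
  have : 0 <= c / kap by rewrite divr_ge0 ?(ltW kap_gt0).
  nra.
apply: le_trans (ler_wpM2r (ltW (ex_gt0 exD ex_ge _)) h1) _.
by rewrite -mulrA -exD subrr (ex0 exD ex_ge) mulr1.
Qed.

Lemma cap_final h w : hist_ok h -> full h -> capb w -> Jcomp k gcap h w < 1 ->
  cw w (rcons p1 k) u x0 <= kap * L / ell + Lam * D%:R ^+ (size p1).+1 / (m%:R * ell).
Proof.
move=> hok hf cb /(Jcomp_lt1 exD ex_ge); rewrite /Scomp /gcap cb.
rewrite (sum_ents_full k (fun sl => 1 * (ell / kap * cw w p1 u sl.1.1 * (tgt w sl == x0)%:R -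
   Lam / (kap * m%:R) * cw w p1 u sl.1.1)) hok hf) /=.
under eq_bigr do (under eq_bigr do rewrite mul1r; rewrite sumrB sumr_const card_ord -mulr_sumr).
rewrite sumrB sumrMnl -mulr_sumr sum_cw.
have -> : \sum_x ell / kap * cw w p1 u x * (\sum_(l < D) (tgt w (x, k, l) == x0)%:R) =
   ell / kap * cw w (rcons p1 k) u x0.
  rewrite -cats1 cw_cat mulr_sumr; apply: eq_bigr => x _; rewrite -mulrA cw_cons; congr (_ * (_ * _)).
  by apply: eq_bigr => l _; rewrite cw_nil.
set C := cw _ _ _ _; rewrite -(mulr_natr (Lam / (kap * m%:R) * _) D) => /ltW h1.
have -> : kap * L / ell + Lam * D%:R ^+ (size p1).+1 / (m%:R * ell) =
  kap / ell * (L + Lam / (kap * m%:R) * D%:R ^+ size p1 * D%:R).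
  by rewrite exprS; field; rewrite !lt0r_neq0.
rewrite mulrC -ler_pdivrMr ?divr_gt0 // invf_div; move: h1; rewrite lerBlDr mulrC; exact.
Qed.
End Cap.

(** * Indegrees, and walks from a whole class *)

Section Indegree.
Variables (k : Key) (a : 'I_s.+1) (y0 : 'I_m).

Definition cl x : R := \sum_y (emb a y == x)%:R.

Lemma cl01 x : 0 <= cl x <= 1.
Proof.
rewrite /cl sumr_ge0 //=; case: (pickP (fun y => emb a y == x)) => [y /eqP <-|hn].
  rewrite (bigD1 y) //= eqxx big1 ?addr0 // => y' ne.
  by case: eqP => // /emb_inj[E]; rewrite E eqxx in ne.
by rewrite big1 ?ler01 // => y _; rewrite hn.
Qed.

Lemma sum_cl (G : V -> R) : \sum_x cl x * G x = \sum_y G (emb a y).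
Proof.
under eq_bigr do rewrite mulr_suml.
rewrite exchange_big /=; apply: eq_bigr => y _; rewrite (bigD1 (emb a y)) //= eqxx mul1r.
by rewrite big1 ?addr0 // => x; rewrite eq_sym => /negbTE->; rewrite mul0r.
Qed.

Definition gin (h : hist) sl (B : {set Edge}) w : R :=
  cl sl.1.1 * (w sl == y0)%:R - 3 * (cl sl.1.1 / m%:R).

Lemma in_super : super (Jcomp k gin).
Proof.
apply: (Jcomp_super exD ex_ge) => [h sl B w sl' y e1 e2 hs ne|h sl B w hok ek].
  by rewrite /gin upd_out // eq_sym.
rewrite /gin; under eq_bigr do rewrite upd_id.
have /andP[c0 c1] := cl01 sl.1.1.
apply: (mean_upper exD ex_ge (f := fun y => cl sl.1.1 * (y == y0)%:R)) => [y|].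
  by case: (_ == _); rewrite ?mulr1 ?mulr0 ?c0 ?lexx ?ler01.
rewrite -mulr_sumr (bigD1 y0) //= eqxx big1 ?addr0 ?mulr1 => [|y /negbTE->//].
by rewrite mulrC divfK ?lt0r_neq0.
Qed.

Lemma in_final h w : hist_ok h -> full h -> Jcomp k gin h w < 1 ->
  \sum_y \sum_(l < D) (w (emb a y, k, l) == y0)%:R <= 3 * D%:R + L.
Proof.
move=> hok hf /(Jcomp_lt1 exD ex_ge); rewrite /Scomp /gin.
rewrite (sum_ents_full k (fun sl => cl sl.1.1 * (w sl == y0)%:R - 3 * (cl sl.1.1 / m%:R)) hok hf) /=.
under eq_bigr do rewrite sumrB sumr_const card_ord -mulr_sumr.
rewrite sumrB sumrMnl -mulr_sumr -mulr_suml.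
have -> : \sum_x cl x = m%:R.
  have := sum_cl (fun=> 1); rewrite sumr_const card_ord => <-.
  by apply: eq_bigr => x _; rewrite mulr1.
rewrite (sum_cl (fun x => \sum_(l < D) (w (x, k, l) == y0)%:R)) divff ?lt0r_neq0 // mulr1 -mulr_natr.
lra.
Qed.
End Indegree.

Definition Ein w k := [forall a, forall y0,
  \sum_y \sum_(l < D) (w (emb a y, k, l) == y0)%:R <= 4 * D%:R :> R].

(** Each vertex of the next class is reached from the class [a] by at most [4 * D] slots. Averaging
    over the value of a slot means summing over just such a class of starting points. *)
Lemma in_bound w p a z : all (Ein w) p ->
  \sum_y cw w p (emb a y) z <= (4 * D%:R) ^+ size p.
Proof.
elim: p a => [|k p IH] a /= => [_|/andP[/forallP/(_ a)/forallP hk /IH{}IH]].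
  under eq_bigr do rewrite cw_nil.
  by have /andP[] := cl01 a z.
have -> : \sum_y cw w (k :: p) (emb a y) z =
   \sum_y' (\sum_y \sum_(l < D) (w (emb a y, k, l) == y')%:R) * cw w p (emb k.2 y') z.
  under [RHS]eq_bigr do rewrite mulr_suml.
  rewrite exchange_big /=; apply: eq_bigr => y _; rewrite cw_cons.
  under [RHS]eq_bigr do rewrite mulr_suml.
  rewrite exchange_big /=; apply: eq_bigr => l _; rewrite (bigD1 (w (emb a y, k, l))) //= eqxx mul1r.
  by rewrite big1 ?addr0 // => y'; rewrite eq_sym => /negbTE->; rewrite mul0r.
rewrite exprS; apply: (@le_trans _ _ (\sum_y' 4 * D%:R * cw w p (emb k.2 y') z)).
  by apply: ler_sum => y' _; rewrite ler_wpM2r ?cw_ge0.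
by rewrite -mulr_sumr ler_wpM2l ?mulr_ge0.
Qed.

Lemma cw_class w p a y z : (forall y', z != emb (last a (map snd p)) y') -> cw w p (emb a y) z = 0.
Proof.
elim: p a y => [|k p IH] a y /= hz; first by rewrite cw_nil eq_sym (negbTE (hz y)).
by rewrite cw_cons big1 // => l _; apply: IH.
Qed.

Lemma sum_class a (F : V -> R) : (forall z, (forall y, z != emb a y) -> F z = 0) ->
  \sum_z F z = \sum_y F (emb a y).
Proof.
move=> hF; rewrite -sum_cl; apply: eq_bigr => z _.
case: (pickP (fun y => emb a y == z)) => [y /eqP <-|hn]; last first.
  by rewrite hF ?mulr0 // => y; rewrite eq_sym hn.
rewrite /cl (bigD1 y) //= eqxx big1 ?addr0 ?mul1r // => y' ne.
by case: eqP => // /emb_inj[E]; rewrite E eqxx in ne.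
Qed.

(** Breaker's edges at the moment the last slot of the box was revealed, or the present ones [B]
    while it is unfinished. Validity controls Breaker's degree only in unfinished boxes, so this
    frozen set is what remains sparse at all times. *)
Fixpoint bfroz (h : hist) be B : {set Edge} :=
  if h is e :: h0 then bfroz h0 be (if complete h be then e.2 else B) else B.

Lemma complete_cons e h be : complete h be -> complete (e :: h) be.
Proof. by move/forallP=> c; apply/forallP=> l; rewrite inE c orbT. Qed.

Lemma bfroz_inc h be B : ~~ complete h be -> bfroz h be B = B.
Proof.
elim: h B => //= e h IH B nc; rewrite (negbTE nc) IH //.
by apply: contra nc; apply: complete_cons.
Qed.

Lemma bfroz_card h be B : hist_ok h -> valid h B ->
  (#|[set y | sedge be (emb be.2.2 y) \in bfroz h be B]| <= em)%N.
Proof.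
elim: h B => [|e h IH] B hok hv.
  by apply: hv; apply/forallPn; exists (Ordinal D_gt0).
have [c|nc] := boolP (complete (e :: h) be); last by rewrite bfroz_inc //; apply: hv.
by rewrite /= c; case: hok => _ hv' _ hok; apply: IH.
Qed.

Lemma bfroz_sub h be B e : hist_ok h -> complete h be -> e \in ents h -> e.1.1.1 = be ->
  e.1.2 \subset bfroz h be B.
Proof.
elim: h B => //= e0 h IH B [ne hv mono hok] c; rewrite c.
have [c'|nc] := boolP (complete h be).
  rewrite inE => /orP[/eqP->|he] E; last exact: IH.
  by move: ne; have /forallP/(_ e0.1.2) := c'; rewrite -E /=; case: (e0.1) => a b /= ->.
rewrite (bfroz_inc _ nc) inE => /orP[/eqP->//|he] E.
by apply: mono; elim: (h) he => //= e1 h1 IH1; rewrite !inE => /orP[/eqP->|/IH1->]; rewrite ?eqxx ?orbT.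
Qed.

(** * Pairs whose middle edge Breaker took before the middle box was finished *)

Section Bad.
Variables (u v : V) (p p1 p2 : seq Key) (kk : Key) (cm : 'I_s) (aV : 'I_s.+1).
Hypotheses (kp : kk \notin p) (kp1 : kk \notin p1) (kp2 : kk \notin p2).
Hypothesis lastV : last kk.2 (map snd p2) = aV.

Definition bf h B x z := (cm, [set x; z]) \in bfroz h (x, (cm, aV)) B.

Definition cost h sl B w : R := \sum_x \sum_z
  cw w p u x * cw w p1 v sl.1.1 * (cw w p2 (tgt w sl) z * (bf h B x z)%:R).

Let Nrm : R := D%:R ^+ size p * D%:R ^+ size p1 * D%:R ^+ size p2.

(** For each [x] at most [em] ends [z] are frozen, and as the value of the slot runs over its class
    each of them is reached by at most [(4 * D) ^+ size p2] walks. *)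
Definition bad_bound : R := em%:R / m%:R * 4 ^+ size p2.

Definition gbad h sl B w : R := (all (Ein w) p2)%:R *
  (cost h sl B w / Nrm - 3 * (cw w p1 v sl.1.1 / D%:R ^+ size p1 * bad_bound)).

Let Nrm_gt0 : 0 < Nrm. Proof. by rewrite !mulr_gt0 ?exprn_gt0. Qed.

Lemma cost_ge0 h sl B w : 0 <= cost h sl B w.
Proof. by apply: sumr_ge0 => x _; apply: sumr_ge0 => z _; rewrite !mulr_ge0 ?cw_ge0. Qed.

Lemma cost_le h sl B w : cost h sl B w <= Nrm.
Proof.
apply: (@le_trans _ _ (\sum_x \sum_z cw w p u x * cw w p1 v sl.1.1 * cw w p2 (tgt w sl) z)).
  apply: ler_sum => x _; apply: ler_sum => z _; rewrite ler_wpM2l ?mulr_ge0 ?cw_ge0 //.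
  by case: (bf _ _ _ _); rewrite ?mulr1 ?mulr0 ?cw_ge0.
under eq_bigr do rewrite -mulr_sumr sum_cw.
rewrite -mulr_suml -mulr_suml sum_cw ler_wpM2r ?exprn_ge0 ?ler_wpM2l ?exprn_ge0 ?(ltW DR_gt0) //.
exact: cw_le.
Qed.

Lemma Ein_upd w sl y k : sl.1.2 != k -> Ein (upd w sl y) k = Ein w k.
Proof.
move=> ne; apply: eq_forallb => a; apply: eq_forallb => y0; congr (_ <= _).
apply: eq_bigr => y' _; apply: eq_bigr => l _; rewrite upd_out //.
by apply: contraNneq ne => <-.
Qed.

Lemma all_Ein_upd w sl y : sl.1.2 \notin p2 -> all (Ein (upd w sl y)) p2 = all (Ein w) p2.
Proof.
move=> np; apply: eq_in_all => k hk; rewrite Ein_upd //.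
by apply: contraNneq np => ->.
Qed.

Lemma bad_super : super (Jcomp kk gbad).
Proof.
apply: (Jcomp_super exD ex_ge) => [h sl B w sl' y e1 e2 hs ne|h sl B w hok ek].
  rewrite /gbad all_Ein_upd ?e2 // cw_upd ?e2 //.
  have -> // : cost h sl B (upd w sl' y) = cost h sl B w.
  apply: eq_bigr => x _; apply: eq_bigr => z _.
  by rewrite !cw_upd ?e2 // /tgt upd_out // eq_sym.
rewrite /gbad; under eq_bigr do rewrite all_Ein_upd ?ek // cw_upd ?ek //.
have [hE|_] := boolP (all _ _); last first.
  under eq_bigr do rewrite mul0r (ex0 exD ex_ge).
  by rewrite sumr_const card_ord.
under eq_bigr do rewrite mul1r.
apply: (mean_upper exD ex_ge (f := fun y => cost h sl B (upd w sl y) / Nrm)) => [y|].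
  by rewrite divr_ge0 ?cost_ge0 ?(ltW Nrm_gt0) //= ler_pdivrMr // mul1r cost_le.
rewrite -mulr_suml ler_pdivrMr //.
have -> : m%:R * (cw w p1 v sl.1.1 / D%:R ^+ size p1 * bad_bound) * Nrm =
   D%:R ^+ size p * (cw w p1 v sl.1.1 * (em%:R * (4 * D%:R) ^+ size p2)).
  rewrite /bad_bound /Nrm exprMn; field.
  by rewrite lt0r_neq0 // lt0r_neq0 // exprn_gt0.
rewrite /cost exchange_big /= -(sum_cw R emb w p u) mulr_suml; apply: ler_sum => x _.
rewrite exchange_big /=.
under eq_bigr => z _.
  under eq_bigr => y _ do rewrite !cw_upd ?ek // /tgt upd_id mulrA.
  rewrite -mulr_suml -mulr_sumr.
  over.
rewrite (sum_class (a := aV)); last first.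
  move=> z hz; rewrite big1 ?mulr0 ?mul0r // => y _.
  by rewrite cw_class // ek lastV.
under eq_bigr do rewrite -mulrA; rewrite -mulr_sumr -mulrA; do 2!(apply: ler_wpM2l; first exact: cw_ge0).
case: hok => _ hv _ hok'.
have := bfroz_card (x, (cm, aV)) hok' hv; rewrite -(ler_nat R) -sum_bool_card natr_sum => hb.
apply: le_trans (ler_wpM2r _ hb); last by rewrite exprn_ge0 ?mulr_ge0 ?(ltW DR_gt0).
rewrite mulr_suml; apply: ler_sum => y _.
rewrite -[_ \in bfroz _ _ _]/(bf h B x (emb aV y)) mulrC; case: (bf _ _ _ _).
  by rewrite !mul1r in_bound.
by rewrite !mul0r.
Qed.

Lemma bad_final h w : hist_ok h -> full h -> all (Ein w) p2 -> Jcomp kk gbad h w < 1 ->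
  \sum_(e <- ents h | e.1.1.1.2 == kk) cost e.2 e.1.1 e.1.2 w <=
     Nrm * (3 * bad_bound * D%:R + L).
Proof.
move=> hok hf hE /(Jcomp_lt1 exD ex_ge); rewrite /Scomp /gbad hE.
under eq_bigr do rewrite mul1r; rewrite sumrB -mulr_suml.
rewrite (sum_ents_full kk (fun sl => 3 * (cw w p1 v sl.1.1 / D%:R ^+ size p1 * bad_bound)) hok hf) /=.
under [X in _ - X < _ -> _]eq_bigr do rewrite sumr_const card_ord.
rewrite sumrMnl -mulr_sumr -!mulr_suml sum_cw divff ?mul1r; last by rewrite expf_neq0 // lt0r_neq0.
by move/ltW; rewrite lerBlDr ler_pdivrMr // [leRHS]mulrC -(mulr_natr (3 * bad_bound) D) addrC.
Qed.
End Bad.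
End Concentration.

(** * Middle edges gained through middle boxes *)

Section Gains.
Variables (R : realFieldType) (ex : R -> R).
Hypotheses (exD : forall x y, ex (x + y) = ex x * ex y) (ex_ge : forall x, 1 + x <= ex x).
Variables (n s D m : nat) (emb : 'I_s.+1 -> 'I_m -> 'I_n).
Hypothesis emb_inj : forall a y a' y', emb a y = emb a' y' -> (a, y) = (a', y').
Hypotheses (m_gt0 : (0 < m)%N) (D_gt0 : (0 < D)%N).
Variables (em : nat) (L : R).
Hypothesis L_ge0 : 0 <= L.

Notation V := 'I_n.
Notation Edge := ('I_s * {set V})%type.
Notation Key := ('I_s * 'I_s.+1)%type.
Notation Box := (V * Key)%type.
Notation Slot := (V * Key * 'I_D)%type.
Notation Om := {ffun Slot -> 'I_m}.
Notation hist := (seq (Slot * {set Edge})).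
Notation tgt := (tgt emb).
Notation walks := (walks emb).
Notation wend := (wend emb).
Notation wasted := (wasted emb).
Notation hist_ok := (hist_ok emb em).
Notation valid := (valid emb em).
Notation super := (@super R n s D m emb em).
Notation cw := (@cw R n s D m emb).
Notation Jcomp := (@Jcomp R ex n s D m L).
Notation wst := (wst emb).
Implicit Types (w : Om) (p : seq Key) (x u v z : V) (q : seq Slot) (sl : Slot) (h : hist) (B : {set Edge}) (be : Box) (k : Key).

Let mR_gt0 : 0 < m%:R :> R. Proof. by rewrite ltr0n. Qed.
Let DR_gt0 : 0 < D%:R :> R. Proof. by rewrite ltr0n. Qed.

Section Gain.
Variables (u v : V) (p q : seq Key) (cm : 'I_s) (aV : 'I_s.+1) (muU muV Kg : R).
Local Notation mid := (cm, aV).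
Hypotheses (mp : mid \notin p) (mq : mid \notin q) (Kg_gt0 : 0 < Kg).
Hypotheses (muU_gt0 : 0 < muU) (muV_gt0 : 0 < muV).
Local Notation entry := (Slot * {set Edge} * hist)%type.
Implicit Types (E : seq entry) (e : entry) (Q : seq Slot).

Definition inc h w z : R :=
  \sum_(Q <- walks w q v) (wend w v Q == z)%:R * (~~ all (mem (rvl h)) Q)%:R.

Definition row E w x : R := \sum_(e <- E | e.1.1.1.1 == x) inc e.2 w (tgt w e.1.1).
Definition col E w z : R := \sum_(e <- E | tgt w e.1.1 == z) cw w p u e.1.1.1.1.

(** The thresholds keep a single end from carrying much of the gain, so that wasted walks destroy
    little of it ([gains_le]). A saturated end is charged to the gains already made there
    ([gain_final]). *)
Definition elig E h sl B w := [&& sl.1.2 == mid, ~~ wasted h sl B w,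
  row E w sl.1.1 < muV & col E w (tgt w sl) < muU].

(* The entries of h that gain: the value of the middle slot could still be hit
   by an unfinished walk from v, and neither endpoint is saturated. *)
Fixpoint eg h w : seq entry :=
  if h is e :: h0 then
    if elig (eg h0 w) h0 e.1 e.2 w then (e, h0) :: eg h0 w else eg h0 w
  else [::].

Definition capg w := [forall x, forall z, cw w p u x * cw w q v z <= Kg].

Definition fgain h sl B w : R :=
  (capg w)%:R * (elig (eg h w) h sl B w)%:R * (cw w p u sl.1.1 * inc h w (tgt w sl) / Kg).

(** A lower-tail increment. Its compensator resamples the value of [sl], because the mean of [fgain]
    varies with the history and with the other keys. *)
Definition ggain h sl B w : R :=
  - fgain h sl B w + (\sum_y fgain h sl B (upd w sl y)) / (2 * m%:R).

Lemma inc_ge0 h w z : 0 <= inc h w z.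
Proof. by apply: sumr_ge0 => Q _; rewrite mulr_ge0. Qed.

Lemma inc_le h w z : inc h w z <= cw w q v z.
Proof.
apply: ler_sum => Q _; case: (all _ _) => /=; first by rewrite mulr0.
by rewrite mulr1.
Qed.

Lemma inc_upd h w sl y z : sl.1.2 = mid -> inc h (upd w sl y) z = inc h w z.
Proof.
move=> e; have kq : sl.1.2 \notin q by rewrite e.
rewrite /inc walks_upd // big_seq [RHS]big_seq; apply: eq_bigr => Q hQ.
by rewrite (wend_upd _ kq hQ).
Qed.

Lemma eg_ents h w : {subset eg h w <= ents h}.
Proof.
elim: h => //= e h IH e'; case: ifP => _; rewrite !inE; last by move/IH->; rewrite orbT.
by case/orP=> [->//|/IH->]; rewrite orbT.
Qed.

Lemma eg_elig h w e : e \in eg h w -> elig (eg e.2 w) e.2 e.1.1 e.1.2 w.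
Proof.
by elim: h => //= e0 h IH; case: ifP => [hel|_ /IH//]; rewrite inE => /orP[/eqP->|/IH].
Qed.

Lemma elig_eg h w e : e \in ents h -> elig (eg e.2 w) e.2 e.1.1 e.1.2 w -> e \in eg h w.
Proof.
elim: h => //= e0 h IH; rewrite inE => /orP[/eqP->/= ->|he hel]; first by rewrite mem_head.
by case: ifP => _; rewrite ?inE IH ?orbT.
Qed.

Lemma eg_mono h w e (P : pred entry) (F : entry -> R) : (forall e, 0 <= F e) -> e \in ents h ->
  \sum_(e' <- eg e.2 w | P e') F e' <= \sum_(e' <- eg h w | P e') F e'.
Proof.
move=> F0; elim: h => //= e0 h IH he.
have le0 : \sum_(e' <- eg h w | P e') F e' <= \sum_(e' <- eg (e0 :: h) w | P e') F e'.
  by rewrite /=; case: ifP => _ //; rewrite big_cons; case: (P _) => //; rewrite lerDr F0.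
by move: he; rewrite inE => /orP[/eqP->//|/IH/le_trans]; apply.
Qed.

Lemma elig_upd h0 E h sl B w sl' y : sl'.1.2 = mid -> sl' \notin rvl h -> sl' != sl ->
  {subset E <= ents h} -> elig E h sl B (upd w sl' y) = elig E h sl B w.
Proof.
move=> e2 hs ne sE; have tE e : e \in E -> tgt (upd w sl' y) e.1.1 = tgt w e.1.1.
  move=> he; rewrite /tgt upd_out //; apply: contraNneq hs => <-; apply: ents_rvl; exact: sE.
rewrite /elig wasted_upd //; congr [&& _, _, _ & _]; congr (_ < _).
  rewrite /row big_seq_cond [RHS]big_seq_cond; apply: eq_bigr => e /andP[he _].
  by rewrite inc_upd // tE.
rewrite /col big_seq_cond [RHS]big_seq_cond; apply: eq_big => [e|e _]; last by rewrite cw_upd ?e2.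
by apply: andb_id2l => he; rewrite tE // /tgt upd_out // eq_sym.
Qed.

Lemma eg_upd h w sl' y : sl'.1.2 = mid -> sl' \notin rvl h -> eg h (upd w sl' y) = eg h w.
Proof.
move=> e2; elim: h => //= e h IH; rewrite inE negb_or => /andP[ne hs].
by rewrite IH // elig_upd //; exact: eg_ents.
Qed.

Lemma capg_upd w sl y : sl.1.2 = mid -> capg (upd w sl y) = capg w.
Proof.
by move=> e; apply: eq_forallb => x; apply: eq_forallb => z; rewrite !cw_upd ?e.
Qed.

Lemma fgain_upd h sl B w sl' y : sl'.1.2 = mid -> sl' \notin rvl h -> sl' != sl ->
  fgain h sl B (upd w sl' y) = fgain h sl B w.
Proof.
move=> e2 hs ne; rewrite /fgain capg_upd // eg_upd // elig_upd //; last exact: eg_ents.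
by rewrite cw_upd ?e2 // inc_upd // /tgt upd_out // eq_sym.
Qed.

Lemma fgain01 h sl B w : 0 <= fgain h sl B w <= 1.
Proof.
have i0 := inc_ge0 h w (tgt w sl); have c0 := cw_ge0 R emb w p u sl.1.1.
rewrite /fgain; case: (boolP (capg w)) => [/forallP/(_ sl.1.1)/forallP/(_ (tgt w sl)) cap|_]; last first.
  by rewrite !mul0r lexx ler01.
have h1 : 0 <= cw w p u sl.1.1 * inc h w (tgt w sl) / Kg <= 1.
  rewrite divr_ge0 ?mulr_ge0 ?(ltW Kg_gt0) //= ler_pdivrMr // mul1r.
  apply: le_trans cap; rewrite ler_wpM2l //; exact: inc_le.
by rewrite mul1r; case: (elig _ _ _ _ _); rewrite ?mul1r ?mul0r ?lexx ?ler01.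
Qed.

Lemma gain_super : super (Jcomp mid ggain).
Proof.
apply: (Jcomp_super exD ex_ge) => [h sl B w sl' y e1 e2 hs ne|h sl B w hok ek].
  rewrite /ggain fgain_upd //; congr (_ + _ / _); apply: eq_bigr => y' _.
  have -> : upd (upd w sl' y) sl y' = upd (upd w sl y') sl' y.
    apply/ffunP=> z; rewrite !updE; case: (eqVneq z sl) => // ->.
    by rewrite eq_sym (negbTE ne).
  by rewrite fgain_upd.
rewrite /ggain.
have E y : \sum_y' fgain h sl B (upd (upd w sl y) sl y') = \sum_y' fgain h sl B (upd w sl y').
  apply: eq_bigr => y' _; congr fgain; apply/ffunP=> z; rewrite !updE; by case: eqP.
under eq_bigr do rewrite E.
by apply: (mean_lower exD ex_ge m_gt0) => y; exact: fgain01.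
Qed.

Definition gains h w : R := \sum_(e <- eg h w) cw w p u e.1.1.1.1 * inc e.2 w (tgt w e.1.1).

Lemma eg_key h w e : e \in eg h w -> e.1.1.1.2 = mid.
Proof. by move/eg_elig/and4P=> [/eqP]. Qed.

Lemma eg_uniq h w : hist_ok h -> uniq (eg h w).
Proof.
elim: h => //= e h IH [ne _ _ hok]; case: ifP => _; rewrite /= IH // andbT.
by apply: contra ne => /eg_ents/ents_rvl.
Qed.

Lemma sum_fgain h w : capg w -> \sum_(e <- ents h | e.1.1.1.2 == mid) fgain e.2 e.1.1 e.1.2 w =
  gains h w / Kg.
Proof.
move=> cap; rewrite /gains mulr_suml; elim: h => [|e h IH]; first by rewrite !big_nil.
rewrite /= big_cons /= IH /fgain cap mul1r; case: (boolP (elig _ _ _ _ _)) => hel.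
  by rewrite big_cons; case/and4P: hel => -> _ _ _; rewrite mul1r.
by rewrite mul0r add0r; case: ifP.
Qed.

Lemma row_le h w x Kv : (forall z, cw w q v z <= Kv) -> 0 <= Kv -> row (eg h w) w x <= muV + Kv.
Proof.
move=> hK K0; elim: h => [|e h IH] /=; first by rewrite /row big_nil addr_ge0 // ltW.
case: ifP => // /and4P[_ _ hr _]; rewrite /row big_cons /=; case: eqP => // <-.
rewrite addrC lerD ?(ltW hr) //; apply: le_trans (inc_le _ _ _) (hK _).
Qed.

Lemma col_le h w z Ku : (forall x, cw w p u x <= Ku) -> 0 <= Ku -> col (eg h w) w z <= muU + Ku.
Proof.
move=> hK K0; elim: h => [|e h IH] /=; first by rewrite /col big_nil addr_ge0 // ltW.
by case: ifP => // /and4P[_ _ _ hc]; rewrite /col big_cons /=; case: eqP => // <-; rewrite addrC lerD ?(ltW hc).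
Qed.

Lemma first_use h w be y : has (fun f => (f.1.1 == be) && (w f.1 == y)) h ->
  exists e, [/\ e \in ents h, e.1.1.1 = be, w e.1.1 = y &
    ~~ has (fun f => (f.1.1 == be) && (w f.1 == y)) e.2].
Proof.
elim: h => //= f h IH; case: (boolP (has _ h)) => [/IH[e [h1 h2 h3 h4]] _|nh].
  by exists e; rewrite inE h1 orbT.
by rewrite orbF => /andP[/eqP e1 /eqP e2]; exists (f, h); rewrite mem_head.
Qed.

(** A selected pair could be gained at each of the [D] slots of the middle box at [x]. If the value
    leading to the end of [Q] is not eligible at some slot, then the row or the column is saturated,
    or the value was used before and its first use was a gain. Each of these three exceptions costs
    at most [m] times the gains; the compensator, being half the mean, accounts for the remaining
    [2 * m]. *)
Lemma gain_final h w (a : V -> seq Slot -> bool) : hist_ok h -> full h -> (D <= m)%N -> capg w ->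
  Jcomp mid ggain h w < 1 ->
  muV = D%:R ^+ (size q).+1 / m%:R -> muU = D%:R ^+ (size p).+1 / m%:R ->
  last aV (map snd q) = aV -> (0 < size q)%N ->
  (forall x Q e, a x Q -> e \in ents h -> e.1.1.1 = (x, mid) ->
     ~~ all (mem (rvl e.2)) Q /\ (cm, [set x; wend w v Q]) \notin e.1.2) ->
  D%:R * \sum_x cw w p u x * \sum_(Q <- walks w q v) (a x Q)%:R <=
    m%:R * (5 * gains h w + 2 * L * Kg).
Proof.
move=> hok hf Dm cap J eV eU lastq q0 ha.
have := Jcomp_lt1 exD ex_ge J; rewrite /Scomp /ggain big_split /= sumrN sum_fgain //.
rewrite -mulr_suml; set T := \sum_(e <- ents h | _) _ => hT.
pose G := gains h w.
have {hT} hT : Kg * T <= 2 * m%:R * (L * Kg + G).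
  have : T <= (L + G / Kg) * (2 * m%:R).
    by rewrite -ler_pdivrMr ?mulr_gt0 // ltW // -ltrBDr; move: hT; rewrite addrC.
  move=> /(ler_wpM2l (ltW Kg_gt0)) /le_trans; apply; rewrite le_eqVlt; apply/orP; left; apply/eqP.
  by field; rewrite lt0r_neq0.
pose cl1 e Q := (row (eg e.2 w) w e.1.1.1.1 < muV) && (col (eg e.2 w) w (wend w v Q) < muU).
have cU0 x : 0 <= cw w p u x by exact: cw_ge0.
pose g Q := \sum_(e <- eg h w) cw w p u e.1.1.1.1 *
   ((wend w v Q == tgt w e.1.1)%:R * (~~ all (mem (rvl e.2)) Q)%:R).
pose gx x Q := \sum_(e <- eg h w | e.1.1.1.1 == x)
   ((wend w v Q == tgt w e.1.1)%:R * (~~ all (mem (rvl e.2)) Q)%:R) : R.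
have gG : \sum_(Q <- walks w q v) g Q = G.
  by rewrite exchange_big /=; apply: eq_bigr => e _; rewrite -mulr_sumr.
have rG : \sum_x cw w p u x * row (eg h w) w x = G.
  rewrite /G /gains (partition_big (fun e => e.1.1.1.1) xpredT) //=; apply: eq_bigr => x _.
  by rewrite mulr_sumr; apply: eq_bigr => e /eqP->.
have gxG : \sum_x cw w p u x * \sum_(Q <- walks w q v) gx x Q = G.
  rewrite -rG; apply: eq_bigr => x _; congr (_ * _).
  by rewrite /gx exchange_big.
have row0 x : 0 <= row (eg h w) w x by apply: sumr_ge0 => e _; exact: inc_ge0.
have g0 Q : 0 <= g Q by apply: sumr_ge0 => e _; rewrite !mulr_ge0.
have gx0 x Q : 0 <= gx x Q by apply: sumr_ge0 => e _; rewrite mulr_ge0.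
have key e Q y : e \in ents h -> e.1.1.1.2 = mid -> a e.1.1.1.1 Q -> wend w v Q = emb aV y ->
   1 <= (elig (eg e.2 w) e.2 e.1.1 e.1.2 (upd w e.1.1 y))%:R +
        (row (eg h w) w e.1.1.1.1 / muV + g Q / muU + gx e.1.1.1.1 Q).
  move=> he ke aQ wy; set x := e.1.1.1.1.
  have rest0 : 0 <= row (eg h w) w x / muV + g Q / muU + gx x Q.
    by rewrite !addr_ge0 // divr_ge0 // ltW.
  case: (boolP (elig _ _ _ _ _)) => [_|nel]; first by rewrite lerDl.
  rewrite add0r; have [hr|hr] := ltP (row (eg h w) w x) muV; last first.
    rewrite -addrA ler_wpDr ?addr_ge0 ?divr_ge0 ?(ltW muU_gt0) //.
    by rewrite ler_pdivlMr // mul1r.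
  have [hg|hg] := ltP (g Q) muU; last first.
    rewrite ler_wpDr // ler_wpDl ?divr_ge0 ?(ltW muV_gt0) //.
    by rewrite ler_pdivlMr // mul1r.
  rewrite ler_wpDl ?addr_ge0 ?divr_ge0 ?(ltW muU_gt0) ?(ltW muV_gt0) //.
  have xe : e.1.1.1 = (x, mid) by rewrite /x -ke; case: (e.1.1.1).
  have hcl e' : e' \in ents h -> e'.1.1.1 = (x, mid) ->
     row (eg e'.2 w) w x < muV /\ col (eg e'.2 w) w (wend w v Q) < muU.
    move=> he' xe'; split.
      by apply: le_lt_trans hr; apply: eg_mono => // e''; exact: inc_ge0.
    apply: le_lt_trans hg; have [nall _] := ha _ _ _ aQ he' xe'.
    apply: (@le_trans _ _ (\sum_(e'' <- eg e'.2 w) cw w p u e''.1.1.1.1 *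
       ((wend w v Q == tgt w e''.1.1)%:R * (~~ all (mem (rvl e''.2)) Q)%:R))).
      rewrite /col big_mkcond big_seq [leRHS]big_seq; apply: ler_sum => e'' he''.
      rewrite eq_sym; case: (_ == _); last by rewrite !mulr_ge0.
      rewrite (_ : ~~ all _ _) ?mulr1 //; apply: contra nall => /allP hall; apply/allP=> sl hsl.
      exact: (ents_sub (eg_ents he'')) (hall _ hsl).
    by apply: (@eg_mono h w e' xpredT) => // e''; rewrite !mulr_ge0.
  (* Only a repetition can still make the value ineligible: by [ha] the edge is not Breaker's, and
     neither end is saturated. *)
  have used : has (fun f => (f.1.1 == e.1.1.1) && (w f.1 == y)) e.2.
    move: nel; rewrite /elig ke eqxx /=.
    have slr : e.1.1 \notin rvl e.2 by case: (ents_ok hok he).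
    have [h1 h2] := hcl e he xe.
    have -> : row (eg e.2 w) (upd w e.1.1 y) e.1.1.1.1 = row (eg e.2 w) w x.
      rewrite /row big_seq_cond [RHS]big_seq_cond; apply: eq_bigr => e'' /andP[he'' _].
      rewrite inc_upd // /tgt upd_out //; apply: contraNneq slr => <-.
      by apply: ents_rvl; apply: eg_ents he''.
    have -> : col (eg e.2 w) (upd w e.1.1 y) (tgt (upd w e.1.1 y) e.1.1) =
       col (eg e.2 w) w (wend w v Q).
      rewrite /tgt upd_id ke /= -wy.
      rewrite /col big_seq_cond [RHS]big_seq_cond; apply: eq_big => [e''|e'' _]; last by rewrite cw_upd ?ke.
      apply: andb_id2l => he''; rewrite /tgt upd_out //; apply: contraNneq slr => <-.
      by apply: ents_rvl; apply: eg_ents he''.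
    have E1 : tgt (upd w e.1.1 y) e.1.1 = wend w v Q by rewrite /tgt upd_id ke wy.
    have E2 : sedge e.1.1.1 (wend w v Q) = (cm, [set x; wend w v Q]) by rewrite xe.
    rewrite h1 h2 !andbT negbK /wasted E1 E2 upd_id.
    have [_ /negbTE->] := ha _ _ _ aQ he xe; rewrite /= => /hasP[f hf' /andP[hf1 hf2]].
    apply/hasP; exists f => //; rewrite hf1 /=; move: hf2; rewrite upd_out //.
    by apply: contraNneq slr => <-; exact: map_f.
  have [e' [he' xe' we' nu]] := first_use used.
  have he'h : e' \in ents h.
    elim: (h) he => //= e0 h0 IH; rewrite !inE => /orP[/eqP E|/IH->]; last by rewrite orbT.
    by move: he'; rewrite E => ->; rewrite orbT.
  rewrite xe in xe'.
  have te' : tgt w e'.1.1 = wend w v Q by rewrite /tgt we' xe' wy.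
  have [nall nB] := ha _ _ _ aQ he'h xe'; have [h1 h2] := hcl _ he'h xe'.
  (* The first use of the value was not wasted, hence a gain, and by [ha] the walk [Q] was
     unfinished then, so it is counted in [gx]. *)
  have hin : e' \in eg h w.
    apply: elig_eg => //; rewrite /elig xe' eqxx te' h1 h2 !andbT /=.
    rewrite /wasted te' xe' /sedge /= (negbTE nB) /=; move: nu; rewrite xe; apply: contra.
    by rewrite we'.
  rewrite /gx big_mkcond (bigD1_seq e') ?eg_uniq //= xe' /= eqxx te' eqxx nall mulr1 lerDl.
  by apply: sumr_ge0 => e'' _; case: ifP => _; rewrite ?mulr_ge0.
have main e : e \in ents h -> e.1.1.1.2 = mid ->
    cw w p u e.1.1.1.1 * \sum_(Q <- walks w q v) (a e.1.1.1.1 Q)%:R <=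
    Kg * (\sum_y fgain e.2 e.1.1 e.1.2 (upd w e.1.1 y)) +
    cw w p u e.1.1.1.1 * \sum_(Q <- walks w q v)
      (row (eg h w) w e.1.1.1.1 / muV + g Q / muU + gx e.1.1.1.1 Q).
  move=> he ke; have slr : e.1.1 \notin rvl e.2 by case: (ents_ok hok he).
  pose el y := elig (eg e.2 w) e.2 e.1.1 e.1.2 (upd w e.1.1 y).
  have -> : Kg * (\sum_y fgain e.2 e.1.1 e.1.2 (upd w e.1.1 y)) =
     cw w p u e.1.1.1.1 * \sum_(Q <- walks w q v) \sum_y
       (wend w v Q == emb aV y)%:R * (~~ all (mem (rvl e.2)) Q)%:R * (el y)%:R.
    rewrite exchange_big /= !mulr_sumr; apply: eq_bigr => y _.
    rewrite /fgain capg_upd // cap mul1r eg_upd // -/(el y) cw_upd ?ke // inc_upd //.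
    rewrite /tgt upd_id ke -mulr_suml -/(inc e.2 w (emb aV y)) /=; field.
    by rewrite lt0r_neq0.
  rewrite -mulrDr ler_wpM2l // -big_split /= big_seq [leRHS]big_seq; apply: ler_sum => Q hQ.
  have rest0 : 0 <= row (eg h w) w e.1.1.1.1 / muV + g Q / muU + gx e.1.1.1.1 Q.
    by rewrite !addr_ge0 // divr_ge0 // ltW.
  case: (boolP (a _ _)) => [aQ|_]; last first.
    by rewrite addr_ge0 // sumr_ge0 // => y _; rewrite !mulr_ge0.
  have [y wy] : exists y, wend w v Q = emb aV y.
    case/lastP: Q hQ {aQ rest0} => [/walks_keys|Q sl /walks_keys eq]; first by move=> E; move: q0; rewrite -E.
    exists (w sl); rewrite /wend map_rcons last_rcons /tgt.
    by move: lastq; rewrite -eq !map_rcons last_rcons => ->.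
  apply: le_trans (key e Q y he ke aQ wy) _; rewrite lerD2r (bigD1 y) //= wy eqxx mul1r.
  have xe : e.1.1.1 = (e.1.1.1.1, mid) by rewrite -ke; case: (e.1.1.1).
  have [-> _] := ha _ _ _ aQ he xe; rewrite mul1r lerDl.
  by apply: sumr_ge0 => y' _; rewrite !mulr_ge0.
pose A x := cw w p u x * \sum_(Q <- walks w q v) (a x Q)%:R.
pose C x := cw w p u x * \sum_(Q <- walks w q v) (row (eg h w) w x / muV + g Q / muU + gx x Q).
have sD (F : V -> R) : \sum_(e <- ents h | e.1.1.1.2 == mid) F e.1.1.1.1 = D%:R * \sum_x F x.
  rewrite (sum_ents_full mid (fun sl => F sl.1.1) hok hf) /= mulr_sumr.
  by apply: eq_bigr => x _; rewrite sumr_const card_ord mulr_natl.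
have -> : D%:R * \sum_x cw w p u x * \sum_(Q <- walks w q v) (a x Q)%:R =
   \sum_(e <- ents h | e.1.1.1.2 == mid) A e.1.1.1.1 by rewrite sD.
apply: (@le_trans _ _ (Kg * T + D%:R * \sum_x C x)).
  rewrite -sD /T mulr_sumr -big_split /= big_seq_cond [leRHS]big_seq_cond.
  by apply: ler_sum => e /andP[he /eqP ke]; apply: main.
have hC : \sum_x C x <= (D%:R ^+ size q / muV + D%:R ^+ size p / muU + 1) * G.
  have -> : \sum_x C x = \sum_x cw w p u x * (D%:R ^+ size q * (row (eg h w) w x / muV)) +
     \sum_x cw w p u x * (G / muU) + \sum_x cw w p u x * \sum_(Q <- walks w q v) gx x Q.
    rewrite -!big_split /=; apply: eq_bigr => x _; rewrite /C -!mulrDr !big_split /=.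
    have -> : \sum_(Q <- walks w q v) g Q / muU = G / muU by rewrite -mulr_suml gG.
    by rewrite big_const_seq count_predT size_walks iter_addr_0 -(mulr_natl _ (expn D (size q))) natrX.
  rewrite gxG -mulr_suml sum_cw.
  have -> : \sum_x cw w p u x * (D%:R ^+ size q * (row (eg h w) w x / muV)) =
     D%:R ^+ size q / muV * \sum_x cw w p u x * row (eg h w) w x.
    by rewrite mulr_sumr; apply: eq_bigr => x _; ring.
  by rewrite rG le_eqVlt; apply/orP; left; apply/eqP; ring.
have G0 : 0 <= G by rewrite -rG; apply: sumr_ge0 => x _; rewrite mulr_ge0.
have DmR : D%:R <= m%:R :> R by rewrite ler_nat.
have dV : D%:R * (D%:R ^+ size q / muV) = m%:R.
  by rewrite eV exprS; field; rewrite !lt0r_neq0 ?exprn_gt0.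
have dU : D%:R * (D%:R ^+ size p / muU) = m%:R.
  by rewrite eU exprS; field; rewrite !lt0r_neq0 ?exprn_gt0.
have := ler_wpM2l (ltW DR_gt0) hC.
have -> : D%:R * ((D%:R ^+ size q / muV + D%:R ^+ size p / muU + 1) * G) =
  (D%:R * (D%:R ^+ size q / muV) + D%:R * (D%:R ^+ size p / muU) + D%:R) * G by ring.
rewrite dV dU.
by have := ler_wpM2r G0 DmR; rewrite -/G; move: hT; lra.
Qed.
End Gain.
End Gains.

(** * The two games Maker plays at once *)

Section Hits.
Variables (R : realFieldType) (ex : R -> R).
Hypotheses (exD : forall x y, ex (x + y) = ex x * ex y) (ex_ge : forall x, 1 + x <= ex x).
Variables (n s D m : nat) (emb : 'I_s.+1 -> 'I_m -> 'I_n).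
Hypothesis emb_inj : forall a y a' y', emb a y = emb a' y' -> (a, y) = (a', y').
Hypotheses (m_gt0 : (0 < m)%N) (D_gt0 : (0 < D)%N).
Variables (em : nat) (L : R).
Hypothesis L_ge0 : 0 <= L.

Notation V := 'I_n.
Notation Edge := ('I_s * {set V})%type.
Notation Key := ('I_s * 'I_s.+1)%type.
Notation Box := (V * Key)%type.
Notation Slot := (V * Key * 'I_D)%type.
Notation Om := {ffun Slot -> 'I_m}.
Notation hist := (seq (Slot * {set Edge})).
Notation tgt := (tgt emb).
Notation walks := (walks emb).
Notation wend := (wend emb).
Notation wasted := (wasted emb).
Notation hist_ok := (hist_ok emb em).
Notation valid := (valid emb em).
Notation super := (@super R n s D m emb em).
Notation cw := (@cw R n s D m emb).
Notation Jcomp := (@Jcomp R ex n s D m L).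
Notation wst := (wst emb).
Implicit Types (w : Om) (p : seq Key) (x u v z : V) (q : seq Slot) (sl : Slot) (h : hist) (B : {set Edge}) (be : Box) (k : Key).

Let mR_gt0 : 0 < m%:R :> R. Proof. by rewrite ltr0n. Qed.
Let DR_gt0 : 0 < D%:R :> R. Proof. by rewrite ltr0n. Qed.

(** * The hitting game on middle edges *)

Section Arrivals.
Variables (u v : V) (p q : seq Key) (cm : 'I_s) (ku kv pr : R) (b : nat).
Hypotheses (pr_ge0 : 0 <= pr) (pr_le1 : pr <= 1).
Implicit Types (P Q : seq Slot) (M : {set Edge}) (f : Edge).

Definition me x z : Edge := (cm, [set x; z]).
Definition rvd h P := all (mem (rvl h)) P.
Definition alive h w P := all (fun sl => ~~ wst h w sl) P.

(* The last slot of P ++ Q was revealed while the middle edge was still not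
   Breaker's; such pairs are defended in the hitting game. *)
Definition arrv h w P Q := [&& rvd h P && rvd h Q, alive h w P && alive h w Q &
  has (fun e : Slot * {set Edge} * hist => [&& all (mem (e.1.1 :: rvl e.2)) (P ++ Q), e.1.1 \in P ++ Q &
                    me (wend w u P) (wend w v Q) \notin e.1.2]) (ents h)].

Definition sumPQ w (F : seq Slot -> seq Slot -> R) : R :=
  \sum_(P <- walks w p u) \sum_(Q <- walks w q v) F P Q.

Definition claimed h w M : R :=
  sumPQ w (fun P Q => (arrv h w P Q)%:R * (me (wend w u P) (wend w v Q) \in M)%:R).
Definition wt h w f : R :=
  sumPQ w (fun P Q => (arrv h w P Q)%:R * (me (wend w u P) (wend w v Q) == f)%:R).
Definition ru h w x : R := \sum_(P <- walks w p u) (rvd h P)%:R * (wend w u P == x)%:R.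
Definition rv h w z : R := \sum_(Q <- walks w q v) (rvd h Q)%:R * (wend w v Q == z)%:R.
Definition nU h w : R := \sum_(P <- walks w p u) (rvd h P)%:R.
Definition nV h w : R := \sum_(Q <- walks w q v) (rvd h Q)%:R.
Definition capR h w := [forall x, ru h w x <= ku] && [forall z, rv h w z <= kv].
(** Maker's pairs against the fraction [pr] of all decided ones. When a walk from [v] (from [u]) is
    completed, the next [b] edges of Breaker spoil at most [b * ku] ([b * kv]) of the pairs it
    creates; the last term refunds these once per completed walk. *)
Definition Y h w M B : R := (1 - pr) * claimed h w M - pr * claimed h w B +
  pr * b%:R * (ku * nV h w + kv * nU h w).

Lemma le_sumPQ w F1 F2 : (forall P Q, P \in walks w p u -> Q \in walks w q v -> F1 P Q <= F2 P Q) ->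
  sumPQ w F1 <= sumPQ w F2.
Proof.
move=> hF; rewrite /sumPQ big_seq [leRHS]big_seq; apply: ler_sum => P hP.
by rewrite big_seq [leRHS]big_seq; apply: ler_sum => Q hQ; apply: hF.
Qed.

Lemma sumPQ_add w F1 F2 : sumPQ w (fun P Q => F1 P Q + F2 P Q) = sumPQ w F1 + sumPQ w F2.
Proof.
by rewrite /sumPQ -big_split; apply: eq_bigr => P _; apply: big_split.
Qed.

Lemma le_sumPQ_add w F F1 F2 : (forall P Q, F P Q <= F1 P Q + F2 P Q) ->
  sumPQ w F <= sumPQ w F1 + sumPQ w F2.
Proof. by move=> hF; rewrite -sumPQ_add; apply: le_sumPQ => P Q _ _; apply: hF. Qed.

Lemma sumPQ_sum w (I : finType) (A : {set I}) (F : I -> seq Slot -> seq Slot -> R) :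
  sumPQ w (fun P Q => \sum_(i in A) F i P Q) = \sum_(i in A) sumPQ w (F i).
Proof.
rewrite /sumPQ [RHS]exchange_big /=; apply: eq_bigr => P _.
by rewrite exchange_big.
Qed.

Section Agree.
Variables (h : hist) (w w' : Om).
Hypothesis ww : forall sl, sl \in rvl h -> w sl = w' sl.

Lemma wend_agree x P : rvd h P -> wend w x P = wend w' x P.
Proof. by move/allP=> hP; apply: wend_eq => sl /hP; apply: ww. Qed.

Lemma wasted_agree (e : Slot * {set Edge} * hist) : e \in ents h -> wasted e.2 e.1.1 e.1.2 w = wasted e.2 e.1.1 e.1.2 w'.
Proof.
move=> he; rewrite /Submission.wasted /Submission.tgt ww ?ents_rvl //; congr orb; apply: eq_in_has => f hf.
by rewrite ww //; apply: (ents_sub he); apply: map_f.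
Qed.

Lemma wst_agree sl : wst h w sl = wst h w' sl.
Proof. by apply: eq_in_has => e he; case: eqP => //= <-; rewrite wasted_agree. Qed.

Lemma arrv_agree P Q : arrv h w P Q = arrv h w' P Q.
Proof.
rewrite /arrv; case: (boolP (rvd h P)) => //= hP; case: (boolP (rvd h Q)) => //= hQ.
rewrite /alive !(eq_all (fun sl => congr1 negb (wst_agree sl))).
by rewrite !(wend_agree _ hP) !(wend_agree _ hQ).
Qed.

(** Sums supported on fully revealed pairs depend on revealed values only, so later choices of
    values leave the hitting potential unchanged. *)
Lemma sumPQ_agree F F' :
  (forall P Q, rvd h P -> rvd h Q -> F P Q = F' P Q) ->
  (forall P Q, ~~ (rvd h P && rvd h Q) -> F P Q = 0) ->
  (forall P Q, ~~ (rvd h P && rvd h Q) -> F' P Q = 0) -> sumPQ w F = sumPQ w' F'.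
Proof.
move=> hF F0 F'0; rewrite /sumPQ.
rewrite (bigID (rvd h)) /= [X in _ + X]big1 ?addr0; last first.
  by move=> P nP; rewrite big1 // => Q _; apply: F0; rewrite (negbTE nP).
rewrite [RHS](bigID (rvd h)) /= [X in _ = _ + X]big1 ?addr0; last first.
  by move=> P nP; rewrite big1 // => Q _; apply: F'0; rewrite (negbTE nP).
rewrite (sum_walks_agree _ _ _ _ ww); apply: eq_bigr => P hP.
rewrite (bigID (rvd h)) /= [X in _ + X]big1 ?addr0; last first.
  by move=> Q nQ; apply: F0; rewrite (negbTE nQ) andbF.
rewrite [RHS](bigID (rvd h)) /= [X in _ = _ + X]big1 ?addr0; last first.
  by move=> Q nQ; apply: F'0; rewrite (negbTE nQ) andbF.
by rewrite (sum_walks_agree _ _ _ _ ww); apply: eq_bigr => Q hQ; apply: hF.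
Qed.

Lemma arrv0 w0 P Q (x : R) : ~~ (rvd h P && rvd h Q) -> (arrv h w0 P Q)%:R * x = 0.
Proof. by rewrite /arrv => /negbTE->; rewrite mul0r. Qed.

Lemma claimed_agree M : claimed h w M = claimed h w' M.
Proof.
apply: sumPQ_agree => P Q; [|exact: arrv0|exact: arrv0].
by move=> hP hQ; rewrite arrv_agree !(wend_agree _ hP) !(wend_agree _ hQ).
Qed.

Lemma wt_agree f : wt h w f = wt h w' f.
Proof.
apply: sumPQ_agree => P Q; [|exact: arrv0|exact: arrv0].
by move=> hP hQ; rewrite arrv_agree !(wend_agree _ hP) !(wend_agree _ hQ).
Qed.

Lemma sum_rvd_agree r0 x (F F' : seq Slot -> R) : (forall P, rvd h P -> F P = F' P) ->
  \sum_(P <- walks w r0 x) (rvd h P)%:R * F P = \sum_(P <- walks w' r0 x) (rvd h P)%:R * F' P.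
Proof.
move=> hF; rewrite (bigID (rvd h)) /= [X in _ + X]big1 ?addr0; last first.
  by move=> P /negbTE->; rewrite mul0r.
rewrite [RHS](bigID (rvd h)) /= [X in _ = _ + X]big1 ?addr0; last first.
  by move=> P /negbTE->; rewrite mul0r.
by rewrite (sum_walks_agree _ _ _ _ ww); apply: eq_bigr => P hP; rewrite hF.
Qed.

Lemma nU_agree : nU h w = nU h w'.
Proof.
rewrite /nU; under eq_bigr do rewrite -[_%:R]mulr1; under [RHS]eq_bigr do rewrite -[_%:R]mulr1.
exact: sum_rvd_agree.
Qed.

Lemma nV_agree : nV h w = nV h w'.
Proof.
rewrite /nV; under eq_bigr do rewrite -[_%:R]mulr1; under [RHS]eq_bigr do rewrite -[_%:R]mulr1.
exact: sum_rvd_agree.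
Qed.

Lemma capR_agree : capR h w = capR h w'.
Proof.
rewrite /capR; congr andb; apply: eq_forallb => x; congr (_ <= _);
  by apply: sum_rvd_agree => P hP; rewrite (wend_agree _ hP).
Qed.

Lemma Y_agree M B : Y h w M B = Y h w' M B.
Proof. by rewrite /Y !claimed_agree nU_agree nV_agree. Qed.
End Agree.

Section Step.
Variables (h : hist) (w : Om) (sl : Slot) (B1 : {set Edge}).
Hypothesis hok : hist_ok ((sl, B1) :: h).
Let h' := (sl, B1) :: h.

Lemma rvd_cons P : rvd h P -> rvd h' P.
Proof. by apply: sub_all => t; rewrite /= inE => ->; rewrite orbT. Qed.

Lemma wst_cons (t : Slot) : t \in rvl h -> wst h' w t = wst h w t.
Proof.
move=> hx; rewrite /Submission.wst /=; case: eqP => //= E.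
by case: hok; rewrite /= E hx.
Qed.

Lemma alive_cons P : rvd h P -> alive h' w P = alive h w P.
Proof. by move/allP=> hP; apply: eq_in_all => t /hP ht; rewrite wst_cons. Qed.

Lemma arrv_cons P Q : rvd h P -> rvd h Q -> arrv h' w P Q = arrv h w P Q.
Proof.
move=> hP hQ; rewrite /arrv hP hQ !rvd_cons // !alive_cons //=; congr (_ && _).
have -> : sl \in P ++ Q = false; last by rewrite andbF.
apply/negP; rewrite mem_cat => hs; case: hok => /negP[] /=.
by case/orP: hs => [/(allP hP)|/(allP hQ)].
Qed.

(** A pair that arrives now has [sl] as its last slot, and [B1] is what Breaker owned at that
    moment; only his next move can spoil it at once. *)
Lemma arrv_new P Q : ~~ (rvd h P && rvd h Q) -> arrv h' w P Q ->
  me (wend w u P) (wend w v Q) \notin B1.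
Proof.
move=> nr /and3P[_ _ /= /orP[/and3P[]//|/hasP[e he /and3P[hall hin _]]]].
case/negP: nr; rewrite -all_cat; apply/allP=> t /(allP hall) /=; rewrite inE.
by case/orP=> [/eqP->|/(ents_sub he)//]; apply: ents_rvl.
Qed.

Lemma capR_mono : capR h' w -> capR h w.
Proof.
case/andP=> /forallP h1 /forallP h2; apply/andP; split; apply/forallP=> x.
  apply: le_trans (h1 x); apply: ler_sum => P _; rewrite ler_wpM2r // ler_nat.
  by case: (boolP (rvd h P)) => // /rvd_cons->.
apply: le_trans (h2 x); apply: ler_sum => P _; rewrite ler_wpM2r // ler_nat.
by case: (boolP (rvd h P)) => // /rvd_cons->.
Qed.

Lemma set2_inj x x' z : [set x; z] = [set x'; z] -> x = x'.
Proof.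
move=> E; have := set21 x z; rewrite E !inE => /orP[/eqP//|/eqP xz].
by have := set21 x' z; rewrite -E !inE xz orbb => /eqP.
Qed.

Lemma sum_me_le (F : {set Edge}) z (c : V -> R) K : (forall x, 0 <= c x <= K) ->
  \sum_x c x * (me x z \in F)%:R <= K * #|F|%:R.
Proof.
move=> hc; have K0 : 0 <= K by have /andP[] := hc z; apply: le_trans.
apply: (@le_trans _ _ (\sum_x K * (me x z \in F)%:R)).
  by apply: ler_sum => x _; rewrite ler_wpM2r //; case/andP: (hc x).
rewrite -mulr_sumr ler_wpM2l // -natr_sum ler_nat sum_bool_card.
rewrite -(card_in_imset (f := me^~ z)); last by move=> x x' _ _ [/set2_inj].
by apply: subset_leq_card; apply/subsetP=> f /imsetP[x]; rewrite inE => ? ->.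
Qed.

Lemma ru_ge0 h0 x : 0 <= ru h0 w x.
Proof. by apply: sumr_ge0 => P _; rewrite mulr_ge0. Qed.
Lemma rv_ge0 h0 x : 0 <= rv h0 w x.
Proof. by apply: sumr_ge0 => P _; rewrite mulr_ge0. Qed.

Lemma sum_ru h0 (G : V -> R) :
  \sum_(P <- walks w p u) (rvd h0 P)%:R * G (wend w u P) = \sum_x ru h0 w x * G x.
Proof.
under [RHS]eq_bigr do rewrite mulr_suml.
rewrite exchange_big /=; apply: eq_bigr => P _.
rewrite (bigD1 (wend w u P)) //= eqxx mulr1 big1 ?addr0 // => x.
by rewrite eq_sym => /negbTE->; rewrite mulr0 mul0r.
Qed.

Lemma sum_rv h0 (G : V -> R) :
  \sum_(Q <- walks w q v) (rvd h0 Q)%:R * G (wend w v Q) = \sum_x rv h0 w x * G x.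
Proof.
under [RHS]eq_bigr do rewrite mulr_suml.
rewrite exchange_big /=; apply: eq_bigr => Q _.
rewrite (bigD1 (wend w v Q)) //= eqxx mulr1 big1 ?addr0 // => x.
by rewrite eq_sym => /negbTE->; rewrite mulr0 mul0r.
Qed.

(* A newly arrived pair can be spoiled at once only through an edge of F, and
   each edge of F meets at most ku (kv) of the finished walks at a given end. *)
Lemma new_lost (F : {set Edge}) : capR h' w -> (#|F| <= b)%N ->
  sumPQ w (fun P Q => (arrv h' w P Q && ~~ (rvd h P && rvd h Q))%:R *
                       (me (wend w u P) (wend w v Q) \in F)%:R) <=
  b%:R * (ku * (nV h' w - nV h w) + kv * (nU h' w - nU h w)).
Proof.
case/andP=> /forallP capU /forallP capV Fb.
have FbR : #|F|%:R <= b%:R :> R by rewrite ler_nat.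
have newE r0 x : \sum_(P <- walks w r0 x) (rvd h' P && ~~ rvd h P)%:R =
   \sum_(P <- walks w r0 x) (rvd h' P)%:R - \sum_(P <- walks w r0 x) (rvd h P)%:R :> R.
  rewrite -sumrB; apply: eq_bigr => P _; case: (boolP (rvd h P)) => [/rvd_cons->|_] /=.
    by rewrite subrr.
  by rewrite andbT subr0.
have ku0 : 0 <= ku by apply: le_trans (ru_ge0 h' u) (capU u).
have kv0 : 0 <= kv by apply: le_trans (rv_ge0 h' u) (capV u).
apply: (@le_trans _ _ (\sum_(Q <- walks w q v) (rvd h' Q && ~~ rvd h Q)%:R * (ku * b%:R) +
     \sum_(P <- walks w p u) (rvd h' P && ~~ rvd h P)%:R * (kv * b%:R))); last first.
  by rewrite -!mulr_suml !newE /nU /nV; lra.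
apply: (@le_trans _ _ (sumPQ w (fun P Q =>
    (rvd h' Q && ~~ rvd h Q)%:R * ((rvd h' P)%:R * (me (wend w u P) (wend w v Q) \in F)%:R)) +
  sumPQ w (fun P Q =>
    (rvd h' P && ~~ rvd h P)%:R * ((rvd h' Q)%:R * (me (wend w u P) (wend w v Q) \in F)%:R)))).
  apply: le_sumPQ_add => P Q; rewrite /arrv.
  case: (rvd h' P); case: (rvd h' Q); rewrite /= ?andbF ?mul0r ?mulr0 ?addr0 // ?mul1r.
  case: (_ \in F); rewrite ?mulr0 ?addr0 ?mulr0 // !mulr1.
  by case: (rvd h P); case: (rvd h Q); rewrite /= ?andbF ?andbT ?addr0 ?add0r //; case: (_ && _) => /=; lra.
apply: lerD.
  rewrite /sumPQ exchange_big /=; apply: ler_sum => Q _; rewrite -mulr_sumr ler_wpM2l //.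
  rewrite (sum_ru h' (fun x => (me x (wend w v Q) \in F)%:R)).
  apply: le_trans (sum_me_le (K := ku) _ _ _) _; last by rewrite ler_wpM2l.
  by move=> x; rewrite ru_ge0 capU.
apply: ler_sum => P _; rewrite -mulr_sumr ler_wpM2l //.
rewrite (sum_rv h' (fun z => (me (wend w u P) z \in F)%:R)).
apply: (@le_trans _ _ (\sum_x rv h' w x * (me x (wend w u P) \in F)%:R)).
  by apply: ler_sum => x _; rewrite /me setUC.
apply: le_trans (sum_me_le (K := kv) _ _ _) _; last by rewrite ler_wpM2l.
by move=> x; rewrite rv_ge0 capV.
Qed.

Lemma wt_ge0 h0 f : 0 <= wt h0 w f.
Proof. by apply: sumr_ge0 => P _; apply: sumr_ge0 => Q _; rewrite mulr_ge0. Qed.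

Lemma claimed_setU h0 B (F : {set Edge}) : claimed h0 w (B :|: F) <= claimed h0 w B + \sum_(f in F) wt h0 w f.
Proof.
rewrite -sumPQ_sum; apply: le_sumPQ_add => P Q.
rewrite -mulr_sumr -mulrDr ler_wpM2l // in_setU.
case: (boolP (_ \in F)) => [hF|_]; last by rewrite orbF lerDl sumr_ge0.
by rewrite orbT (bigD1 _ hF) /= eqxx addrCA lerDl addr_ge0 ?sumr_ge0.
Qed.

Lemma claimed_mono h0 M M' : M \subset M' -> claimed h0 w M <= claimed h0 w M'.
Proof.
move=> sM; apply: le_sumPQ => P Q _ _; rewrite ler_wpM2l // ler_nat.
by case: (boolP (_ \in M)) => // /(subsetP sM)->.
Qed.

Lemma claimed_setU1 h0 M f : f \notin M -> claimed h0 w (f |: M) = claimed h0 w M + wt h0 w f.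
Proof.
move=> fM; rewrite /claimed /wt -sumPQ_add /sumPQ; apply: eq_bigr => P _; apply: eq_bigr => Q _.
rewrite -mulrDr in_setU1; case: eqP => [->|_]; first by rewrite (negbTE fM) add0r.
by rewrite addr0.
Qed.

Lemma claimed_cons M : claimed h w M <= claimed h' w M.
Proof.
apply: le_sumPQ => P Q _ _; rewrite ler_wpM2r // ler_nat.
case: (boolP (rvd h P && rvd h Q)) => [/andP[hP hQ]|nr]; first by rewrite arrv_cons.
by rewrite /arrv (negbTE nr).
Qed.

Lemma claimed_cons_le (F : {set Edge}) : capR h' w -> (#|F| <= b)%N ->
  claimed h' w (B1 :|: F) <= claimed h w (B1 :|: F) +
    b%:R * (ku * (nV h' w - nV h w) + kv * (nU h' w - nU h w)).
Proof.
move=> cap Fb; apply: le_trans (lerD (lexx _) (new_lost cap Fb)).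
apply: le_sumPQ_add => P Q; case: (boolP (rvd h P && rvd h Q)) => [/andP[hP hQ]|nr].
  by rewrite arrv_cons // andbF mul0r addr0.
rewrite andbT; case: (boolP (arrv h' w P Q)) => [ha|_]; last first.
  by rewrite !mul0r addr0 mulr_ge0.
by rewrite in_setU (negbTE (arrv_new nr ha)) /= lerDr mulr_ge0.
Qed.

(** The factor 2 stands for the two ways to assign the ends of [f] to the walks from [u] and from
    [v]. *)
Lemma wt_le h0 f : capR h0 w -> wt h0 w f <= 2 * (ku * kv).
Proof.
case/andP=> /forallP capU /forallP capV.
have ku0 : 0 <= ku by apply: le_trans (ru_ge0 h0 u) (capU u).
have kv0 : 0 <= kv by apply: le_trans (rv_ge0 h0 u) (capV u).
apply: (@le_trans _ _ (sumPQ w (fun P Q => (rvd h0 P)%:R * ((rvd h0 Q)%:R *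
    (me (wend w u P) (wend w v Q) \in [set f])%:R)))).
  apply: le_sumPQ => P Q _ _; rewrite /arrv in_set1.
  by case: (rvd h0 P); case: (rvd h0 Q); rewrite /= ?mul1r ?mul0r // ler_piMl // lern1; case: (_ && _).
rewrite /sumPQ; under eq_bigr do rewrite -mulr_sumr (sum_rv h0 (fun z => (me (wend w u _) z \in [set f])%:R)).
rewrite (sum_ru h0 (fun x => \sum_z rv h0 w z * (me x z \in [set f])%:R)).
have inner x : \sum_z rv h0 w z * (me x z \in [set f])%:R <= kv * (x \in f.2)%:R.
  case: (boolP (x \in f.2)) => xf; last first.
    rewrite big1 ?mulr0 // => z _; rewrite in_set1; case: eqP => [E|_]; last by rewrite mulr0.
    by move: xf; rewrite -E set21.
  rewrite mulr1; apply: le_trans (_ : kv * #|[set f]|%:R <= _); last by rewrite cards1 mulr1.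
  apply: le_trans (sum_me_le (c := rv h0 w) (K := kv) [set f] x _); last by move=> z; rewrite rv_ge0 capV.
  by apply: ler_sum => z _; rewrite /me setUC.
have [c2|c2] := leqP #|f.2| 2; last first.
  rewrite big1 ?mulr_ge0 // => x _; rewrite big1 ?mulr0 // => z _; rewrite in_set1.
  case: eqP => [E|_]; last by rewrite mulr0.
  by move: c2; rewrite -E cards2 ltnS; case: (_ != _).
apply: (@le_trans _ _ (\sum_x ku * (kv * (x \in f.2)%:R))).
  apply: ler_sum => x _; apply: le_trans (ler_wpM2l (ru_ge0 _ _) (inner x)) _.
  by rewrite ler_wpM2r ?mulr_ge0.
rewrite -mulr_sumr -mulr_sumr mulrA [leRHS]mulrC ler_wpM2l ?mulr_ge0 // -natr_sum ler_nat.
by rewrite sum_bool_card (_ : [set _ | _] = f.2) //; apply/setP=> x; rewrite inE.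
Qed.
Lemma Y_hit h0 M B (E1 : {set Edge}) : (#|E1| <= 1)%N -> [disjoint E1 & M] ->
  Y h0 w (E1 :|: M) B = Y h0 w M B + (1 - pr) * \sum_(f in E1) wt h0 w f.
Proof.
move=> c1 dE; case: (set_0Vmem E1) c1 dE => [->|[f fE]].
  by rewrite set0U big_set0 mulr0 addr0.
move=> c1 dE; have -> : E1 = [set f].
  by apply/esym/eqP; rewrite eqEcard sub1set fE cards1.
by rewrite big_set1 /Y claimed_setU1 ?(disjointFr dE fE) //; ring.
Qed.

Lemma Y_loss h0 M B (F : {set Edge}) :
  Y h0 w M B - pr * \sum_(f in F) wt h0 w f <= Y h0 w M (B :|: F).
Proof. by rewrite /Y; have := ler_wpM2l pr_ge0 (claimed_setU h0 B F); lra. Qed.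

Lemma Y_reveal M M' (F : {set Edge}) : capR h' w -> (#|F| <= b)%N -> M \subset M' ->
  Y h w M B1 - pr * \sum_(f in F) wt h w f <= Y h' w M' (B1 :|: F).
Proof.
move=> cap Fb sM; rewrite /Y.
have := ler_wpM2l pr_ge0 (le_trans (claimed_cons_le cap Fb) (lerD (claimed_setU h B1 F) (lexx _))).
have : (1 - pr) * claimed h w M <= (1 - pr) * claimed h' w M'.
  by rewrite ler_wpM2l ?subr_ge0 // (le_trans (claimed_cons M)) // claimed_mono.
by lra.
Qed.
End Step.
End Arrivals.
End Hits.

(** * Maker's combined strategy *)

Section Strategy.
Variables (R : realFieldType) (ex : R -> R).
Hypotheses (exD : forall x y, ex (x + y) = ex x * ex y) (ex_ge : forall x, 1 + x <= ex x).
Variables (n s D m : nat) (emb : 'I_s.+1 -> 'I_m -> 'I_n).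
Hypothesis emb_inj : forall a y a' y', emb a y = emb a' y' -> (a, y) = (a', y').
Hypotheses (m_gt0 : (0 < m)%N) (D_gt0 : (0 < D)%N).
Variables (em : nat) (L : R).
Hypothesis L_ge0 : 0 <= L.

Notation V := 'I_n.
Notation Edge := ('I_s * {set V})%type.
Notation Key := ('I_s * 'I_s.+1)%type.
Notation Box := (V * Key)%type.
Notation Slot := (V * Key * 'I_D)%type.
Notation Om := {ffun Slot -> 'I_m}.
Notation hist := (seq (Slot * {set Edge})).
Notation tgt := (tgt emb).
Notation walks := (walks emb).
Notation wend := (wend emb).
Notation wasted := (wasted emb).
Notation hist_ok := (hist_ok emb em).
Notation valid := (valid emb em).
Notation super := (@super R n s D m emb em).
Notation cw := (@cw R n s D m emb).
Notation Jcomp := (@Jcomp R ex n s D m L).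
Notation wst := (wst emb).
Implicit Types (w : Om) (p : seq Key) (x u v z : V) (q : seq Slot) (sl : Slot) (h : hist) (B : {set Edge}) (be : Box) (k : Key).

Let mR_gt0 : 0 < m%:R :> R. Proof. by rewrite ltr0n. Qed.
Let DR_gt0 : 0 < D%:R :> R. Proof. by rewrite ltr0n. Qed.
Variables (X : {set Edge}) (b : nat) (ku kv LB : R).
Hypotheses (hX : forall f, f \in X -> #|f.2| = 2%N) (b_gt0 : (0 < b)%N) (ku_gt0 : 0 < ku) (kv_gt0 : 0 < kv).
Hypothesis LB_ge : 2 * #|{: Box}|%:R <= ex LB.
Hypothesis em_ge : 16 * b%:R * (D%:R + LB) <= em%:R.

Let pr : R := (16 * b%:R)^-1.
Let lam : R := (2 * (ku * kv))^-1.
Let bR_gt0 : 0 < b%:R :> R. Proof. by rewrite ltr0n. Qed.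
Let bR_ge1 : 1 <= b%:R :> R. Proof. by rewrite ler1n. Qed.
Let prb : pr * b%:R = 1 / 16.
Proof. by rewrite /pr; field; exact: lt0r_neq0. Qed.
Let pr_gt0 : 0 < pr. Proof. by rewrite invr_gt0; apply: mulr_gt0. Qed.
Let pr_le : pr <= 1 / 16. Proof. by rewrite -prb ler_peMr // ltW. Qed.
Let pr_ge0 : 0 <= pr := ltW pr_gt0.
Let pr_le1 : pr <= 1. Proof. by have := pr_le; lra. Qed.
Let lam_gt0 : 0 < lam. Proof. by rewrite invr_gt0 !mulr_gt0. Qed.
Let ex_gt0 := ex_gt0 exD ex_ge.

Notation Task := (V * V * seq Key * seq Key * 'I_s)%type.
Implicit Types (t : Task) (M F : {set Edge}) (f : Edge).
Definition Yt t h w M B := Y emb t.1.1.1.1 t.1.1.1.2 t.1.1.2 t.1.2 t.2 ku kv pr b h w M B.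
Definition capt t h w := capR emb t.1.1.1.1 t.1.1.1.2 t.1.1.2 t.1.2 ku kv h w.
Definition wtt t h w f : R := wt R emb t.1.1.1.1 t.1.1.1.2 t.1.1.2 t.1.2 t.2 h w f.
Definition Lpot (ts : seq Task) h w M B : R :=
  \sum_(t <- ts) (capt t h w)%:R * ex (- (lam * Yt t h w M B)).

Lemma Lpot_agree ts h w w' M B : (forall sl, sl \in rvl h -> w sl = w' sl) ->
  Lpot ts h w M B = Lpot ts h w' M B.
Proof.
move=> ww; apply: eq_bigr => t _.
by congr (_%:R * ex (- (lam * _))); [congr nat_of_bool; exact: capR_agree | exact: Y_agree].
Qed.

(** [g] is the weight Maker hits and [S] the weight Breaker takes in the two moves of a block. Since
    [lam * g <= 1] and [pr * (lam * S) <= 1 / 8], both exponentials can be linearised. The flags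
    record the caps: these can only be lost, and then the term vanishes. *)
Lemma hit_real (c c' : bool) y y' g S : (c' -> c) -> (c' -> y + (1 - pr) * g - pr * S <= y') ->
  0 <= g -> 0 <= S -> (c -> lam * g <= 1) -> (c -> lam * S <= 2 * b%:R) ->
  c'%:R * ex (- (lam * y')) <=
  c%:R * ex (- (lam * y)) - c%:R * ex (- (lam * y)) * (lam * (1 / 4) * g - 2 * lam * pr * S).
Proof.
move=> cc hy g0 S0 hg hS; case: c' cc hy => [cc hy|_ _]; last first.
  rewrite mul0r -[X in _ <= X - _]mulr1 -mulrBr.
  case: c hg hS => [hg hS|_ _]; last first.
    by rewrite [_ * ex _]mul0r mul0r lexx.
  apply: mulr_ge0; first by rewrite mul1r (ltW (ex_gt0 _)).
  have := hg isT; have : 0 <= lam * pr * S by rewrite mulr_ge0 // mulr_ge0 // ltW.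
  by nra.
case: c cc hg hS => [_ hg hS|cc]; last by have := cc isT.
rewrite !mul1r.
have {}hg := hg isT; have {}hS := hS isT; have {}hy := hy isT.
pose al := lam * ((1 - pr) * g); pose be := pr * (lam * S).
have lg0 : 0 <= lam * g by rewrite mulr_ge0 ?(ltW lam_gt0).
have lS0 : 0 <= lam * S by rewrite mulr_ge0 ?(ltW lam_gt0).
have al01 : 0 <= al <= 1.
  rewrite /al mulrCA; apply/andP; split; first by rewrite mulr_ge0 ?subr_ge0.
  by rewrite mulr_ile1 ?subr_ge0 // gerBl.
have be01 : 0 <= be <= 1 / 2.
  rewrite /be mulr_ge0 //=; apply: le_trans (ler_wpM2l pr_ge0 hS) _.
  by rewrite mulrCA prb; lra.
apply: (@le_trans _ _ (ex (- (lam * y)) * ((1 - al / 2) * (1 + 2 * be)))).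
  apply: (@le_trans _ _ (ex (- (lam * y) + (- al + be)))).
    apply: (ex_le exD ex_ge); have := ler_wpM2l (ltW lam_gt0) hy; rewrite /al /be; lra.
  rewrite exD ler_wpM2l ?(ltW (ex_gt0 _)) // exD ler_pM ?(ltW (ex_gt0 _)) //.
    exact: ex_neg_half.
  exact: ex_pos_double.
rewrite -[X in _ <= X - _]mulr1 -mulrBr ler_wpM2l ?(ltW (ex_gt0 _)) //.
have alE : al = lam * g - pr * (lam * g) by rewrite /al; ring.
have -> : 2 * lam * pr * S = 2 * be by rewrite /be; ring.
have : 0 <= al * be by case/andP: al01 => ? _; case/andP: be01 => ? _; apply: mulr_ge0.
have : pr * (lam * g) <= 1 / 16 * (lam * g) by rewrite ler_wpM2r.
have : lam * (1 / 4) * g = 1 / 4 * (lam * g) by ring.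
nra.
Qed.

Lemma arg_max_set (T : finType) (A : {set T}) (G : T -> R) (i0 : T) : i0 \in A ->
  exists2 i : T, i \in A & forall j, j \in A -> G j <= G i.
Proof. by move=> fA; case: (arg_maxP G fA) => f hf hmax; exists f. Qed.

Definition hitw ts h w M B f : R :=
  \sum_(t <- ts) (capt t h w)%:R * ex (- (lam * Yt t h w M B)) * wtt t h w f.

Lemma hitw_agree ts h w w' M B f : (forall sl, sl \in rvl h -> w sl = w' sl) ->
  hitw ts h w M B f = hitw ts h w' M B f.
Proof.
move=> ww; apply: eq_bigr => t _; congr (_ * _); last exact: wt_agree.
by congr (_%:R * ex (- (lam * _))); [congr nat_of_bool; exact: capR_agree | exact: Y_agree].
Qed.

(** [F1] and [F2] have at most [2 * b] edges together, none heavier than [E1]. As [pr * b = 1 / 16],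
    their cost of [2 * pr * (2 * b)] per unit of weight is exactly the gain [1 / 4]. All weights are
    those before the block, since arrivals inside it are refunded by [Y]. *)
Lemma hit_bound ts h w M B (E1 : {set Edge}) : hist_ok h -> (#|E1| <= 1)%N ->
  E1 \subset X :\: (M :|: B) ->
  (forall f, f \in X :\: (M :|: B) -> hitw ts h w M B f <= \sum_(g in E1) hitw ts h w M B g) ->
  forall F1 F2 h' M', F1 \subset X :\: (M :|: B) -> F2 \subset X :\: (M :|: B) ->
    (#|F1| <= b)%N -> (#|F2| <= b)%N -> E1 :|: M \subset M' ->
    h' = h \/ (exists2 sl, h' = (sl, B :|: F1) :: h & hist_ok h') ->
    Lpot ts h' w M' (B :|: F1 :|: F2) <= Lpot ts h w M B.
Proof.
move=> hok E1c; pose c t : R := (capt t h w)%:R * ex (- (lam * Yt t h w M B)).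
set G := hitw ts h w M B; set A := X :\: (M :|: B) => E1A E1max.
have c0 t : 0 <= c t by rewrite mulr_ge0 ?(ltW (ex_gt0 _)).
have wt0 t f : 0 <= wtt t h w f by apply: wt_ge0.
move=> F1 F2 h' M' F1A F2A F1b F2b sM hh.
pose S t : R := \sum_(f in F1) wtt t h w f + \sum_(f in F2) wtt t h w f.
pose g t : R := \sum_(f in E1) wtt t h w f.
have dE : [disjoint E1 & M].
  apply: disjointWl E1A _; rewrite disjoint_sym -setI_eq0; apply/eqP/setP=> z; rewrite !inE.
  by case: (z \in M).
have capm t : capt t h' w -> capt t h w.
  by case: hh => [->//|[sl -> hok']]; apply: capR_mono.
have wtle t f : capt t h w -> lam * wtt t h w f <= 1.
  by move=> ct; rewrite mulrC ler_pdivrMr ?mul1r ?mulr_gt0 //; apply: wt_le.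
have sumle t F : capt t h w -> lam * \sum_(f in F) wtt t h w f <= #|F|%:R.
  move=> ct; rewrite mulr_sumr -[#|F|%:R]mulr1 mulr_natl -sumr_const.
  by apply: ler_sum => f _; apply: wtle.
have Yle t : capt t h' w ->
    Yt t h w M B + (1 - pr) * g t - pr * S t <= Yt t h' w M' (B :|: F1 :|: F2).
  move=> ct; rewrite /Yt -Y_hit // /S mulrDr opprD addrA.
  have L1 := Y_loss emb t.1.1.1.1 t.1.1.1.2 t.1.1.2 t.1.2 t.2 ku kv b pr_ge0 w h (E1 :|: M) B F1.
  apply: le_trans (lerD L1 (lexx _)) _.
  case: hh ct => [->|[sl -> hok'] ct].
    move=> ct; apply: le_trans (Y_loss _ _ _ _ _ _ _ _ _ pr_ge0 _ _ _ _ _) _.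
    by rewrite /Y lerD2r lerD2r ler_wpM2l ?subr_ge0 // claimed_mono.
  exact: (Y_reveal _ pr_ge0 pr_le1 hok' ct F2b sM).
apply: (@le_trans _ _ (\sum_(t <- ts) (c t - c t * (lam * (1 / 4) * g t - 2 * lam * pr * S t)))).
  apply: ler_sum => t _; apply: hit_real; [exact: capm|exact: Yle| | | |].
  - exact: sumr_ge0.
  - by rewrite addr_ge0 ?sumr_ge0.
  - by move=> ct; apply: le_trans (sumle _ _ ct) _; rewrite lern1.
  move=> ct; rewrite mulrDr; apply: le_trans (lerD (sumle _ _ ct) (sumle _ _ ct)) _.
  by rewrite mulr_natl mulr2n -natrD -natrD ler_nat leq_add.
rewrite sumrB lerBlDr lerDl.
have swapG F : \sum_(t <- ts) c t * \sum_(f in F) wtt t h w f = \sum_(f in F) G f.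
  by rewrite [RHS]exchange_big; apply: eq_bigr => t _; rewrite mulr_sumr.
have -> : \sum_(t <- ts) c t * (lam * (1 / 4) * g t - 2 * lam * pr * S t) =
   lam * (1 / 4) * (\sum_(f in E1) G f) - 2 * lam * pr * (\sum_(f in F1) G f + \sum_(f in F2) G f).
  rewrite -!swapG -big_split /= !mulr_sumr -sumrB; apply: eq_bigr => t _.
  by rewrite /g /S; ring.
have Fle F : F \subset A -> (#|F| <= b)%N -> \sum_(f in F) G f <= b%:R * \sum_(f in E1) G f.
  move=> FA Fb; apply: (@le_trans _ _ (\sum_(f in F) \sum_(g in E1) G g)).
    by apply: ler_sum => f fF; apply: E1max; apply: (subsetP FA).
  rewrite sumr_const -(mulr_natl (\sum_(g in E1) G g)) ler_wpM2r ?ler_nat //.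
  by apply: sumr_ge0 => f _; apply: sumr_ge0 => t _; apply: mulr_ge0 (c0 t) (wt0 t _).
have := lerD (Fle _ F1A F1b) (Fle _ F2A F2b) => hle.
have := ler_wpM2l (mulr_ge0 (ltW lam_gt0) pr_ge0) hle.
have -> : lam * pr * (b%:R * \sum_(f in E1) G f + b%:R * \sum_(f in E1) G f) =
  lam * (pr * b%:R) * 2 * \sum_(f in E1) G f by ring.
rewrite prb.
have : 0 <= \sum_(f in E1) G f.
  by apply: sumr_ge0 => f _; apply: sumr_ge0 => t _; apply: mulr_ge0 (c0 t) (wt0 t _).
move: (\sum_(f in E1) G f) => GE GE0 hl.
have := mulr_ge0 (ltW lam_gt0) GE0.
by lra.
Qed.

(* Maker hits the free edge of largest potential-weighted weight; the two
   Breaker moves that follow can only touch edges of smaller weight. *)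
Lemma hit_step ts h w M B : hist_ok h -> exists E1 : {set Edge},
  [/\ (#|E1| <= 1)%N, E1 \subset X :\: (M :|: B) &
  forall F1 F2 h' M' w', F1 \subset X :\: (M :|: B) -> F2 \subset X :\: (M :|: B) ->
    (#|F1| <= b)%N -> (#|F2| <= b)%N -> E1 :|: M \subset M' ->
    h' = h \/ (exists2 sl, h' = (sl, B :|: F1) :: h & hist_ok h') ->
    (forall sl, sl \in rvl h -> w sl = w' sl) ->
    Lpot ts h' w' M' (B :|: F1 :|: F2) <= Lpot ts h w M B].
Proof.
move=> hok; set A := X :\: (M :|: B); set G := hitw ts h w M B.
have [E1 [E1c E1A E1max]] : exists E1 : {set Edge}, [/\ (#|E1| <= 1)%N, E1 \subset A &
    forall f, f \in A -> G f <= \sum_(g in E1) G g].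
  case: (set_0Vmem A) => [A0|[f0 f0A]].
    by exists set0; split; rewrite ?cards0 ?sub0set // => f; rewrite A0 inE.
  have [f fA fmax] := arg_max_set G f0A; exists [set f].
  by split; rewrite ?cards1 ?sub1set // => g gA; rewrite big_set1 fmax.
exists E1; split=> // F1 F2 h' M' w' F1A F2A F1b F2b sM hh ww.
rewrite (Lpot_agree _ _ _ ww); apply: (hit_bound (E1 := E1)) => // f fA.
by rewrite -!(hitw_agree _ _ _ _ ww); under eq_bigr do rewrite -(hitw_agree _ _ _ _ ww); apply: E1max.
Qed.

Definition bdeg B be := #|[set y | sedge be (emb be.2.2 y) \in B]|.
Definition nrev h be := #|[set l | (be, l) \in rvl h]|.
(** Each Breaker edge in the box raises the exponent by [pr], each revealed slot lowers it by 1.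
    With at most [D] slots, a term of at most [ex LB] means a degree of at most [16 * b * (D + LB)],
    which [em_ge] allows. *)
Definition bterm h B be : R := ex (pr * (bdeg B be)%:R - (nrev h be)%:R).
Definition Pot h B : R := \sum_(be | ~~ complete h be) bterm h B be.

Lemma emb_edge_inj x y y' a a' : [set x; emb a y] = [set x; emb a' y'] -> (a, y) = (a', y').
Proof. by rewrite setUC [RHS]setUC => /set2_inj /emb_inj. Qed.

Lemma bdegU B F be : (bdeg (B :|: F) be <= bdeg B be + bdeg F be)%N.
Proof.
rewrite /bdeg (_ : [set y | _ \in B :|: F] =
  [set y | sedge be (emb be.2.2 y) \in B] :|: [set y | sedge be (emb be.2.2 y) \in F]).
  by rewrite cardsU leq_subr.
by apply/setP=> y; rewrite !inE.
Qed.

Lemma bdeg_le F be : (bdeg F be <= #|F|)%N.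
Proof.
rewrite /bdeg -(card_in_imset (f := fun y => sedge be (emb be.2.2 y))); last first.
  by move=> y y' _ _ [/emb_edge_inj[]].
by apply: subset_leq_card; apply/subsetP=> f /imsetP[y]; rewrite inE => ? ->.
Qed.

(* An edge lies in at most two boxes: the box is determined by which end of
   the edge is its apex. *)
Lemma sum_bdeg F : F \subset X -> (\sum_be bdeg F be <= 2 * #|F|)%N.
Proof.
move=> FX; pose E f := [set z : Box * 'I_m | sedge z.1 (emb z.1.2.2 z.2) == f].
apply: (@leq_trans (\sum_(f in F) #|E f|)); last first.
  rewrite mulnC -sum_nat_const; apply: leq_sum => f fF; rewrite -(hX (subsetP FX f fF)).
  rewrite -(card_in_imset (f := fun z : Box * 'I_m => z.1.1)).
    apply: subset_leq_card; apply/subsetP=> x /imsetP[[[x' [c a]] y]].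
    by rewrite inE => /eqP <- ->; rewrite /sedge /= set21.
  move=> [[x [c a]] y] [[x' [c' a']] y']; rewrite !inE /sedge /= => /eqP <- /eqP[-> E1] xx.
  by move: E1; rewrite xx => /emb_edge_inj[-> ->].
rewrite /E /bdeg; under eq_bigr do rewrite -sum_bool_card.
under [leqRHS]eq_bigr do rewrite -sum_bool_card.
rewrite [leqRHS]exchange_big [leqLHS]pair_big /=; apply: eq_leq; apply: eq_bigr => z _.
case: (boolP (_ \in F)) => [hF|nF]; last first.
  by rewrite big1 // => f fF; case: eqP nF => // ->; rewrite fF.
rewrite (bigD1 _ hF) /= eqxx big1 // => f /andP[_]; by rewrite eq_sym => /negbTE->.
Qed.

Lemma bterm_gt0 h B be : 0 < bterm h B be.
Proof. exact: ex_gt0. Qed.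

Lemma prdeg F be : (#|F| <= b)%N -> 0 <= pr * (bdeg F be)%:R <= 1 / 16.
Proof.
move=> Fb; rewrite mulr_ge0 //= -prb ler_wpM2l // ler_nat.
exact: leq_trans (bdeg_le _ _) Fb.
Qed.

Lemma btermU h B F be : (#|F| <= b)%N ->
  bterm h (B :|: F) be <= bterm h B be * (1 + 2 * (pr * (bdeg F be)%:R)).
Proof.
move=> /(prdeg be) hF.
apply: (@le_trans _ _ (bterm h B be * ex (pr * (bdeg F be)%:R))).
  rewrite -exD (ex_le exD ex_ge) //.
  have : (bdeg (B :|: F) be)%:R <= (bdeg B be)%:R + (bdeg F be)%:R :> R.
    by rewrite -natrD ler_nat bdegU.
  by move=> /(ler_wpM2l pr_ge0); lra.
rewrite ler_wpM2l ?(ltW (bterm_gt0 _ _ _)) //; apply: ex_pos_double => //.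
by case/andP: hF => -> ?; lra.
Qed.

Lemma btermU_rev h B F be : (#|F| <= b)%N ->
  bterm h (B :|: F) be * (1 - pr * (bdeg F be)%:R) <= bterm h B be.
Proof.
move=> /(prdeg be) hF.
apply: (@le_trans _ _ (bterm h (B :|: F) be * ex (- (pr * (bdeg F be)%:R)))).
  by rewrite ler_wpM2l ?(ltW (bterm_gt0 _ _ _)) // ex_ge.
rewrite -exD (ex_le exD ex_ge) //.
have : (bdeg (B :|: F) be)%:R <= (bdeg B be)%:R + (bdeg F be)%:R :> R.
  by rewrite -natrD ler_nat bdegU.
by move=> /(ler_wpM2l pr_ge0); lra.
Qed.

Lemma sum_prdeg (P : pred Box) F T : F \subset X -> (#|F| <= b)%N -> 0 <= T ->
  \sum_(be | P be) T * (pr * (bdeg F be)%:R) <= T / 8.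
Proof.
move=> FX Fb T0; rewrite -!mulr_sumr ler_wpM2l //.
have h2 : \sum_(be | P be) (bdeg F be)%:R <= 2 * b%:R :> R.
  rewrite -natr_sum -natrM ler_nat; apply: leq_trans (_ : 2 * #|F| <= _)%N; last by rewrite leq_mul2l.
  apply: leq_trans (sum_bdeg FX); rewrite [leqRHS](bigID P) /=; exact: leq_addr.
by apply: le_trans (ler_wpM2l pr_ge0 h2) _; rewrite mulrCA prb; lra.
Qed.

Lemma Pot_valid h B F : hist_ok h -> F \subset X -> (#|F| <= b)%N ->
  Pot h B <= #|{: Box}|%:R -> valid h (B :|: F).
Proof.
move=> hok FX Fb hP be nc; rewrite -(ler_nat R); apply: le_trans em_ge.
have b1 : bterm h B be <= #|{: Box}|%:R.
  apply: le_trans hP; rewrite /Pot (bigD1 be) //= lerDl sumr_ge0 // => b' _.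
  exact: ltW (bterm_gt0 _ _ _).
have b2 : bterm h (B :|: F) be <= ex LB.
  apply: le_trans LB_ge; apply: le_trans (btermU _ _ _ Fb) _.
  have /andP[p0 p1] := prdeg be Fb; rewrite mulrC ler_pM ?(ltW (bterm_gt0 _ _ _)) //; lra.
have nr : (nrev h be)%:R <= D%:R :> R by rewrite ler_nat -[leqRHS]card_ord max_card.
have : pr * (bdeg (B :|: F) be)%:R - (nrev h be)%:R <= LB.
  by rewrite leNgt; apply/negP=> /(ex_lt exD ex_ge); rewrite ltNge b2.
move=> h1; have h2 : pr * (bdeg (B :|: F) be)%:R <= D%:R + LB by lra.
by move: h2; rewrite /pr mulrC ler_pdivrMr ?mulr_gt0 // [leRHS]mulrC.
Qed.

Lemma complete_rvl h sl B be : complete ((sl, B) :: h) be = false -> complete h be = false.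
Proof.
move/negbT => nc; apply/negbTE; apply: contra nc => /forallP hc; apply/forallP=> l.
by rewrite /= inE hc orbT.
Qed.

(** The slot is taken in the unfinished box with the largest term [T]. Revealing it removes at least
    [T / 2], while the two moves of Breaker add at most [T / 8] and [T / 4]. *)
Lemma box_step h B F1 : hist_ok h -> F1 \subset X -> (#|F1| <= b)%N ->
  (exists be, ~~ complete h be) ->
  exists2 sl, sl \notin rvl h & forall F2, F2 \subset X -> (#|F2| <= b)%N ->
    Pot ((sl, B :|: F1) :: h) (B :|: F1 :|: F2) <= Pot h B.
Proof.
move=> hok F1X F1b [be0 nc0]; set B1 := B :|: F1.
have : be0 \in [set be | ~~ complete h be] by rewrite inE.
case/(arg_max_set (bterm h B1)) => be; rewrite inE => nc bmax.
have {}bmax be' : ~~ complete h be' -> bterm h B1 be' <= bterm h B1 be by move=> ?; apply: bmax; rewrite inE.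
move: (bterm_gt0 h B1 be) bmax; set T := bterm h B1 be => T0 bmax.
have /existsP[l hl] : [exists l, (be, l) \notin rvl h] by rewrite -negb_forall.
exists (be, l) => // F2 F2X F2b; set h' := (_, _) :: h.
have nrev_le be' : (nrev h be' <= nrev h' be')%N.
  by apply: subset_leq_card; apply/subsetP=> l'; rewrite !inE => ->; rewrite orbT.
have nrev_lt : nrev h' be = (nrev h be).+1.
  rewrite /nrev (_ : [set l0 | _ \in rvl h'] = l |: [set l0 | (be, l0) \in rvl h]).
    by rewrite cardsU1 inE hl.
  by apply/setP=> l'; rewrite !inE /= xpair_eqE eqxx.
have bt_le be' B' : bterm h' B' be' <= bterm h B' be'.
  by rewrite (ex_le exD ex_ge) // lerB // ler_nat.
have bt_half : bterm h' B1 be <= T / 2.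
  have -> : bterm h' B1 be = T * ex (- 1).
    by rewrite /T /bterm -exD nrev_lt -natr1; congr ex; ring.
  by rewrite ler_wpM2l ?(ltW T0) //; have := ex_neg_half exD ex_ge (x := 1); lra.
have nch be' : ~~ complete h' be' -> ~~ complete h be'.
  by move=> /negbTE /complete_rvl ->.
(* [F1] came before the choice of the box, so its effect is estimated from the terms after it, among
   which [T] is the maximum. *)
have S1 : Pot h B1 <= Pot h B + T / 8.
  apply: le_trans (lerD (lexx _) (sum_prdeg (fun be => ~~ complete h be) F1X F1b (ltW T0))).
  rewrite -big_split /=; apply: ler_sum => be' nc'.
  have := btermU_rev h B be' F1b; have := ler_wpM2r (proj1 (andP (prdeg be' F1b))) (bmax _ nc').
  by rewrite -/B1; lra.
have S2 : Pot h' (B1 :|: F2) <= Pot h' B1 + T / 4.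
  have -> : T / 4 = (2 * T) / 8 by field.
  have T2 : 0 <= 2 * T by rewrite mulr_ge0 ?ltW.
  apply: le_trans (lerD (lexx _) (sum_prdeg (fun be => ~~ complete h' be) F2X F2b T2)).
  rewrite -big_split /=; apply: ler_sum => be' nc'.
  have := btermU h' B1 be' F2b.
  have := ler_wpM2r (proj1 (andP (prdeg be' F2b))) (le_trans (bt_le be' B1) (bmax _ (nch _ nc'))).
  by lra.
have S3 : Pot h' B1 <= Pot h B1 - T / 2.
  rewrite [in leRHS]/Pot (bigD1 be) //= -/T.
  have -> (z : R) : T + z - T / 2 = T / 2 + z by lra.
  rewrite /Pot big_mkcond [X in _ <= _ + X]big_mkcond (bigD1 be) //=; apply: lerD.
    by case: ifP => // _; lra.
  rewrite big_mkcond [leRHS]big_mkcond; apply: ler_sum => be' _.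
  case: eqP => //= _; rewrite ?andbF // ?andbT.
  case: (boolP (complete h' be')) => /= nc'.
    by case: ifP => // _; apply: ltW (bterm_gt0 _ _ _).
  by rewrite (nch _ nc').
by lra.
Qed.

Lemma full_incomplete h : hist_ok h -> (size h < #|{: Slot}|)%N -> exists be, ~~ complete h be.
Proof.
move=> hok sz; apply/existsP; rewrite -[[exists _, _]]negbK negb_exists; apply/negP=> /forallP hc.
move: sz; rewrite ltnNge -(size_map fst) -(card_uniqP (rvl_uniq hok)) => /negP[].
apply: subset_leq_card; apply/subsetP=> -[be l] _.
by have := hc be; rewrite negbK => /forallP /(_ l).
Qed.

Lemma full_size h : hist_ok h -> (#|{: Slot}| <= size h)%N -> full h.
Proof.
move=> hok sz sl; have u := rvl_uniq hok.
have c : #|rvl h| = #|{: Slot}|.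
  by apply/eqP; rewrite eqn_leq max_card (card_uniqP u) size_map.
by rewrite ((subset_cardP c) (subset_predT _)).
Qed.

Lemma Y0_ge0 t w : 0 <= Yt t [::] w set0 set0.
Proof.
have c0 : claimed R emb t.1.1.1.1 t.1.1.1.2 t.1.1.2 t.1.2 t.2 [::] w set0 = 0.
  by rewrite /claimed /sumPQ big1 // => P _; rewrite big1 // => Q _; rewrite inE mulr0.
rewrite /Yt /Y c0 !mulr0 subrr add0r mulr_ge0 ?mulr_ge0 //.
by apply: addr_ge0; apply: mulr_ge0; rewrite ?(ltW ku_gt0) ?(ltW kv_gt0) //; apply: sumr_ge0.
Qed.

(** In each block Maker hits a middle edge, then reveals a slot and plays its edge. The slot is
    recorded with Breaker's edges after [F1], those present when its edge is played. *)
Lemma maker_strategy (ts : seq Task) (Jtot : hist -> Om -> R) (P : {set Edge} -> Prop) :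
  super Jtot -> \sum_w (Jtot [::] w - 1) < 0 ->
  (forall h w M B, hist_ok h -> full h -> (forall e, e \in h -> e.2 \subset B) ->
     Jtot h w < 1 -> Lpot ts h w M B <= (size ts)%:R -> X \subset M :|: B ->
     (forall e : Slot * {set Edge} * hist, e \in ents h -> ~~ wasted e.2 e.1.1 e.1.2 w ->
        sedge e.1.1.1 (tgt w e.1.1) \in X -> sedge e.1.1.1 (tgt w e.1.1) \in M) -> P M) ->
  mwin X b P set0 set0.
Proof.
move=> sJ J0 fin.
pose Inv r M B := exists h w, [/\ hist_ok h, forall e, e \in h -> e.2 \subset B,
   r = (#|{: Slot}| - size h)%N & \sum_(w' | agree h w w') (Jtot h w' - 1) < 0] /\
  [/\ Pot h B <= #|{: Box}|%:R, Lpot ts h w M B <= (size ts)%:R &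
   forall e : Slot * {set Edge} * hist, e \in ents h -> ~~ wasted e.2 e.1.1 e.1.2 w ->
        sedge e.1.1.1 (tgt w e.1.1) \in X -> sedge e.1.1.1 (tgt w e.1.1) \in M].
apply: (mwin_strategy (I := Inv) _ _ _ (r := #|{: Slot}|)).
- move=> r M B x [h [w [[h1 h2 h3 h4] [h5 h6 h7]]]] xB; exists h, w; split=> //; split=> //; last first.
    by move=> e he hw hX'; rewrite in_setU1 h7 ?orbT.
  apply: le_trans h6; apply: ler_sum => t _; rewrite ler_wpM2l //.
  rewrite (ex_le exD ex_ge) // lerN2 ler_wpM2l ?(ltW lam_gt0) // /Yt /Y.
  have : claimed R emb t.1.1.1.1 t.1.1.1.2 t.1.1.2 t.1.2 t.2 h w M <=
         claimed R emb t.1.1.1.1 t.1.1.1.2 t.1.1.2 t.1.2 t.2 h w (x |: M).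
    by apply: claimed_mono; apply: subsetUr.
  have p1 : 0 <= 1 - pr by rewrite subr_ge0.
  by move=> /(ler_wpM2l p1); lra.
- move=> r M B [h [w [[h1 h2 h3 h4] [h5 h6 h7]]]] dMB.
  have [E1 [E1c E1A hE1]] := hit_step ts w M B h1.
  have XMB : X :\: (M :|: B) \subset X :\: B by rewrite setDS ?subsetUr.
  exists E1; split=> //; first exact: subset_trans E1A XMB.
  move=> F1 F1A F1b.
  have F1A' : F1 \subset X :\: (M :|: B).
    by apply: subset_trans F1A _; rewrite setDS // -setUA subsetUr.
  have F1X : F1 \subset X := subset_trans F1A (subsetDl _ _).
  have F2sub (E2 F2 : {set Edge}) : F2 \subset X :\: (E2 :|: E1 :|: M :|: B :|: F1) ->
     F2 \subset X :\: (M :|: B) /\ F2 \subset X.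
    move=> F2A; split; last exact: subset_trans F2A (subsetDl _ _).
    apply: subset_trans F2A _; rewrite setDS //; apply/subsetP=> z; rewrite !inE.
    by case/orP=> ->; rewrite !orbT.
  case: (ltnP (size h) #|{: Slot}|) => sz; last first.
    (* All slots are revealed: only the hitting game goes on. *)
    exists set0; split; rewrite ?cards0 ?sub0set // => F2 /F2sub[F2A F2X] F2b.
    exists h, w; split; split=> //.
    + by move=> e /h2 he; apply: subset_trans he _; rewrite -setUA subsetUl.
    + have s0 : (#|{: Slot}| - size h)%N = 0%N by apply/eqP; rewrite subn_eq0.
      by rewrite h3 s0.
    + rewrite /Pot big_pred0 ?ler0n // => be; apply/negbTE; rewrite negbK; apply/forallP=> l.
      exact: full_size.
    + rewrite set0U; apply: le_trans (hE1 F1 F2 h _ w F1A' F2A F1b F2b (subxx _) (or_introl erefl) (fun _ _ => erefl)) h6.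
    + by move=> e he hw hX'; rewrite !in_setU h7 ?orbT.
  have [sl slh hsl] := box_step B h1 F1X F1b (full_incomplete h1 sz).
  have hok' : hist_ok ((sl, B :|: F1) :: h).
    split=> //=; first exact: Pot_valid.
    by move=> e' /h2 he; apply: subset_trans he _; apply: subsetUl.
  have [y hy] := choose_value sJ hok' m_gt0 h4.
  set w' := upd w sl y in hy.
  have ww : forall sl', sl' \in rvl h -> w sl' = w' sl'.
    by move=> sl' hs; rewrite /w' upd_out //; apply: contraNneq slh => <-.
  pose ed := sedge sl.1 (tgt w' sl).
  (* A wasted slot, or one whose edge is not on the board, calls for no move. *)
  pose good := ~~ wasted h sl (B :|: F1) w' && (ed \in X).
  exists (if good then [set ed] else set0); split.
  + by case: ifP; rewrite ?cards1 ?cards0.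
  + case: ifP => [/andP[hw hX']|_]; last by rewrite sub0set.
    rewrite sub1set inE hX' andbT; apply: contra hw => hB.
    by rewrite /wasted /Submission.wasted hB.
  move=> F2 F2A' F2b; have [F2A F2X] := F2sub _ _ F2A'.
  exists ((sl, B :|: F1) :: h), w'; split; split=> //.
  + move=> e; rewrite inE => /orP[/eqP->|/h2 he]; first exact: subsetUl.
    by apply: subset_trans he _; rewrite -setUA subsetUl.
  + by rewrite h3 subnS.
  + exact: le_trans (hsl _ F2X F2b) h5.
  + apply: le_trans (hE1 F1 F2 _ _ w' F1A' F2A F1b F2b _ (or_intror _) ww) h6.
      by rewrite -setUA subsetUr.
    by exists sl.
  move=> e; rewrite inE => /orP[/eqP->|he] /= hw hX'.
    by rewrite /good hw hX' -setUA in_setU1 eqxx.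
  have E : wasted e.2 e.1.1 e.1.2 w' = wasted e.2 e.1.1 e.1.2 w.
    by apply/esym; apply: wasted_agree he; exact: ww.
  have E2 : tgt w' e.1.1 = tgt w e.1.1 by rewrite /Submission.tgt ww ?ents_rvl.
  by rewrite !in_setU E2 h7 ?orbT // -?E -?E2.
- move=> M B [h [w [[h1 h2 h3 h4] [h5 h6 h7]]]] dMB XMB.
  have hf : full h by apply: full_size => //; rewrite -subn_eq0 -h3.
  apply: (fin h w M B) => //.
  (* With every slot revealed [w] is its own only completion, so the negative sum says
     [Jtot h w < 1]. *)
  rewrite (big_pred1 w) in h4; first by rewrite -subr_lt0.
  move=> w'; apply/allP/eqP=> [ag|-> //]; apply/ffunP=> sl; have := hf sl.
  by case/mapP=> e he ->; apply/eqP/ag.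
exists [::], [ffun=> Ordinal m_gt0]; split; split=> //.
- by rewrite subn0.
- rewrite -sum1_card natr_sum; apply: (@le_trans _ _ (\sum_be 1)); last by apply: ler_sum.
  rewrite /Pot big_mkcond; apply: ler_sum => be _; case: ifP => // _.
  rewrite /bterm (_ : bdeg set0 be = 0%N) ?mulr0 ?sub0r; last first.
    by rewrite /bdeg eq_card0 // => y; rewrite !inE.
  by rewrite (_ : nrev [::] be = 0%N) ?oppr0 ?(ex0 exD ex_ge) // /nrev eq_card0 // => y; rewrite !inE.
- rewrite /Lpot -sum1_size natr_sum; apply: ler_sum => t _.
  rewrite -[leRHS]mulr1 ler_pM ?(ltW (ex_gt0 _)) //; first by case: capt.
  rewrite -(ex0 exD ex_ge) (ex_le exD ex_ge) // oppr_le0 mulr_ge0 ?(ltW lam_gt0) //.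
  exact: Y0_ge0.
Qed.
End Strategy.

(** * Counting *)

Section Count.
Variables (R : realFieldType) (ex : R -> R).
Hypotheses (exD : forall x y, ex (x + y) = ex x * ex y) (ex_ge : forall x, 1 + x <= ex x).
Variables (n s D m : nat) (emb : 'I_s.+1 -> 'I_m -> 'I_n).
Hypothesis emb_inj : forall a y a' y', emb a y = emb a' y' -> (a, y) = (a', y').
Hypotheses (m_gt0 : (0 < m)%N) (D_gt0 : (0 < D)%N).
Variables (em : nat) (L : R).
Hypothesis L_ge0 : 0 <= L.

Notation V := 'I_n.
Notation Edge := ('I_s * {set V})%type.
Notation Key := ('I_s * 'I_s.+1)%type.
Notation Box := (V * Key)%type.
Notation Slot := (V * Key * 'I_D)%type.
Notation Om := {ffun Slot -> 'I_m}.
Notation hist := (seq (Slot * {set Edge})).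
Notation tgt := (tgt emb).
Notation walks := (walks emb).
Notation wend := (wend emb).
Notation wasted := (wasted emb).
Notation hist_ok := (hist_ok emb em).
Notation valid := (valid emb em).
Notation super := (@super R n s D m emb em).
Notation cw := (@cw R n s D m emb).
Notation Jcomp := (@Jcomp R ex n s D m L).
Notation wst := (wst emb).
Implicit Types (w : Om) (p : seq Key) (x u v z : V) (q : seq Slot) (sl : Slot) (h : hist) (B : {set Edge}) (be : Box) (k : Key).

Let mR_gt0 : 0 < m%:R :> R. Proof. by rewrite ltr0n. Qed.
Let DR_gt0 : 0 < D%:R :> R. Proof. by rewrite ltr0n. Qed.
Local Notation entry := (Slot * {set Edge} * hist)%type.

Fixpoint splits p : seq (seq Key * Key * seq Key) :=
  if p is k :: p' then ([::], k, p') :: [seq (k :: t.1.1, t.1.2, t.2) | t <- splits p'] else [::].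

Lemma splits_cat p t : t \in splits p -> p = t.1.1 ++ t.1.2 :: t.2.
Proof.
elim: p t => //= k p IH t; rewrite inE => /orP[/eqP->//|/mapP[t' /IH E ->]].
by rewrite /= {1}E.
Qed.

Lemma mem_splits p1 k p2 : (p1, k, p2) \in splits (p1 ++ k :: p2).
Proof.
elim: p1 => [|k1 p1 IH] /=; rewrite inE ?eqxx //; apply/orP; right.
by apply/mapP; exists (p1, k, p2).
Qed.

Lemma size_splits p : size (splits p) = size p.
Proof. by elim: p => //= k p IH; rewrite size_map IH. Qed.

(** A union bound over the position of the wasted slot; the hypothesis has the form of
    [waste_final]. *)
Lemma dead_count h w u p (wb : R) : (forall p1 k p2, p = p1 ++ k :: p2 ->
    \sum_x \sum_(l < D) cw w p1 u x * (wst h w (x, k, l))%:R <= D%:R ^+ (size p1).+1 * wb) ->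
  \sum_(P <- walks w p u) (~~ alive emb h w P)%:R <= (size p)%:R * (D%:R ^+ size p * wb).
Proof.
elim/last_ind: p => [|p k IH] hw; first by rewrite sum_walks0 /alive /= mul0r.
rewrite -cats1 sum_walks_cat cats1 size_rcons.
have /IH{}IH : forall p1 k0 p2, p = p1 ++ k0 :: p2 ->
    \sum_x \sum_(l < D) cw w p1 u x * (wst h w (x, k0, l))%:R <= D%:R ^+ (size p1).+1 * wb.
  by move=> p1 k0 p2 E; apply: (hw _ _ (rcons p2 k)); rewrite E -cats1 -catA cat_cons cats1.
have hk : \sum_x \sum_(l < D) cw w p u x * (wst h w (x, k, l))%:R <= D%:R ^+ (size p).+1 * wb.
  by apply: (hw _ _ [::]); rewrite cats1.
apply: (@le_trans _ _ (\sum_(P <- walks w p u) (D%:R * (~~ alive emb h w P)%:R +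
          \sum_(l < D) (wst h w (wend w u P, k, l))%:R))).
  apply: ler_sum => P _; rewrite sum_walks_cons.
  have -> : D%:R * (~~ alive emb h w P)%:R = \sum_(l < D) (~~ alive emb h w P)%:R :> R.
    by rewrite sumr_const card_ord mulr_natl.
  rewrite -big_split; apply: ler_sum => l _; rewrite sum_walks0 /alive all_cat /= andbT negb_and negbK.
  by case: (all _ _); case: (wst _ _ _); rewrite /= ?addr0 ?add0r // lerDl.
rewrite big_split /= -mulr_sumr (sum_wend emb w p u (fun x => \sum_(l < D) (wst h w (x, k, l))%:R)).
under [X in _ + X]eq_bigr do rewrite mulr_sumr.
apply: le_trans (lerD (ler_wpM2l (ltW DR_gt0) IH) hk) _.
by rewrite -natr1 exprS le_eqVlt; apply/orP; left; apply/eqP; ring.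
Qed.

Lemma cap_all w u p (kap : nat -> R) : 1 <= kap 0%N ->
  (forall p1 k p2 x0, p = p1 ++ k :: p2 -> (forall x, cw w p1 u x <= kap (size p1)) ->
     cw w (rcons p1 k) u x0 <= kap (size p1).+1) ->
  forall x, cw w p u x <= kap (size p).
Proof.
move=> k0; elim/last_ind: p => [|p k IH] hw x.
  by rewrite cw_nil; apply: le_trans k0; case: (_ == _).
rewrite size_rcons; apply: (hw _ _ [::]); first by rewrite cats1.
apply: IH => p1 k1 p2 x0 E; apply: (hw _ _ (rcons p2 k)).
by rewrite E -cats1 -catA cat_cons cats1.
Qed.

(** Since [kk] occurs only once among the keys, a walk passes [sl] exactly when its first part ends
    at the apex of [sl] and its step at [kk] is [sl]; so the count factorises. *)
Lemma sum_walks_mem w v (q1 : seq Key) kk (q2 : seq Key) sl (G : V -> R) : sl.1.2 = kk -> kk \notin q1 -> kk \notin q2 ->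
  \sum_(Q <- walks w (q1 ++ kk :: q2) v) (sl \in Q)%:R * G (wend w v Q) =
  cw w q1 v sl.1.1 * \sum_z cw w q2 (tgt w sl) z * G z.
Proof.
move=> ek k1 k2; rewrite sum_walks_cat.
have notin r x Q : Q \in walks w r x -> kk \notin r -> (sl \in Q) = false.
  move=> hQ; apply: contraNF => hs; rewrite -ek -(walks_keys hQ); apply/mapP; by exists sl.
rewrite {1}/Submission.cw big_distrl /= big_seq [RHS]big_seq; apply: eq_bigr => Q1 hQ1.
rewrite sum_walks_cons.
transitivity (\sum_(l < D) ((wend w v Q1, kk, l) == sl)%:R * \sum_z cw w q2 (tgt w sl) z * G z).
  apply: eq_bigr => l _; rewrite -(sum_wend emb w q2 (tgt w sl)).
  case: eqP => [<-|ne]; last first.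
    rewrite mul0r big_seq big1 // => Q2 hQ2; rewrite mem_cat inE (notin _ _ _ hQ1 k1).
    by rewrite (notin _ _ _ hQ2 k2) orbF; case: eqP ne => [->//|]; rewrite mul0r.
  rewrite mul1r; apply: eq_bigr => Q2 _; rewrite mem_cat inE eqxx orbT mul1r.
  by rewrite wend_cat.
rewrite -mulr_suml; congr (_ * _); case: eqP => [E|ne]; last first.
  by rewrite big1 // => l _; case: eqP => // E; case: ne; rewrite -E.
rewrite (bigD1 sl.2) //= big1 ?addr0 => [|l /eqP nl].
  by rewrite E -ek; case: (sl) => -[] /= x k l; rewrite eqxx.
by case: eqP => // E'; case: nl; rewrite -E'.
Qed.

Definition badp u v cm aV h w P Q := has (fun e : entry => (e.1.1 \in Q) &&
   bf cm aV e.2 e.1.2 (wend w u P) (wend w v Q)) (ents h).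

Lemma bad_count u v p (q : seq Key) cm aV h w (K : R) : uniq q ->
  (forall (q1 : seq Key) kk (q2 : seq Key), q = q1 ++ kk :: q2 -> \sum_(e <- ents h | e.1.1.1.2 == kk)
     cost R emb u v p q1 q2 cm aV e.2 e.1.1 e.1.2 w <= K) ->
  sumPQ emb u v p q w (fun P Q => (badp u v cm aV h w P Q)%:R) <= (size q)%:R * K.
Proof.
move=> uq hK.
pose S (e : entry) : R := \sum_x cw w p u x * \sum_(Q <- walks w q v)
   (e.1.1 \in Q)%:R * (bf cm aV e.2 e.1.2 x (wend w v Q))%:R.
apply: (@le_trans _ _ (\sum_(e <- ents h) S e)).
  rewrite /S /sumPQ.
  under [leRHS]eq_bigr => e _ do rewrite -(sum_wend emb w p u (fun x => \sum_(Q <- walks w q v)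
   (e.1.1 \in Q)%:R * (bf cm aV e.2 e.1.2 x (wend w v Q))%:R)).
  rewrite [leRHS]exchange_big /=; apply: ler_sum => P _.
  rewrite [leRHS]exchange_big /=; apply: ler_sum => Q _; rewrite /badp.
  elim: (ents h) => [|e E IH]; first by rewrite big_nil.
  rewrite big_cons /=; case: (_ \in Q) => /=; last by rewrite mul0r add0r.
  case: (bf _ _ _ _ _ _) => /=; last by rewrite mulr0 add0r.
  by rewrite mulr1 lerDl sumr_ge0 // => e' _; rewrite mulr_ge0.
apply: (@le_trans _ _ (\sum_(kk <- q) \sum_(e <- ents h | e.1.1.1.2 == kk) S e)); last first.
  apply: (@le_trans _ _ (\sum_(kk <- q) K)); last first.
    by rewrite big_const_seq count_predT iter_addr_0 mulr_natl.
  rewrite big_seq [leRHS]big_seq; apply: ler_sum => kk hk.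
  have [q1 [q2 Eq]] : exists q1 q2 : seq Key, q = q1 ++ kk :: q2.
    by case/splitPr: hk => q1 q2; exists q1, q2.
  move: (uq); rewrite Eq cat_uniq /= => /and3P[_ nq /andP[n2 _]].
  have n1 : kk \notin q1 by move: nq; rewrite negb_or => /andP[].
  apply: le_trans (hK _ _ _ Eq); apply: ler_sum => e /eqP ek.
  rewrite /S /cost Eq; apply: ler_sum => x _.
  rewrite (sum_walks_mem w v (fun z => (bf cm aV e.2 e.1.2 x z)%:R) ek n1 n2).
  rewrite mulrA mulr_sumr; apply: ler_sum => z _.
  by rewrite !mulrA.
under [leRHS]eq_bigr do rewrite big_mkcond.
rewrite [leRHS]exchange_big /= le_eqVlt; apply/orP; left; apply/eqP; apply: eq_bigr => e _.
rewrite -big_mkcond /=; case: (boolP (e.1.1.1.2 \in q)) => hq.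
  by rewrite (big_rem _ hq) /= eqxx big_seq_cond big1 ?addr0 // => kk /andP[]; rewrite mem_rem_uniq // inE => /andP[/negbTE]; rewrite eq_sym => ->.
rewrite big_seq_cond big1 => [|kk /andP[h1 /eqP h2]]; last by rewrite h2 h1 in hq.
rewrite /S big1 // => x _; rewrite big_seq big1 ?mulr0 // => Q /walks_keys hQ.
case: (boolP (_ \in Q)) => [hs|_]; last by rewrite mul0r.
by move: hq; rewrite -hQ => /negP[]; apply/mapP; exists e.1.1.
Qed.

Lemma last_entry h (S : seq Slot) : S != [::] -> all (mem (rvl h)) S ->
  exists e : entry, [/\ e \in ents h, e.1.1 \in S & all (mem (e.1.1 :: rvl e.2)) S].
Proof.
move=> S0; elim: h => [|e h IH] hS.
  by case: S S0 hS => // a S _ /andP[].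
case: (boolP (e.1 \in S)) => he; first by exists (e, h); split; rewrite ?mem_head.
have [|e' [h1 h2 h3]] := IH.
  apply/allP=> t ht; have := allP hS t ht; rewrite /= inE => /orP[/eqP E|//].
  by rewrite E (negbTE he) in ht.
by exists e'; split; rewrite ?inE ?h1 ?orbT.
Qed.

Lemma ents_trans h e e' : e \in ents h -> e' \in ents e.2 -> e' \in ents h.
Proof.
elim: h => //= e0 h IH; rewrite inE => /orP[/eqP->/= he'|he he'].
  by rewrite inE he' orbT.
by rewrite inE IH ?orbT.
Qed.

(** The selection [a] of [gain_final]: at every revelation in the middle box at [x] the pair was
    still to be gained. *)
Definition pa v cm aV h w x Q := all (fun e : entry => (e.1.1.1 == (x, (cm, aV))) ==>
  ~~ all (mem (rvl e.2)) Q && (me cm x (wend w v Q) \notin e.1.2)) (ents h).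

Lemma classify_half v cm aV h w x Q e : hist_ok h -> e \in ents h -> e.1.1 \in Q ->
  [|| me cm x (wend w v Q) \notin e.1.2, bf cm aV e.2 e.1.2 x (wend w v Q) | pa v cm aV h w x Q].
Proof.
move=> hok he eQ; have [ne _ _ hok'] : hist_ok (e.1 :: e.2) by apply: ents_ok he.
case: (boolP (bf _ _ _ _ _ _)) => [|nb]; rewrite ?orbT //=.
case: (boolP (complete e.2 (x, (cm, aV)))) => hc; last first.
  by move: nb; rewrite /bf bfroz_inc // => ->.
apply/orP; right; apply/allP=> e' he'; apply/implyP=> /eqP ebx.
have he2 : e' \in ents e.2.
  have /forallP/(_ e'.1.1.2) := hc; rewrite -ebx => hs.
  have /ents_ex[e'' h1 h2] : e'.1.1 \in rvl e.2 by case: (e'.1.1) hs.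
  by rewrite -(ents_inj hok (ents_trans he h1) he' h2).
apply/andP; split.
  by apply: contra ne => /allP/(_ _ eQ) /(ents_sub he2).
by apply: contra nb => hm; apply: (subsetP (bfroz_sub _ hok' hc he2 ebx)).
Qed.

(** Consider the slot of [P ++ Q] revealed last. If the middle edge was not Breaker's then, the pair
    arrives; otherwise [classify_half] applies to the walk containing that slot, with the middle box
    at the end of the other walk. *)
Lemma classify u v cm aU aV h w P Q : hist_ok h -> full h -> P != [::] ->
  alive emb h w P -> alive emb h w Q ->
  [|| arrv emb u v cm h w P Q, badp u v cm aV h w P Q, badp v u cm aU h w Q P,
     pa v cm aV h w (wend w u P) Q | pa u cm aU h w (wend w v Q) P].
Proof.
move=> hok hf P0 aP aQ; case: (boolP (arrv _ _ _ _ _ _ _ _)) => //= na.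
have [||e [he eS hall]] := @last_entry h (P ++ Q).
- by case: (P) P0.
- by apply/allP=> t _; apply: hf.
have hB : me cm (wend w u P) (wend w v Q) \in e.1.2.
  apply: contraR na => nB; rewrite /arrv aP aQ /= /rvd.
  have -> : all (mem (rvl h)) P by apply/allP=> t _; apply: hf.
  have -> : all (mem (rvl h)) Q by apply/allP=> t _; apply: hf.
  by apply/hasP; exists e => //; rewrite hall eS.
move: eS; rewrite mem_cat => /orP[eP|eQ].
  have := classify_half u cm aU w (wend w v Q) hok he eP; rewrite {1}/me setUC hB /=.
  case/orP=> [hb|->]; last by rewrite !orbT.
  by apply/orP; right; apply/orP; left; apply/hasP; exists e => //; rewrite eP.
have := classify_half v cm aV w (wend w u P) hok he eQ; rewrite hB /=.
case/orP=> [hb|->]; last by rewrite !orbT.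
by apply/orP; left; apply/hasP; exists e => //; rewrite eQ.
Qed.
End Count.

(** * From surviving pairs of walks to paths *)

Section Paths.
Variables (R : realFieldType) (ex : R -> R).
Hypotheses (exD : forall x y, ex (x + y) = ex x * ex y) (ex_ge : forall x, 1 + x <= ex x).
Variables (n s D m : nat) (emb : 'I_s.+1 -> 'I_m -> 'I_n).
Hypothesis emb_inj : forall a y a' y', emb a y = emb a' y' -> (a, y) = (a', y').
Hypotheses (m_gt0 : (0 < m)%N) (D_gt0 : (0 < D)%N).
Variables (em : nat) (L : R).
Hypothesis L_ge0 : 0 <= L.

Notation V := 'I_n.
Notation Edge := ('I_s * {set V})%type.
Notation Key := ('I_s * 'I_s.+1)%type.
Notation Box := (V * Key)%type.
Notation Slot := (V * Key * 'I_D)%type.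
Notation Om := {ffun Slot -> 'I_m}.
Notation hist := (seq (Slot * {set Edge})).
Notation tgt := (tgt emb).
Notation walks := (walks emb).
Notation wend := (wend emb).
Notation wasted := (wasted emb).
Notation hist_ok := (hist_ok emb em).
Notation valid := (valid emb em).
Notation super := (@super R n s D m emb em).
Notation cw := (@cw R n s D m emb).
Notation Jcomp := (@Jcomp R ex n s D m L).
Notation wst := (wst emb).
Implicit Types (w : Om) (p : seq Key) (x u v z : V) (q : seq Slot) (sl : Slot) (h : hist) (B : {set Edge}) (be : Box) (k : Key).

Let mR_gt0 : 0 < m%:R :> R. Proof. by rewrite ltr0n. Qed.
Let DR_gt0 : 0 < D%:R :> R. Proof. by rewrite ltr0n. Qed.
Local Notation entry := (Slot * {set Edge} * hist)%type.

Fact idx_lt (a b c t : nat) : (a + b).+1 = c -> (a < t)%N -> (t <= c)%N -> (t - a.+1 < b.+1)%N.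
Proof. by clear; lia. Qed.
Fact idx_rev (a b c t : nat) : (a + b).+1 = c -> (a < t)%N -> (t <= c)%N ->
  (b.+1 - (t - a.+1).+1 = c - t)%N.
Proof. by clear; lia. Qed.
Fact idx_le (a b c t : nat) : (a + b).+1 = c -> (a < t)%N -> (c - t < b.+1)%N.
Proof. by clear; lia. Qed.
Fact idx_s (a b c : nat) : (a + b).+1 = c -> (a < c)%N /\ (c - a.+1 = b)%N.
Proof. by clear; split; lia. Qed.
Fact idx_j (a b c t : nat) : (a + b).+1 = c -> (a < t)%N -> (t < c)%N ->
  [/\ (c - t = (c.-1 - t).+1)%N, (c - t.+1 = c.-1 - t)%N & (c.-1 - t < b)%N].
Proof. by clear; split; lia. Qed.
Variables (h : hist) (w : Om) (M : {set Edge}).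
Hypotheses (hok : hist_ok h) (hf : full h).
Hypothesis hM : forall e : entry, e \in ents h -> ~~ wasted e.2 e.1.1 e.1.2 w ->
  e.1.1.1.1 != tgt w e.1.1 -> sedge e.1.1.1 (tgt w e.1.1) \in M.

Lemma ents_tri g (e e' : entry) : e \in ents g -> e' \in ents g ->
  [\/ e = e', e.1 \in e'.2 | e'.1 \in e.2].
Proof.
have entm g' (f : entry) : f \in ents g' -> f.1 \in g'.
  by elim: g' => //= a g' IH; rewrite !inE => /orP[/eqP->|/IH->]; rewrite ?eqxx ?orbT.
elim: g => //= a g IH; rewrite !inE => /orP[/eqP->|he] /orP[/eqP->|he'].
- by constructor 1.
- by constructor 3; apply: entm.
- by constructor 2; apply: entm.
- exact: IH.
Qed.

(** Of two such entries the later would repeat the earlier and thus be wasted. *)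
Lemma unwasted_inj (e e' : entry) : e \in ents h -> e' \in ents h ->
  ~~ wasted e.2 e.1.1 e.1.2 w -> ~~ wasted e'.2 e'.1.1 e'.1.2 w ->
  e.1.1.1 = e'.1.1.1 -> w e.1.1 = w e'.1.1 -> e = e'.
Proof.
move=> he he' nw nw' E1 E2; case: (ents_tri he he') => // hin.
  by case/negP: nw'; apply/orP; right; apply/hasP; exists e.1 => //; rewrite E1 E2 !eqxx.
by case/negP: nw; apply/orP; right; apply/hasP; exists e'.1 => //; rewrite E1 E2 !eqxx.
Qed.

Lemma unwst_ent sl : ~~ wst h w sl -> exists e : entry,
  [/\ e \in ents h, e.1.1 = sl & ~~ wasted e.2 e.1.1 e.1.2 w].
Proof.
move=> nw; have [e he E] := ents_ex (hf sl); exists e; split=> //.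
by rewrite -(wst_ents w hok he) E.
Qed.

Lemma unwst_inj sl sl' : ~~ wst h w sl -> ~~ wst h w sl' -> sl.1 = sl'.1 -> w sl = w sl' ->
  sl = sl'.
Proof.
case/unwst_ent=> e [he <- nw] /unwst_ent[e' [he' <- nw']] E1 E2.
by rewrite (unwasted_inj he he' nw nw' E1 E2).
Qed.

Lemma walks_inj p x P P' : P \in walks w p x -> P' \in walks w p x ->
  alive emb h w P -> alive emb h w P' -> map (tgt w) P = map (tgt w) P' -> P = P'.
Proof.
elim: p x P P' => [|k p IH] x P P' /=; first by rewrite !inE => /eqP-> /eqP->.
case/allpairsPdep=> sl [q [/mapP[l _ ->] hq ->]] /allpairsPdep[sl' [q' [/mapP[l' _ ->] hq' ->]]].
case/andP=> nw aq /andP[nw' aq'] [E1 E2].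
have El : (x, k, l) = (x, k, l').
  by apply: unwst_inj => //; move/emb_inj: E1 => [].
rewrite El in hq E1 *; congr (_ :: _); exact: IH hq hq' _ _ _.
Qed.

Lemma walk_nth p x P t sl0 : P \in walks w p x -> (t < size p)%N ->
  (nth sl0 P t).1 = (nth x (x :: map (tgt w) P) t, nth sl0.1.2 p t).
Proof.
elim: p x P t => //= k p IH x P t /allpairsPdep[sl [q [/mapP[l _ ->] hq ->]]].
case: t => //= t; rewrite ltnS => ht; rewrite (IH _ _ _ hq ht).
by congr (_, _); apply: set_nth_default; rewrite /= size_map -(size_map (fun sl => sl.1.2)) (walks_keys hq) ltnW.
Qed.

Lemma walk_size p x P : P \in walks w p x -> size P = size p.
Proof. by move/walks_keys <-; rewrite size_map. Qed.

Lemma tgt_uniq q : uniq [seq sl.1.2.2 | sl <- q] -> uniq (map (tgt w) q).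
Proof.
elim: q => //= sl q IH /andP[nin /IH->]; rewrite andbT; apply: contra nin.
by case/mapP=> sl' hs /emb_inj[E _]; rewrite E; apply/mapP; exists sl'.
Qed.

Section OneTask.
Variables (u v : V) (p q : seq Key) (cm : 'I_s) (aV : 'I_s.+1).
Implicit Types (P Q : seq Slot).

Definition npairs : R := sumPQ emb u v p q w (fun P Q =>
  [&& alive emb h w P, alive emb h w Q & me cm (wend w u P) (wend w v Q) \in M]%:R).

Definition dead x r : R := \sum_(P <- walks w r x) (~~ alive emb h w P)%:R.

Lemma sum_bool_has (T : eqType) (r : seq T) (f : pred T) : uniq r ->
  {in r &, forall e e', f e -> f e' -> e = e'} -> \sum_(e <- r) (f e)%:R <= (has f r)%:R :> R.
Proof.
elim: r => [|e r IH] /=; first by rewrite big_nil.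
case/andP=> ne ur hi; rewrite big_cons; have [fe|_] := boolP (f e) => /=.
  rewrite big_seq big1 ?addr0 // => e' he'; case: (boolP (f e')) => // fe'.
  by rewrite (hi e e') ?mem_head ?inE ?he' ?orbT // in ne; rewrite he' in ne.
rewrite add0r; apply: IH => // a b ha hb; apply: hi; by rewrite inE ?ha ?hb orbT.
Qed.

Hypothesis srctgt : forall P Q, P \in walks w p u -> Q \in walks w q v -> wend w u P != wend w v Q.

(** A pair of unwasted walks is gained at most once, since two gains would be unwasted slots of one
    box with the same value. A wasted walk costs at most what a row or a column can hold. *)
Lemma gains_le (muU muV Ku Kv : R) : (forall x, cw w p u x <= Ku) -> (forall z, cw w q v z <= Kv) ->
  0 <= Ku -> 0 <= Kv -> 0 < muU -> 0 < muV ->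
  gains emb u v p q cm aV muU muV h w <=
    npairs + dead u p * (muV + Kv) + dead v q * (muU + Ku).
Proof.
move=> hKu hKv Ku0 Kv0 muU0 muV0; set E := eg emb u v p q cm aV muU muV h w.
pose i (e : entry) Q : R := (wend w v Q == tgt w e.1.1)%:R * (~~ all (mem (rvl e.2)) Q)%:R.
have i0 e Q : 0 <= i e Q by rewrite mulr_ge0.
pose s0 (e : entry) P : R := (wend w u P == e.1.1.1.1)%:R.
have -> : gains emb u v p q cm aV muU muV h w = sumPQ emb u v p q w (fun P Q => \sum_(e <- E) s0 e P * i e Q).
  rewrite /gains -/E /sumPQ.
  under [RHS]eq_bigr do rewrite exchange_big /=.
  rewrite exchange_big /=; apply: eq_bigr => e _; rewrite /Submission.cw mulr_suml; apply: eq_bigr => P _.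
  by rewrite mulr_sumr.
apply: (@le_trans _ _ (sumPQ emb u v p q w (fun P Q =>
    [&& alive emb h w P, alive emb h w Q & me cm (wend w u P) (wend w v Q) \in M]%:R +
    ((~~ alive emb h w P)%:R * (\sum_(e <- E) s0 e P * i e Q) +
     (~~ alive emb h w Q)%:R * (\sum_(e <- E) s0 e P * i e Q))))).
  apply: le_sumPQ => P Q hP hQ; case: (boolP (alive emb h w P)) => aP /=; last first.
    by rewrite add0r mul1r lerDl mulr_ge0 // sumr_ge0 // => e _; rewrite mulr_ge0 ?ler0n ?i0.
  case: (boolP (alive emb h w Q)) => aQ /=; last by rewrite mul0r mul1r !add0r.
  rewrite !mul0r !addr0.
  pose f (e : entry) := (wend w u P == e.1.1.1.1) && (wend w v Q == tgt w e.1.1).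
  have hE e : e \in E -> [/\ e \in ents h, e.1.1.1.2 = (cm, aV) & ~~ wasted e.2 e.1.1 e.1.2 w].
    by move=> he; split; [exact: eg_ents he|exact: eg_key he|case/and4P: (eg_elig he)].
  apply: (@le_trans _ _ (\sum_(e <- E) (f e)%:R)).
    apply: ler_sum => e _; rewrite /s0 /i /f; case: (_ == _) => /=; last by rewrite mul0r.
    by rewrite mul1r; case: (_ == _); rewrite ?mul0r // mul1r; case: (~~ _).
  have hi : {in E &, forall e e', f e -> f e' -> e = e'}.
    move=> e e' /hE[h1 h2 h3] /hE[h1' h2' h3'] /andP[/eqP s1 /eqP t1] /andP[/eqP s2 /eqP t2].
    apply: unwasted_inj => //.
      by rewrite [LHS]surjective_pairing [RHS]surjective_pairing h2 h2' -s1 -s2.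
    by have := etrans (esym t1) t2; rewrite /Submission.tgt => /emb_inj[].
  apply: le_trans (sum_bool_has _ hi) _; first by apply: eg_uniq; exact: hok.
  rewrite ler_nat; case: (boolP (has f E)) => // /hasP[e he /andP[/eqP s1 /eqP t1]].
  have [h1 h2 h3] := hE e he; suff -> : me cm (wend w u P) (wend w v Q) \in M by [].
  have -> : me cm (wend w u P) (wend w v Q) = sedge e.1.1.1 (tgt w e.1.1).
    by rewrite /me s1 t1 /sedge h2.
  by apply: hM => //; rewrite -s1 -t1 srctgt.
rewrite (sumPQ_add emb u v p q w (fun P Q => [&& alive emb h w P, alive emb h w Q & me cm (wend w u P) (wend w v Q) \in M]%:R)).
rewrite -/npairs -addrA lerD2l.
rewrite (sumPQ_add emb u v p q w (fun P Q => (~~ alive emb h w P)%:R * _)); apply: lerD.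
  rewrite /dead mulr_suml /sumPQ; apply: ler_sum => P _; rewrite -mulr_sumr ler_wpM2l //.
  apply: le_trans (row_le u p cm aV muU muV0 h (wend w u P) hKv Kv0).
  rewrite exchange_big /= /row -/E [leRHS]big_mkcond /=; apply: ler_sum => e _.
  rewrite -mulr_sumr /s0 eq_sym; case: eqP => _; last by rewrite mul0r.
  by rewrite mul1r.
rewrite /dead mulr_suml /sumPQ exchange_big; apply: ler_sum => Q _; rewrite -mulr_sumr ler_wpM2l //.
apply: le_trans (col_le v q cm aV muV muU0 h (wend w v Q) hKu Ku0).
rewrite exchange_big /= /col -/E [leRHS]big_mkcond /=; apply: ler_sum => e _.
rewrite -mulr_suml -/(cw w p u e.1.1.1.1) /i eq_sym; case: eqP => _; last by rewrite mul0r mulr0.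
by rewrite mul1r ler_piMr ?cw_ge0 //; case: (~~ _).
Qed.
End OneTask.

Lemma walk_edge p x P t k0 : P \in walks w p x -> alive emb h w P -> (t < size p)%N ->
  uniq (x :: map (tgt w) P) ->
  ((nth k0 p t).1, [set nth x (x :: map (tgt w) P) t; nth x (map (tgt w) P) t]) \in M.
Proof.
move=> hP aP ht uP; have sz := walk_size hP.
pose sl0 : Slot := (x, k0, Ordinal D_gt0); set sl := nth sl0 P t.
have slP : sl \in P by rewrite mem_nth // sz.
have tE : tgt w sl = nth x (map (tgt w) P) t by rewrite (nth_map sl0) // sz.
have sE : sl.1 = (nth x (x :: map (tgt w) P) t, nth k0 p t) by rewrite (walk_nth _ hP ht).
have [e [he E nw]] := unwst_ent (allP aP _ slP).
have := hM he nw; rewrite E tE sE /sedge /= => -> //.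
rewrite -[X in _ != X]/(nth x (x :: map (tgt w) P) t.+1) nth_uniq //= ?size_map ?sz ?ltnS //.
  by rewrite neq_ltn leqnn.
exact: ltnW.
Qed.

Lemma sum_inj_card (T1 T2 T : finType) (r1 : seq (seq T1)) (r2 : seq (seq T2))
    (g : seq T1 -> seq T2 -> bool) (F : seq T1 -> seq T2 -> T) (S : {set T}) :
  uniq r1 -> uniq r2 -> (forall a b, a \in r1 -> b \in r2 -> g a b -> F a b \in S) ->
  (forall a b a' b', a \in r1 -> b \in r2 -> a' \in r1 -> b' \in r2 -> g a b -> g a' b' ->
     F a b = F a' b' -> (a, b) = (a', b')) ->
  \sum_(a <- r1) \sum_(b <- r2) (g a b)%:R <= #|S|%:R :> R.
Proof.
move=> u1 u2 hS hi; pose L0 := [seq c <- [seq (a, b) | a <- r1, b <- r2] | g c.1 c.2].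
have -> : \sum_(a <- r1) \sum_(b <- r2) (g a b)%:R = (size L0)%:R :> R.
  rewrite size_filter -sumn_count sumnE big_map natr_sum big_allpairs_dep /=.
  by apply: eq_bigr => a _; apply: eq_bigr => b _.
rewrite ler_nat -(size_map (fun c => F c.1 c.2)).
have inL c : c \in L0 -> [/\ c.1 \in r1, c.2 \in r2 & g c.1 c.2].
  by rewrite mem_filter => /andP[gc /allpairsP[[a b] [/= ha hb E]]]; move: gc; rewrite E.
have uL : uniq (map (fun c => F c.1 c.2) L0).
  rewrite map_inj_in_uniq.
    by rewrite filter_uniq // allpairs_uniq // => -[a b] [a' b'].
  move=> [a b] [a' b'] /inL[h1 h2 h3] /inL[h1' h2' h3'] /= E.
  exact: hi h1 h2 h1' h2' h3 h3' E.
rewrite -(card_uniqP uL); apply: subset_leq_card; apply/subsetP=> c /mapP[d /inL[h1 h2 h3] ->].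
exact: hS.
Qed.

Section Injection.
Variables (u v : V) (p q : seq Key) (cm : 'I_s) (sigma : {perm 'I_s}).
Hypotheses (hu : forall k y, k \in p ++ q -> emb k.2 y != u)
  (hv : forall k y, k \in p ++ q -> emb k.2 y != v) (uv : u != v).
Hypotheses (ucl : uniq (map snd (p ++ q))) (szs : (size p + size q).+1 = s).
Hypotheses (sp : forall j : 'I_s, (j < size p)%N -> (nth (cm, ord0) p j).1 = sigma j)
  (sm : forall j : 'I_s, (j : nat) = size p -> cm = sigma j)
  (sq : forall j : 'I_s, (size p < j)%N -> (nth (cm, ord0) q (s.-1 - j)).1 = sigma j).
Implicit Types (P Q : seq Slot).

Let vs P Q := u :: map (tgt w) P ++ rev (v :: map (tgt w) Q).

Lemma vs_size P Q : P \in walks w p u -> Q \in walks w q v -> size (vs P Q) = s.+1.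
Proof.
move=> /walk_size h1 /walk_size h2.
by rewrite /= size_cat size_rev /= !size_map h1 h2 addnS szs.
Qed.

Lemma vs_uniq P Q : P \in walks w p u -> Q \in walks w q v -> uniq (vs P Q).
Proof.
move=> /walks_keys h1 /walks_keys h2.
have cls x : x \in map (tgt w) (P ++ Q) -> exists k y, k \in p ++ q /\ x = emb k.2 y.
  case/mapP=> sl hs ->; exists sl.1.2, (w sl); split=> //.
  by rewrite -h1 -h2 -map_cat; apply/mapP; exists sl.
have nu : u \notin map (tgt w) (P ++ Q).
  by apply/negP=> /cls[k [y [hk E]]]; have := hu y hk; rewrite -E eqxx.
have nv : v \notin map (tgt w) (P ++ Q).
  by apply/negP=> /cls[k [y [hk E]]]; have := hv y hk; rewrite -E eqxx.
have -> : uniq (vs P Q) = uniq [:: u, v & map (tgt w) (P ++ Q)].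
  apply: perm_uniq; rewrite /vs perm_cons map_cat.
  apply: (@perm_trans _ (map (tgt w) P ++ v :: map (tgt w) Q)).
    by rewrite perm_cat2l perm_rev.
  by rewrite -[v :: map _ Q]cat1s perm_catCA.
rewrite /= inE negb_or uv nu nv /=; apply: tgt_uniq.
by rewrite (map_comp snd (fun sl : Slot => sl.1.2)) map_cat h1 h2.
Qed.

(** The vertices of [P] followed by those of [Q] backwards form the path, and [walks_inj] recovers
    the pair from them. The vertices are distinct because the classes are distinct and contain
    neither [u] nor [v]. *)
Lemma npairs_le_paths : npairs u v p q cm <= (ordered_paths_count M u v sigma)%:R.
Proof.
apply: (sum_inj_card (F := fun P Q => [ffun k : 'I_s.+1 => nth u (vs P Q) k]));
  [exact: walks_uniq|exact: walks_uniq| |].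
  move=> P Q hP hQ /and3P[aP aQ hm]; have sz := vs_size hP hQ; have uq := vs_uniq hP hQ.
  have sP := walk_size hP; have sQ := walk_size hQ.
  have nP t : (t <= size p)%N -> nth u (vs P Q) t = nth u (u :: map (tgt w) P) t.
    by move=> ht; rewrite /vs -cat_cons nth_cat /= size_map sP ltnS ht.
  (* Positions past the middle edge are counted from [v]. *)
  have nQ t : (size p < t)%N -> (t <= s)%N -> nth u (vs P Q) t = nth v (v :: map (tgt w) Q) (s - t).
    move=> ht ts; rewrite /vs -cat_cons nth_cat /= size_map sP ltnS leqNgt ht /=.
    rewrite nth_rev /= ?size_map ?sQ; last exact: idx_lt szs ht ts.
    rewrite (idx_rev szs ht ts).
    by apply: set_nth_default; rewrite /= size_map sQ; exact: idx_le szs ht.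
  rewrite inE; apply/and4P; split.
  - by rewrite ffunE.
  - by rewrite ffunE nQ ?subnn //=; case: (idx_s szs).
  - apply/injectiveP=> a b; rewrite !ffunE => /eqP; rewrite nth_uniq ?sz ?ltn_ord //.
    by move/eqP/val_inj.
  apply/forallP=> j; rewrite !ffunE !inordK ?ltnS ?ltn_ord //; last exact: ltnW.
  have js := ltn_ord j.
  have uP : uniq (u :: map (tgt w) P).
    by move: uq; rewrite /vs -cat_cons cat_uniq => /andP[].
  have uQ : uniq (v :: map (tgt w) Q).
    by move: uq; rewrite /vs -cat_cons cat_uniq rev_uniq => /and3P[].
  case: (ltngtP j (size p)) => hj.
  - rewrite -sp // !nP //; last exact: ltnW.
    exact: walk_edge.
  - rewrite -sq // !nQ ?(leqW hj) ?(ltnW js) //.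
    have [-> -> i3] := idx_j szs hj js.
    by rewrite setUC; apply: walk_edge.
  rewrite -sm // hj nP // nQ //; last by case: (idx_s szs).
  have [_ ->] := idx_s szs.
  by move: hm; rewrite /me /wend (last_nth u) (last_nth v) !size_map sP sQ.
move=> P Q P' Q' hP hQ hP' hQ' /and3P[aP aQ _] /and3P[aP' aQ' _] /ffunP E.
have Ev : vs P Q = vs P' Q'.
  apply: (@eq_from_nth _ u); first by rewrite !vs_size.
  move=> t; rewrite vs_size // => ht; have := E (Ordinal ht); by rewrite !ffunE.
case: Ev => /eqP; rewrite eqseq_cat ?size_map ?(walk_size hP) ?(walk_size hP') // => /andP[/eqP E1].
move/eqP/(congr1 rev); rewrite !revK => -[E2].
by rewrite (walks_inj hP hP' aP aP' E1) (walks_inj hQ hQ' aQ aQ' E2).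
Qed.
End Injection.
End Paths.

(** * One pair of vertices with one ordering of the colours *)

Section Task.
Variables (R : realFieldType) (ex : R -> R).
Hypotheses (exD : forall x y, ex (x + y) = ex x * ex y) (ex_ge : forall x, 1 + x <= ex x).
Variables (n s D m : nat) (emb : 'I_s.+1 -> 'I_m -> 'I_n).
Hypothesis emb_inj : forall a y a' y', emb a y = emb a' y' -> (a, y) = (a', y').
Hypotheses (m_gt0 : (0 < m)%N) (D_gt0 : (0 < D)%N).
Variables (em : nat) (L : R).
Hypothesis L_ge0 : 0 <= L.

Notation V := 'I_n.
Notation Edge := ('I_s * {set V})%type.
Notation Key := ('I_s * 'I_s.+1)%type.
Notation Box := (V * Key)%type.
Notation Slot := (V * Key * 'I_D)%type.
Notation Om := {ffun Slot -> 'I_m}.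
Notation hist := (seq (Slot * {set Edge})).
Notation tgt := (tgt emb).
Notation walks := (walks emb).
Notation wend := (wend emb).
Notation wasted := (wasted emb).
Notation hist_ok := (hist_ok emb em).
Notation valid := (valid emb em).
Notation super := (@super R n s D m emb em).
Notation cw := (@cw R n s D m emb).
Notation Jcomp := (@Jcomp R ex n s D m L).
Notation wst := (wst emb).
Implicit Types (w : Om) (p : seq Key) (x u v z : V) (q : seq Slot) (sl : Slot) (h : hist) (B : {set Edge}) (be : Box) (k : Key).

Let mR_gt0 : 0 < m%:R :> R. Proof. by rewrite ltr0n. Qed.
Let DR_gt0 : 0 < D%:R :> R. Proof. by rewrite ltr0n. Qed.
Local Notation entry := (Slot * {set Edge} * hist)%type.
Variables (Lam ell A : R).
Hypotheses (Lam_ell : ex ell = Lam) (ell_ge1 : 1 <= ell) (L_le : L <= (A - 1) * ell) (A_ge1 : 1 <= A).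
Let ex_gt0 := ex_gt0 exD ex_ge.
Let ell_gt0 : 0 < ell. Proof. by apply: lt_le_trans ell_ge1. Qed.
Let Lam_gt0 : 0 < Lam. Proof. by rewrite -Lam_ell. Qed.
Let A_gt0 : 0 < A. Proof. by apply: lt_le_trans A_ge1. Qed.

(** The outcome of iterating [cap_final]: by [L_le] each step costs a constant factor [A], while
    [Lam] multiplies only the mean number [D ^+ r / m] of walks per vertex. *)
Definition kapf r : R := A ^+ r * (1 + Lam * D%:R ^+ r / m%:R).

Lemma kapf_gt0 r : 0 < kapf r.
Proof. by rewrite mulr_gt0 ?exprn_gt0 // addr_gt0 // divr_gt0 // mulr_gt0 ?exprn_gt0. Qed.

Lemma kapf_step r : kapf r * L / ell + Lam * D%:R ^+ r.+1 / (m%:R * ell) <= kapf r.+1.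
Proof.
have D1 : 1 <= D%:R :> R by rewrite ler1n.
have kr := kapf_gt0 r.
set c := Lam * D%:R ^+ r.+1 / m%:R.
have c0 : 0 <= c by rewrite divr_ge0 ?(ltW mR_gt0) ?mulr_ge0 ?exprn_ge0 ?(ltW Lam_gt0).
have h1 : kapf r * L / ell <= kapf r * (A - 1).
  by rewrite -mulrA ler_wpM2l ?(ltW kr) // ler_pdivrMr.
have h2 : Lam * D%:R ^+ r.+1 / (m%:R * ell) <= c.
  rewrite /c invfM mulrA ler_piMr ?mulr_ge0 ?(ltW Lam_gt0) ?exprn_ge0 ?invr_ge0 ?(ltW mR_gt0) //.
  by rewrite invf_le1.
have h3 : kapf r <= A ^+ r * (1 + c).
  rewrite ler_wpM2l ?exprn_ge0 ?(ltW A_gt0) // lerD2l /c ler_wpM2r ?invr_ge0 ?(ltW mR_gt0) //.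
  by rewrite ler_wpM2l ?(ltW Lam_gt0) // exprS ler_peMl ?exprn_ge0.
have Ar : 1 <= A ^+ r by rewrite exprn_ege1.
have h4 : kapf r * (A - 1) <= A ^+ r * (1 + c) * (A - 1) by rewrite ler_wpM2r ?subr_ge0.
have h5 : c <= A ^+ r * (1 + c) by apply: (@le_trans _ _ (1 + c)); [lra|rewrite ler_peMl //; lra].
have -> : kapf r.+1 = A ^+ r * (1 + c) * (A - 1) + A ^+ r * (1 + c).
  by rewrite /kapf -/c exprS; ring.
exact: lerD (le_trans h1 h4) (le_trans h2 h5).
Qed.

Definition lastc (q : seq Key) : 'I_s.+1 := last ord0 (map snd q).
Definition mu (q : seq Key) : R := D%:R ^+ (size q).+1 / m%:R.

(** All that is needed on the side of [u]. The middle key asks for the class [lastc q] because that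
    is where the walks from [v] end, so that a middle slot can hit them. *)
Definition Jside u v p (q : seq Key) cm h w : R :=
  \sum_(t <- splits p) Jcomp t.1.2 (gwaste R emb em u t.1.1) h w +
  \sum_(t <- splits p) \sum_x0 Jcomp t.1.2 (gcap emb u t.1.1 x0 (kapf (size t.1.1)) Lam ell) h w +
  \sum_(t <- splits q) Jcomp t.1.2 (gbad R emb em u v p t.1.1 t.2 cm (lastc q)) h w +
  Jcomp (cm, lastc q) (ggain emb u v p q cm (lastc q) (mu p) (mu q)
     (kapf (size p) * kapf (size q))) h w.

Definition Jin h w : R := \sum_k \sum_a \sum_y0 Jcomp k (gin R emb a y0) h w.

Lemma Jcomp_gt0 k g h w : 0 < Jcomp k g h w. Proof. exact: ex_gt0. Qed.

Lemma Jcomp_nil k g w : Jcomp k g [::] w = ex (- L).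
Proof. by rewrite /Submission.Jcomp /Scomp big_nil sub0r. Qed.

Lemma Jside_nil u v p (q : seq Key) cm w : Jside u v p q cm [::] w =
  (size p * n.+1 + size q + 1)%:R * ex (- L).
Proof.
rewrite /Jside.
under eq_bigr do rewrite Jcomp_nil.
under [X in _ + X + _ + _]eq_bigr do
  (under eq_bigr do rewrite Jcomp_nil; rewrite sumr_const card_ord).
under [X in _ + X + _]eq_bigr do rewrite Jcomp_nil.
rewrite Jcomp_nil !big_const_seq !count_predT !size_splits !iter_addr_0.
rewrite -mulrnA -!mulrnDr -mulrSr mulr_natl; congr (_ *+ _).
by rewrite addn1 mulnS (mulnC n).
Qed.

Lemma Jin_nil w : Jin [::] w = (#|{: Key}| * (s.+1 * m))%:R * ex (- L).
Proof.
rewrite /Jin; under eq_bigr do (under eq_bigr do (under eq_bigr do rewrite Jcomp_nil;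
  rewrite sumr_const card_ord); rewrite sumr_const card_ord).
rewrite sumr_const -!mulrnA mulr_natl; congr (_ *+ _).
by rewrite mulnA mulnC (mulnC m).
Qed.

Lemma Jside_ge0 u v p (q : seq Key) cm h w : 0 <= Jside u v p q cm h w.
Proof.
rewrite /Jside !addr_ge0 // ?(ltW (Jcomp_gt0 _ _ _ _)) //; apply: sumr_ge0 => t _;
  rewrite ?(ltW (Jcomp_gt0 _ _ _ _)) //.
by apply: sumr_ge0 => x _; rewrite (ltW (Jcomp_gt0 _ _ _ _)).
Qed.

Lemma Jin_ge0 h w : 0 <= Jin h w.
Proof. by do 3!(apply: sumr_ge0 => ? _); exact: ltW (Jcomp_gt0 _ _ _ _). Qed.

Lemma sum_ge_term (T : eqType) (r : seq T) (F : T -> R) t : (forall t, 0 <= F t) -> t \in r ->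
  F t <= \sum_(t <- r) F t.
Proof. by move=> F0 ht; rewrite (big_rem _ ht) lerDl sumr_ge0. Qed.

Lemma super_seq (T : eqType) (r : seq T) (F : T -> hist -> Om -> R) :
  {in r, forall t, super (F t)} -> super (fun h w => \sum_(t <- r) F t h w).
Proof.
move=> hF h e w he; rewrite exchange_big [leRHS]exchange_big /= big_seq [leRHS]big_seq.
by apply: ler_sum => t /hF; apply.
Qed.

(** Distinct colours make all keys distinct, including either possible middle key, whatever its
    class. *)
Definition okc p (q : seq Key) (cm : 'I_s) := uniq (cm :: map fst (p ++ q)).

Lemma okc_sym p (q : seq Key) cm : okc p q cm = okc q p cm.
Proof.
rewrite /okc /=; congr andb; first by rewrite !map_cat !mem_cat orbC.
by rewrite !map_cat; apply: perm_uniq; rewrite perm_catC.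
Qed.

Lemma okc_facts p (q : seq Key) cm : okc p q cm ->
  [/\ uniq p, uniq q, forall k, k \in p -> k \notin q, forall a, (cm, a) \notin p &
      forall a, (cm, a) \notin q].
Proof.
rewrite /okc /= map_cat mem_cat negb_or => /andP[/andP[c1 c2]].
rewrite cat_uniq => /and3P[u1 nu u2]; split.
- exact: map_uniq u1.
- exact: map_uniq u2.
- move=> k kp; apply: contra nu => kq; apply/hasP; exists k.1; first exact: map_f.
  exact: map_f.
- by move=> a; apply: contra c1 => h; apply/mapP; exists (cm, a).
- by move=> a; apply: contra c2 => h; apply/mapP; exists (cm, a).
Qed.

Lemma split_notin p t : uniq p -> t \in splits p -> t.1.2 \notin t.1.1 /\ t.1.2 \notin t.2.
Proof.
move=> up /splits_cat E; move: up; rewrite E cat_uniq /= negb_or => /and3P[_ /andP[n1 _] /andP[n2 _]].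
by [].
Qed.

Lemma last_split (q : seq Key) t : t \in splits q -> last t.1.2.2 (map snd t.2) = lastc q.
Proof. by move/splits_cat=> E; rewrite /lastc E map_cat last_cat. Qed.

Lemma mu_gt0 (q : seq Key) : 0 < mu q.
Proof. by rewrite divr_gt0 ?exprn_gt0. Qed.

Lemma Jside_super u v p (q : seq Key) cm : okc p q cm -> super (Jside u v p q cm).
Proof.
move=> /okc_facts[up uq pq cp cq].
apply: super_add; last by apply: gain_super => //; rewrite mulr_gt0 ?kapf_gt0.
apply: super_add; last first.
  apply: super_seq => t ht; have [n1 n2] := split_notin uq ht.
  apply: bad_super => //; last exact: last_split.
  have tq : t.1.2 \in q by rewrite (splits_cat ht) mem_cat mem_head orbT.
  by apply: contraL tq; apply: pq.
apply: super_add; apply: super_seq => t ht; have [n1 n2] := split_notin up ht.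
  exact: waste_super.
by apply: super_sum => x0; apply: cap_super => //; exact: kapf_gt0.
Qed.

Lemma Jin_super : super Jin.
Proof. by do 3!(apply: super_sum => ?); exact: in_super. Qed.

Section Bound.
Variables (h : hist) (w : Om).
Hypotheses (hok : hist_ok h) (hf : full h) (J3 : Jin h w < 1) (LD : L <= D%:R) (Dm : (D <= m)%N).
Implicit Types (P Q : seq Slot).

Let W : R := 3 * waste_bound R D m em + L / D%:R.
Let BF : R := 3 * (em%:R / m%:R * 4 ^+ s) + L / D%:R.

Lemma all_Ein k : Ein R emb w k.
Proof.
apply/forallP=> a; apply/forallP=> y0; apply: (@le_trans _ _ (3 * D%:R + L)); last first.
  have -> : 4 * D%:R = 3 * D%:R + D%:R :> R by ring.
  by rewrite lerD2l.
apply: (in_final exD ex_ge m_gt0 hok hf); apply: le_lt_trans J3.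
rewrite /Jin (bigD1 k) //= (bigD1 a) //= (bigD1 y0) //= -!addrA lerDl !addr_ge0 //;
  by do !(apply: sumr_ge0 => ? _); exact: ltW (Jcomp_gt0 _ _ _ _).
Qed.

Section Side.
Variables (u v : V) (p q : seq Key) (cm : 'I_s).
Hypotheses (ok : okc p q cm) (J : Jside u v p q cm h w < 1).

Let J0 k g : 0 <= Jcomp k g h w := ltW (Jcomp_gt0 k g h w).

Lemma Jside_waste t : t \in splits p -> Jcomp t.1.2 (gwaste R emb em u t.1.1) h w < 1.
Proof.
move=> ht; apply: le_lt_trans J; rewrite /Jside -!addrA.
apply: le_trans (sum_ge_term (F := fun t => Jcomp t.1.2 (gwaste R emb em u t.1.1) h w) _ ht) _ => //.
rewrite lerDl !addr_ge0 //; apply: sumr_ge0 => // t' _; exact: sumr_ge0.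
Qed.

Lemma Jside_cap t x0 : t \in splits p ->
  Jcomp t.1.2 (gcap emb u t.1.1 x0 (kapf (size t.1.1)) Lam ell) h w < 1.
Proof.
move=> ht; apply: le_lt_trans J; rewrite /Jside [X in X + _ + _]addrC -!addrA.
have h1 : Jcomp t.1.2 (gcap emb u t.1.1 x0 (kapf (size t.1.1)) Lam ell) h w <=
  \sum_x0 Jcomp t.1.2 (gcap emb u t.1.1 x0 (kapf (size t.1.1)) Lam ell) h w.
  by rewrite (bigD1 x0) //= lerDl sumr_ge0.
apply: le_trans h1 _.
apply: le_trans (sum_ge_term (F := fun t => \sum_x0 Jcomp t.1.2
   (gcap emb u t.1.1 x0 (kapf (size t.1.1)) Lam ell) h w) _ ht) _ => [t'|]; first exact: sumr_ge0.
by rewrite lerDl !addr_ge0 // sumr_ge0.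
Qed.

Lemma Jside_bad t : t \in splits q ->
  Jcomp t.1.2 (gbad R emb em u v p t.1.1 t.2 cm (lastc q)) h w < 1.
Proof.
move=> ht; apply: le_lt_trans J; rewrite /Jside addrAC.
apply: le_trans (sum_ge_term (F := fun t =>
   Jcomp t.1.2 (gbad R emb em u v p t.1.1 t.2 cm (lastc q)) h w) _ ht) _ => //.
by rewrite lerDr !addr_ge0 ?sumr_ge0 // => t' _; rewrite ?sumr_ge0.
Qed.

Lemma Jside_gain : Jcomp (cm, lastc q) (ggain emb u v p q cm (lastc q) (mu p) (mu q)
     (kapf (size p) * kapf (size q))) h w < 1.
Proof.
apply: le_lt_trans J; rewrite /Jside lerDr !addr_ge0 ?sumr_ge0 // => t' _.
by rewrite ?sumr_ge0.
Qed.

Lemma side_dead : dead R emb h w u p <= (size p)%:R * (D%:R ^+ size p * W).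
Proof.
apply: dead_count => // p1 k p2 E.
have ht : (p1, k, p2) \in splits p by rewrite E; exact: mem_splits.
exact: (waste_final exD ex_ge D_gt0 hok hf (Jside_waste ht)).
Qed.

Lemma side_cap x : cw w p u x <= kapf (size p).
Proof.
apply: (cap_all (kap := kapf)) => [|p1 k p2 x0 E hc].
  by rewrite /kapf expr0 mul1r lerDl divr_ge0 ?mulr_ge0 ?(ltW Lam_gt0) ?exprn_ge0 ?(ltW mR_gt0).
have ht : (p1, k, p2) \in splits p by rewrite E; exact: mem_splits.
apply: le_trans (kapf_step _).
apply: (cap_final exD ex_ge m_gt0 (kapf_gt0 _) ell_gt0 hok hf _ (Jside_cap x0 ht)).
by apply/forallP=> x'; apply: hc.
Qed.

Lemma side_bad : sumPQ emb u v p q w (fun P Q => (badp emb u v cm (lastc q) h w P Q)%:R) <=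
  (size q)%:R * (D%:R ^+ (size p + size q) * BF).
Proof.
have [up uq pq cp cq] := okc_facts ok.
apply: bad_count => // q1 kk q2 E.
have ht : (q1, kk, q2) \in splits q by rewrite E; exact: mem_splits.
have aE : all (Ein R emb w) q2 by apply/allP=> k _; exact: all_Ein.
apply: le_trans (bad_final exD ex_ge D_gt0 hok hf aE (Jside_bad ht)) _ => /=.
have sz : (size p + size q = (size p + size q1 + size q2).+1)%N.
  by rewrite E size_cat /= !addnS addnA.
have s2 : (size q2 <= s)%N.
  have /andP[_ uc] := ok; have := uniq_leq_size uc (s2 := enum 'I_s).
  rewrite size_enum_ord size_map size_cat E size_cat /= => /(_ (fun c _ => mem_enum _ c)).
  by apply: leq_trans; rewrite !addnS addnA leqW ?leq_addl.
rewrite sz exprS !exprD -!mulrA [D%:R * _]mulrCA; apply: ler_wpM2l; first by rewrite exprn_ge0.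
rewrite [D%:R * _]mulrCA; apply: ler_wpM2l; first by rewrite exprn_ge0.
rewrite [D%:R * _]mulrCA; apply: ler_wpM2l; first by rewrite exprn_ge0.
rewrite /BF /bad_bound mulrDr [D%:R * (L / _)]mulrCA divff ?lt0r_neq0 // mulr1 lerD2r.
rewrite [leRHS]mulrC -!mulrA ler_wpM2l // ler_wpM2l // ler_wpM2l ?invr_ge0 //.
apply: ler_wpM2r; first exact: ltW.
by apply: ler_weXn2l => //; rewrite ler1n.
Qed.

Lemma side_gain : (0 < size q)%N -> (forall z, cw w q v z <= kapf (size q)) ->
  D%:R * sumPQ emb u v p q w (fun P Q => (pa emb v cm (lastc q) h w (wend w u P) Q)%:R) <=
  m%:R * (5 * gains emb u v p q cm (lastc q) (mu p) (mu q) h w +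
          2 * L * (kapf (size p) * kapf (size q))).
Proof.
move=> q0 cq'; have [up uq pq cp cq] := okc_facts ok.
have Kg0 : 0 < kapf (size p) * kapf (size q) by rewrite mulr_gt0 ?kapf_gt0.
have cap : capg emb u v p q (kapf (size p) * kapf (size q)) w.
  apply/forallP=> x; apply/forallP=> z; apply: ler_pM; rewrite ?cw_ge0 ?cq' //; exact: side_cap.
have lq : last (lastc q) (map snd q) = lastc q by rewrite /lastc; case: (q) q0.
rewrite /sumPQ (sum_wend emb w p u (fun x => \sum_(Q <- walks w q v) (pa emb v cm (lastc q) h w x Q)%:R)).
apply: (gain_final exD ex_ge m_gt0 D_gt0 (cp _) (cq _) Kg0 (mu_gt0 _) (mu_gt0 _) hok hf Dm cap Jside_gain) => //.
by move=> x Q e /allP/(_ e) hp he ebx; have := hp he; rewrite ebx eqxx /= => /andP[].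
Qed.
End Side.

Lemma npairs_sym (M : {set Edge}) u v p (q : seq Key) cm : npairs R emb h w M u v p q cm = npairs R emb h w M v u q p cm.
Proof.
rewrite /npairs /sumPQ exchange_big /=; apply: eq_bigr => Q _; apply: eq_bigr => P _.
by rewrite andbCA /me setUC.
Qed.

Lemma rvd_full P : rvd h P. Proof. by apply/allP=> t _; apply: hf. Qed.

(** Write [Gm] for the left side. By [hA] and [side_gain], [Gm] is at most [20 * m] times the gains
    plus [Gm / 5]; by [gains_le] the wasted walks take at most [Gm / 50] from [m] times the gains.
    What remains is [2 / 5 * Gm <= 20 * m * npairs]. *)
Lemma gain_bound (M : {set Edge}) u v p (q : seq Key) cm :
  (forall e : entry, e \in ents h -> ~~ wasted e.2 e.1.1 e.1.2 w ->
     e.1.1.1.1 != tgt w e.1.1 -> sedge e.1.1.1 (tgt w e.1.1) \in M) ->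
  (forall P Q, P \in walks w p u -> Q \in walks w q v -> wend w u P != wend w v Q) ->
  okc p q cm -> (0 < size q)%N -> Jside u v p q cm h w < 1 -> Jside v u q p cm h w < 1 ->
  dead R emb h w u p <= D%:R ^+ size p / 200 -> dead R emb h w v q <= D%:R ^+ size q / 200 ->
  m%:R * kapf (size p) <= D%:R ^+ (size p).+1 -> m%:R * kapf (size q) <= D%:R ^+ (size q).+1 ->
  40 * m%:R * (L * (kapf (size p) * kapf (size q))) <= D%:R ^+ (size p + size q).+1 ->
  D%:R ^+ (size p + size q) <= 4 * sumPQ emb u v p q w (fun P Q =>
     (pa emb v cm (lastc q) h w (wend w u P) Q)%:R) :> R ->
  D%:R ^+ (size p + size q).+1 <= 50 * m%:R * npairs R emb h w M u v p q cm.
Proof.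
move=> hM st ok q0 J1 J2 dP dQ mU mV n5 hA.
have cp := side_cap J1; have cq := side_cap J2.
have := side_gain ok J1 q0 cq; set g := gains _ _ _ _ _ _ _ _ _ _ _ => hg.
have := gains_le emb_inj hok hM cm (lastc q) st cp cq (ltW (kapf_gt0 _)) (ltW (kapf_gt0 _)) (mu_gt0 p) (mu_gt0 q).
rewrite -/g; set N1 := npairs _ _ _ _ _ _ _ _ _ _ => hN.
set Gm := D%:R ^+ (size p + size q).+1 in n5 *.
have GE : Gm = D%:R ^+ size p * D%:R ^+ (size q).+1 by rewrite /Gm -addnS exprD.
have GE' : Gm = D%:R ^+ size q * D%:R ^+ (size p).+1 by rewrite /Gm addnC -addnS exprD.
have h1 : m%:R * (mu q + kapf (size q)) <= 2 * D%:R ^+ (size q).+1.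
  by rewrite mulrDr /mu mulrC divfK ?lt0r_neq0 //; lra.
have h2 : m%:R * (mu p + kapf (size p)) <= 2 * D%:R ^+ (size p).+1.
  by rewrite mulrDr /mu mulrC divfK ?lt0r_neq0 //; lra.
have dge (x : V) (r : seq Key) : 0 <= dead R emb h w x r by apply: sumr_ge0.
have m1 : 0 <= m%:R * (mu q + kapf (size q)) by rewrite mulr_ge0 // addr_ge0 ?(ltW (mu_gt0 _)) ?(ltW (kapf_gt0 _)).
have m2 : 0 <= m%:R * (mu p + kapf (size p)) by rewrite mulr_ge0 // addr_ge0 ?(ltW (mu_gt0 _)) ?(ltW (kapf_gt0 _)).
have h3 := ler_pM (dge u p) m1 dP h1; have h4 := ler_pM (dge v q) m2 dQ h2.
have h5 := ler_wpM2l (ltW mR_gt0) hN.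
have h6 := ler_wpM2l (ltW DR_gt0) hA.
have e1 : D%:R ^+ size p / 200 * (2 * D%:R ^+ (size q).+1) = Gm / 100 by rewrite GE; field.
have e2 : D%:R ^+ size q / 200 * (2 * D%:R ^+ (size p).+1) = Gm / 100 by rewrite GE'; field.
have e3 : D%:R * D%:R ^+ (size p + size q) = Gm by rewrite -exprS.
rewrite e1 in h3; rewrite e2 in h4; rewrite e3 in h6.
move: (kapf (size p) * _) (dead _ _ _ _ u p) (dead _ _ _ _ v q) (mu p + _) (mu q + _)
  (sumPQ _ _ _ _ _ _ _) n5 hg h3 h4 h5 h6 => kk d1 d2 c1 c2 S n5 hg h3 h4 h5 h6.
lra.
Qed.

Section Final.
Variables (M B : {set Edge}) (b : nat) (ts : seq (V * V * seq Key * seq Key * 'I_s)).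
Variables (u v : V) (p q : seq Key) (cm : 'I_s).
Hypothesis hM : forall e : entry, e \in ents h -> ~~ wasted e.2 e.1.1 e.1.2 w ->
  e.1.1.1.1 != tgt w e.1.1 -> sedge e.1.1.1 (tgt w e.1.1) \in M.
Hypothesis hXc : forall f : Edge, #|f.2| = 2%N -> (f \in M) || (f \in B).
Hypotheses (b_gt0 : (0 < b)%N) (ok : okc p q cm) (p0 : (0 < size p)%N) (q0 : (0 < size q)%N).
Hypothesis srctgt : forall P Q, P \in walks w p u -> Q \in walks w q v -> wend w u P != wend w v Q.
Hypotheses (J1 : Jside u v p q cm h w < 1) (J2 : Jside v u q p cm h w < 1).
Let i := size p.
Let j := size q.
Let ku := kapf i.
Let kv := kapf j.
Hypotheses (hts : (u, v, p, q, cm) \in ts) (Lts : (size ts)%:R <= ex L).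
Hypothesis hLp : Lpot ex emb b ku kv ts h w M B <= (size ts)%:R.
Hypotheses (n1 : (i + j)%:R * W <= 1 / 200) (n2 : (i + j)%:R * BF <= 1 / 8).
Hypotheses (n3 : m%:R * ku <= D%:R ^+ i.+1) (n3' : m%:R * kv <= D%:R ^+ j.+1).
Hypotheses (n4 : 32 * b%:R * ku <= D%:R ^+ i) (n4' : 32 * b%:R * kv <= D%:R ^+ j).
Hypothesis n5 : 40 * m%:R * (L * (ku * kv)) <= D%:R ^+ (i + j).+1.
Hypothesis n6 : 512 * b%:R * (L * (ku * kv)) <= D%:R ^+ (i + j).

Let Tot : R := D%:R ^+ (i + j).
Let G : R := D%:R ^+ (i + j).+1 / m%:R.
Let Arr : R := sumPQ emb u v p q w (fun P Q => (arrv emb u v cm h w P Q)%:R).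

Let bR_gt0 : 0 < b%:R :> R. Proof. by rewrite ltr0n. Qed.
Let W_ge0 : 0 <= W.
Proof. by apply: addr_ge0; [apply: mulr_ge0 => //; apply: divr_ge0|apply: divr_ge0]. Qed.
Let Tot_gt0 : 0 < Tot. Proof. by rewrite exprn_gt0. Qed.
Let ku_gt0 : 0 < ku := kapf_gt0 i.
Let kv_gt0 : 0 < kv := kapf_gt0 j.

Lemma dead_p : dead R emb h w u p <= D%:R ^+ i / 200.
Proof.
apply: le_trans (side_dead J1) _; rewrite mulrCA ler_wpM2l ?exprn_ge0 //.
have -> : 200^-1 = 1 / 200 :> R by rewrite mul1r.
by apply: le_trans n1; rewrite ler_wpM2r // ler_nat leq_addr.
Qed.

Lemma dead_q : dead R emb h w v q <= D%:R ^+ j / 200.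
Proof.
apply: le_trans (side_dead J2) _; rewrite mulrCA ler_wpM2l ?exprn_ge0 //.
have -> : 200^-1 = 1 / 200 :> R by rewrite mul1r.
by apply: le_trans n1; rewrite ler_wpM2r // ler_nat leq_addl.
Qed.

Lemma claimed_npairs : claimed R emb u v p q cm h w M <= npairs R emb h w M u v p q cm.
Proof.
apply: le_sumPQ => P Q _ _; rewrite -natrM mulnb ler_nat.
by case: (boolP (arrv _ _ _ _ _ _ _ _)) => //= /and3P[_ /andP[-> ->] _].
Qed.

Lemma claimed_arr : Arr <= claimed R emb u v p q cm h w M + claimed R emb u v p q cm h w B.
Proof.
apply: (@le_trans _ _ (sumPQ emb u v p q w (fun P Q =>
   (arrv emb u v cm h w P Q)%:R * (me cm (wend w u P) (wend w v Q) \in M)%:R +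
   (arrv emb u v cm h w P Q)%:R * (me cm (wend w u P) (wend w v Q) \in B)%:R))); last first.
  by rewrite (sumPQ_add emb u v p q w (fun P Q => (arrv emb u v cm h w P Q)%:R * _)).
apply: le_sumPQ => P Q hP hQ; rewrite -mulrDr ler_peMr //.
have := hXc (f := me cm (wend w u P) (wend w v Q)); rewrite /= cards2 srctgt // => /(_ erefl).
by case: (_ \in M); case: (_ \in B); rewrite //= ?addr0 ?add0r // lerDl.
Qed.

(** The potential gives [- Y <= 2 * L * ku * kv]. Multiplied by [16 * b], this bounds Maker's pairs
    below by the arrivals, at least [Tot / 4], minus [Tot / 16] for the refund term and [Tot / 16]
    for [L]; hence the factor [128 = 16 * 8]. *)
Lemma arr_case : 4 * Arr >= Tot -> Tot <= 128 * b%:R * npairs R emb h w M u v p q cm.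
Proof.
move=> hA; have cM := claimed_npairs; have cA := claimed_arr.
have hcap : capt emb ku kv (u, v, p, q, cm) h w.
  apply/andP; split; apply/forallP=> x /=.
    apply: le_trans (side_cap J1 x); rewrite /ru /Submission.cw le_eqVlt; apply/orP; left; apply/eqP.
    by apply: eq_bigr => P _; rewrite rvd_full mul1r.
  apply: le_trans (side_cap J2 x); rewrite /rv /Submission.cw le_eqVlt; apply/orP; left; apply/eqP.
  by apply: eq_bigr => P _; rewrite rvd_full mul1r.
have e0 t : 0 <= (capt emb ku kv t h w)%:R * ex (- ((2 * (ku * kv))^-1 * Yt emb b ku kv t h w M B)).
  by rewrite mulr_ge0 // (ltW (ex_gt0 _)).
have := le_trans (sum_ge_term e0 hts) (le_trans hLp Lts); rewrite hcap mul1r => hex.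
have {}hex : - ((2 * (ku * kv))^-1 * Yt emb b ku kv (u, v, p, q, cm) h w M B) <= L.
  by rewrite leNgt; apply/negP=> /(ex_lt exD ex_ge); rewrite ltNge hex.
have kk : 0 < 2 * (ku * kv) by apply: mulr_gt0 => //; apply: mulr_gt0.
have hY : - Yt emb b ku kv (u, v, p, q, cm) h w M B <= L * (2 * (ku * kv)).
  by rewrite -ler_pdivrMr // mulNr mulrC.
have nUE : nU R emb u p h w <= D%:R ^+ i.
  rewrite -(sum_cw R emb w p u) -[leRHS](eq_bigr _ (fun z _ => mulr1 _)) -(sum_wend emb w p u (fun=> 1)).
  by apply: ler_sum => P _; rewrite rvd_full.
have nVE : nV R emb v q h w <= D%:R ^+ j.
  rewrite -(sum_cw R emb w q v) -[leRHS](eq_bigr _ (fun z _ => mulr1 _)) -(sum_wend emb w q v (fun=> 1)).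
  by apply: ler_sum => P _; rewrite rvd_full.
rewrite /Yt /Y /= in hY *.
set cm1 := claimed _ _ _ _ _ _ _ _ _ M in cM cA hY *; set cb1 := claimed _ _ _ _ _ _ _ _ _ B in cA hY *.
set pr := (16 * b%:R)^-1 in hY *.
have prE : 16 * b%:R * pr = 1 by rewrite /pr mulfV // lt0r_neq0 // mulr_gt0.
have hn1 : 32 * b%:R * (ku * nV R emb v q h w) <= Tot.
  have p1 : 0 <= 32 * b%:R * ku by apply: mulr_ge0; [apply: mulr_ge0|apply: ltW].
  have p2 : 0 <= nV R emb v q h w by apply: sumr_ge0.
  have := ler_pM p1 p2 n4 nVE.
  by rewrite /Tot exprD mulrA.
have hn2 : 32 * b%:R * (kv * nU R emb u p h w) <= Tot.
  have p1 : 0 <= 32 * b%:R * kv by apply: mulr_ge0; [apply: mulr_ge0|apply: ltW].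
  have p2 : 0 <= nU R emb u p h w by apply: sumr_ge0.
  have := ler_pM p1 p2 n4' nUE.
  by rewrite /Tot exprD mulrA => h1; apply: le_trans h1 _; rewrite mulrC.
have b16 : 0 <= 16 * b%:R :> R by rewrite mulr_ge0.
have := ler_wpM2l b16 hY.
have -> : 16 * b%:R * - ((1 - pr) * cm1 - pr * cb1 +
   pr * b%:R * (ku * nV R emb v q h w + kv * nU R emb u p h w)) =
   - (16 * b%:R * cm1 - (16 * b%:R * pr) * (cm1 + cb1) +
      (16 * b%:R * pr) * (b%:R * (ku * nV R emb v q h w) + b%:R * (kv * nU R emb u p h w))) by ring.
rewrite prE !mul1r => h1.
have h2 : 16 * b%:R * (L * (2 * (ku * kv))) <= Tot / 16.
  by have := n6; rewrite -/Tot; lra.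
have h3 := ler_wpM2l b16 cM.
lra.
Qed.

Lemma sum5_ge1 (c1 c2 c3 c4 c5 : bool) : [|| c1, c2, c3, c4 | c5] ->
  1 <= c1%:R + (c2%:R + (c3%:R + (c4%:R + c5%:R))) :> R.
Proof. by rewrite -!natrD ler1n; case: c1 c2 c3 c4 c5 => [] [] [] [] []. Qed.

Lemma sum_walks_const (x : V) (r : seq Key) (c : R) :
  \sum_(P <- walks w r x) c = D%:R ^+ size r * c.
Proof. by rewrite (sum_wend emb w r x (fun=> c)) -(sum_cw R emb w r x) mulr_suml. Qed.

(** Waste and bad pairs use up at most [1 / 100 + 1 / 8] of all pairs, so arrivals or one of the two
    kinds of available pairs make up a quarter. *)
Lemma task_bound : Tot <= 128 * b%:R * npairs R emb h w M u v p q cm \/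
  D%:R ^+ (i + j).+1 <= 50 * m%:R * npairs R emb h w M u v p q cm.
Proof.
pose A1 : R := sumPQ emb u v p q w (fun P Q => (pa emb v cm (lastc q) h w (wend w u P) Q)%:R).
pose A2 : R := sumPQ emb v u q p w (fun Q P => (pa emb u cm (lastc p) h w (wend w v Q) P)%:R).
pose B1 : R := sumPQ emb u v p q w (fun P Q => (badp emb u v cm (lastc q) h w P Q)%:R).
pose B2 : R := sumPQ emb v u q p w (fun Q P => (badp emb v u cm (lastc p) h w Q P)%:R).
have tot : Tot <= D%:R ^+ j * dead R emb h w u p + D%:R ^+ i * dead R emb h w v q +
    (Arr + (B1 + (B2 + (A1 + A2)))).
  have -> : Tot = sumPQ emb u v p q w (fun _ _ => 1).
    rewrite /sumPQ; under eq_bigr do rewrite sum_walks_const mulr1.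
    by rewrite sum_walks_const -exprD.
  have -> : B2 = sumPQ emb u v p q w (fun P Q => (badp emb v u cm (lastc p) h w Q P)%:R).
    by rewrite /B2 /sumPQ exchange_big.
  have -> : A2 = sumPQ emb u v p q w (fun P Q => (pa emb u cm (lastc p) h w (wend w v Q) P)%:R).
    by rewrite /A2 /sumPQ exchange_big.
  have -> : D%:R ^+ j * dead R emb h w u p = sumPQ emb u v p q w (fun P _ => (~~ alive emb h w P)%:R).
    rewrite /sumPQ mulr_sumr; apply: eq_bigr => P _.
    by rewrite sum_walks_const.
  have -> : D%:R ^+ i * dead R emb h w v q = sumPQ emb u v p q w (fun _ Q => (~~ alive emb h w Q)%:R).
    rewrite /sumPQ exchange_big mulr_sumr; apply: eq_bigr => Q _.
    by rewrite sum_walks_const.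
  rewrite -!sumPQ_add; apply: le_sumPQ => P Q hP hQ.
  have nn0 (x : bool) : 0 <= x%:R :> R by [].
  case: (boolP (alive emb h w P)) => aP /=; last first.
    by rewrite -addrA lerDl !addr_ge0.
  case: (boolP (alive emb h w Q)) => aQ /=; last by rewrite add0r lerDl !addr_ge0.
  rewrite !add0r.
  have Pn : P != [::] by rewrite -size_eq0 (walk_size hP) -lt0n.
  have := classify u v cm (lastc p) (lastc q) hok hf Pn aP aQ.
  exact: sum5_ge1.
have ok' : okc q p cm by rewrite -okc_sym.
have b1 := side_bad ok J1; have b2 := side_bad ok' J2.
have hb : B1 + B2 <= Tot / 8.
  apply: le_trans (lerD b1 b2) _; rewrite [in X in _ + X]addnC -mulrDl -natrD mulrCA ler_wpM2l ?exprn_ge0 //.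
  by rewrite addnC; have -> : 8^-1 = 1 / 8 :> R by rewrite mul1r.
have hd1 : D%:R ^+ j * dead R emb h w u p <= Tot / 200.
  by rewrite /Tot exprD [X in X / _]mulrC -mulrA ler_wpM2l ?exprn_ge0 ?dead_p.
have hd2 : D%:R ^+ i * dead R emb h w v q <= Tot / 200.
  by rewrite /Tot exprD -mulrA ler_wpM2l ?exprn_ge0 ?dead_q.
have [hA|hA] := lerP Tot (4 * Arr); first by left; apply: arr_case.
right; have [hA1|hA1] := lerP Tot (4 * A1).
  by apply: gain_bound => //; [exact: dead_p|exact: dead_q].
rewrite npairs_sym addnC; apply: gain_bound => //.
- by move=> Q P hQ hP; rewrite eq_sym srctgt.
- exact: dead_q.
- exact: dead_p.
- by rewrite addnC [X in L * X]mulrC.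
rewrite addnC -/A2 -/Tot; move: Tot_gt0 hb hd1 hd2 tot hA hA1.
move: (_ * dead _ _ _ _ u p) (_ * dead _ _ _ _ v q) => d1 d2.
lra.
Qed.
End Final.
End Bound.
End Task.

(** * All pairs of vertices and all orderings at once *)

Section Assembly.
Variables (R : realFieldType) (ex : R -> R).
Hypotheses (exD : forall x y, ex (x + y) = ex x * ex y) (ex_ge : forall x, 1 + x <= ex x).
Variables (n s D m : nat) (emb : 'I_s.+1 -> 'I_m -> 'I_n).
Hypothesis emb_inj : forall a y a' y', emb a y = emb a' y' -> (a, y) = (a', y').
Hypotheses (m_gt0 : (0 < m)%N) (D_gt0 : (0 < D)%N).
Variables (em : nat) (L : R).
Hypothesis L_ge0 : 0 <= L.

Notation V := 'I_n.
Notation Edge := ('I_s * {set V})%type.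
Notation Key := ('I_s * 'I_s.+1)%type.
Notation Box := (V * Key)%type.
Notation Slot := (V * Key * 'I_D)%type.
Notation Om := {ffun Slot -> 'I_m}.
Notation hist := (seq (Slot * {set Edge})).
Notation tgt := (tgt emb).
Notation walks := (walks emb).
Notation wend := (wend emb).
Notation wasted := (wasted emb).
Notation hist_ok := (hist_ok emb em).
Notation valid := (valid emb em).
Notation super := (@super R n s D m emb em).
Notation cw := (@cw R n s D m emb).
Notation Jcomp := (@Jcomp R ex n s D m L).
Notation wst := (wst emb).
Implicit Types (w : Om) (p : seq Key) (x u v z : V) (q : seq Slot) (sl : Slot) (h : hist) (B : {set Edge}) (be : Box) (k : Key).

Let mR_gt0 : 0 < m%:R :> R. Proof. by rewrite ltr0n. Qed.
Let DR_gt0 : 0 < D%:R :> R. Proof. by rewrite ltr0n. Qed.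
Fact idx_q (a c t d : nat) : (a + c).+1 = d -> (a < t)%N -> (t < d)%N ->
  (a.+1 + (c - (d.-1 - t).+1))%N = t.
Proof. by clear; lia. Qed.
Local Notation entry := (Slot * {set Edge} * hist)%type.
Variables (Lam ell A : R).
Hypotheses (Lam_ell : ex ell = Lam) (ell_ge1 : 1 <= ell) (L_le : L <= (A - 1) * ell) (A_ge1 : 1 <= A).
Variables (i b : nat).
Hypotheses (i_gt0 : (0 < i)%N) (i_lt : (i < s.-1)%N) (b_gt0 : (0 < b)%N).
Let j := (s.-1 - i)%N.
Let i_lts : (i < s)%N. Proof. exact: leq_trans i_lt (leq_pred s). Qed.

Definition cols (sigma : {perm 'I_s}) : seq 'I_s := map sigma (enum 'I_s).

(* Each vertex lies in at most one class, so at least s - 1 of the s + 1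
   classes contain neither end of the pair to be joined. *)
Definition freecl u v : seq 'I_s.+1 :=
  take s.-1 [seq a <- enum 'I_s.+1 | [forall y, (emb a y != u) && (emb a y != v)]].

Definition midc (sigma : {perm 'I_s}) : 'I_s := sigma (Ordinal i_lts).
Definition pfst (sigma : {perm 'I_s}) u v : seq Key := zip (take i (cols sigma)) (take i (freecl u v)).
(** The colours are reversed because this walk starts at [v]. *)
Definition plast (sigma : {perm 'I_s}) u v : seq Key :=
  zip (rev (drop i.+1 (cols sigma))) (drop i (freecl u v)).

Lemma s_gt0 : (0 < s)%N. Proof. exact: leq_ltn_trans (leq0n i) i_lts. Qed.

Lemma size_cols sigma : size (cols sigma) = s.
Proof. by rewrite size_map size_enum_ord. Qed.

Lemma cols_uniq sigma : uniq (cols sigma).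
Proof. by rewrite map_inj_uniq ?enum_uniq //; exact: perm_inj. Qed.

Lemma nth_cols sigma c (k : 'I_s) : nth c (cols sigma) k = sigma k.
Proof. by rewrite (nth_map k) ?size_enum_ord // nth_ord_enum. Qed.

Lemma freecl_uniq u v : uniq (freecl u v).
Proof. by rewrite take_uniq // filter_uniq // enum_uniq. Qed.

Lemma freecl_free u v a y : a \in freecl u v -> (emb a y != u) && (emb a y != v).
Proof. by move/mem_take; rewrite mem_filter => /andP[/forallP]. Qed.

Lemma class_count (x : V) : (count (fun a : 'I_s.+1 => [exists y, emb a y == x]) (enum 'I_s.+1) <= 1)%N.
Proof.
rewrite -size_filter; case E : [seq _ <- _ | _] => [|a [|a' r]] //.
have mem c : c \in [:: a, a' & r] -> exists y, emb c y = x.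
  by rewrite -E mem_filter => /andP[/existsP[y /eqP]]; exists y.
have [|y h1] := mem a; first by rewrite mem_head.
have [|y' h2] := mem a'; first by rewrite !inE eqxx orbT.
have /(congr1 uniq) := E; rewrite filter_uniq ?enum_uniq //= inE.
by have /emb_inj[->] := etrans h1 (esym h2); rewrite eqxx.
Qed.

Lemma size_freecl u v : size (freecl u v) = s.-1.
Proof.
rewrite size_take; set S := [seq a <- _ | _].
suff h : (s.-1 <= size S)%N by case: ltngtP h.
have h : (s.+1 <= size S + (1 + 1))%N.
  rewrite -[leqLHS](size_enum_ord s.+1) -(count_predC (fun a => [forall y, (emb a y != u) && (emb a y != v)]) (enum 'I_s.+1)).
  rewrite -size_filter -/S leq_add2l.
  apply: leq_trans (leq_add (class_count u) (class_count v)).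
  rewrite -count_predUI; apply: leq_trans (leq_addr _ _); apply: sub_count => a /=.
  rewrite negb_forall => /existsP[y]; rewrite negb_and !negbK => /orP[] hy; apply/orP; [left|right];
    by apply/existsP; exists y.
by move: h; rewrite addn2 ltnS => h; rewrite -ltnS prednK // s_gt0.
Qed.

Lemma jE : (i + j).+1 = s.
Proof. by rewrite /j subnKC ?(ltnW i_lt) // prednK // s_gt0. Qed.

Section OneTask.
Variables (sigma : {perm 'I_s}) (u v : V).
Let p := pfst sigma u v.
Let q := plast sigma u v.
Let cm := midc sigma.

Let s1 : size (take i (cols sigma)) = i.
Proof. by rewrite size_takel // size_cols ltnW. Qed.
Let s2 : size (take i (freecl u v)) = i.
Proof. by rewrite size_takel // size_freecl ltnW. Qed.
Let s3 : size (rev (drop i.+1 (cols sigma))) = j.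
Proof. by rewrite size_rev size_drop size_cols -[in X in (X - _)%N](jE) subSS addKn. Qed.
Let s4 : size (drop i (freecl u v)) = j.
Proof. by rewrite size_drop size_freecl. Qed.

Lemma size_pfst : size p = i. Proof. by rewrite size_zip s1 s2 minnn. Qed.
Lemma size_plast : size q = j. Proof. by rewrite size_zip s3 s4 minnn. Qed.

Lemma task_colors : map fst (p ++ q) = take i (cols sigma) ++ rev (drop i.+1 (cols sigma)).
Proof.
rewrite map_cat -[map fst p]/(unzip1 p) -[map fst q]/(unzip1 q).
by rewrite !unzip1_zip ?s1 ?s2 ?s3 ?s4.
Qed.

Lemma task_classes : map snd (p ++ q) = freecl u v.
Proof.
rewrite map_cat -[map snd p]/(unzip2 p) -[map snd q]/(unzip2 q).
by rewrite !unzip2_zip ?s1 ?s2 ?s3 ?s4 // cat_take_drop.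
Qed.

Lemma task_okc : okc p q cm.
Proof.
rewrite /okc task_colors.
have E : cols sigma = take i (cols sigma) ++ cm :: drop i.+1 (cols sigma).
  rewrite -[LHS](cat_take_drop i) (drop_nth cm) ?size_cols //.
  by rewrite -[X in nth _ _ X]/(nat_of_ord (Ordinal i_lts)) nth_cols.
suff -> : uniq (cm :: take i (cols sigma) ++ rev (drop i.+1 (cols sigma))) = uniq (cols sigma).
  exact: cols_uniq.
rewrite [in RHS]E.
apply: perm_uniq; rewrite -[cm :: _ ++ rev _]cat1s -[cm :: drop _ _]cat1s perm_catCA !perm_cat2l.
by rewrite perm_rev.
Qed.

Lemma task_free k y : k \in p ++ q -> (emb k.2 y != u) && (emb k.2 y != v).
Proof. by move=> hk; apply: freecl_free; rewrite -task_classes; apply: map_f. Qed.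

Lemma task_clu : uniq (map snd (p ++ q)). Proof. by rewrite task_classes freecl_uniq. Qed.

Lemma task_sp (k : 'I_s) : (k < size p)%N -> (nth (cm, ord0) p k).1 = sigma k.
Proof.
rewrite size_pfst => hk; rewrite nth_zip ?s1 ?s2 //= nth_take //.
exact: nth_cols.
Qed.

Lemma task_sm (k : 'I_s) : (k : nat) = size p -> cm = sigma k.
Proof. by rewrite size_pfst => hk; congr (sigma _); apply: val_inj. Qed.

Lemma task_sq (k : 'I_s) : (size p < k)%N -> (nth (cm, ord0) q (s.-1 - k)).1 = sigma k.
Proof.
rewrite size_pfst => hk; have ks := ltn_ord k; have jE' := jE.
have [e1 e2 e3] := idx_j jE' hk ks.
rewrite nth_zip ?s3 ?s4 //= nth_rev; last by rewrite -(size_rev (drop _ _)) s3.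
rewrite -(size_rev (drop _ _)) s3 nth_drop -[RHS](nth_cols sigma cm); congr nth.
exact: idx_q jE' hk ks.
Qed.

Lemma walk_end_class (w : Om) (r : seq Key) x P : (0 < size r)%N -> P \in walks w r x ->
  exists2 k, k \in r & exists y, wend w x P = emb k.2 y.
Proof.
case/lastP: P => [r0 /walks_keys E|P sl _ /walks_keys E]; first by move: r0; rewrite -E.
exists sl.1.2; first by rewrite -E map_rcons mem_rcons mem_head.
by exists (w sl); rewrite /Submission.wend map_rcons last_rcons.
Qed.

Lemma task_srctgt (w : Om) P Q : P \in walks w p u -> Q \in walks w q v ->
  wend w u P != wend w v Q.
Proof.
have pp : (0 < size p)%N by rewrite size_pfst.
have qq : (0 < size q)%N by rewrite size_plast subn_gt0.
move=> /(walk_end_class pp)[k kp [y ->]] /(walk_end_class qq)[k' kq [y' ->]].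
apply/eqP=> /emb_inj[E _]; have := task_clu; rewrite map_cat cat_uniq => /and3P[_ /hasP[]].
by exists k'.2; [exact: map_f|rewrite -E; exact: map_f].
Qed.
End OneTask.

Let ku : R := kapf D m Lam A i.
Let kv : R := kapf D m Lam A j.
Let W : R := 3 * waste_bound R D m em + L / D%:R.
Let BF : R := 3 * (em%:R / m%:R * 4 ^+ s) + L / D%:R.
Hypotheses (LD : L <= D%:R) (Dm : (D <= m)%N).
Hypotheses (n1 : (i + j)%:R * W <= 1 / 200) (n2 : (i + j)%:R * BF <= 1 / 8).
Hypotheses (n3 : m%:R * ku <= D%:R ^+ i.+1) (n3' : m%:R * kv <= D%:R ^+ j.+1).
Hypotheses (n4 : 32 * b%:R * ku <= D%:R ^+ i) (n4' : 32 * b%:R * kv <= D%:R ^+ j).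
Hypothesis n5 : 40 * m%:R * (L * (ku * kv)) <= D%:R ^+ (i + j).+1.
Hypothesis n6 : 512 * b%:R * (L * (ku * kv)) <= D%:R ^+ (i + j).
Hypothesis n7 : (n * n * s`! * (s * (n + 3) + s * (n + 3)) + s * s.+1 * (s.+1 * m))%:R < ex L.
Hypothesis n8 : 2 * (n * (s * s.+1))%:R <= ex L.
Hypothesis n9 : 16 * b%:R * (D%:R + L) <= em%:R.

Notation Task := (V * V * seq Key * seq Key * 'I_s)%type.
Definition mkt (c : V * V * {perm 'I_s}) : Task :=
  (c.1.1, c.1.2, pfst c.2 c.1.1 c.1.2, plast c.2 c.1.1 c.1.2, midc c.2).
Definition tasks : seq Task :=
  [seq mkt c | c <- [seq c <- enum {: V * V * {perm 'I_s}} | c.1.1 != c.1.2]].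
Local Notation Js := (Jside ex emb em L Lam ell A).
Definition Jtot h w : R := \sum_(t <- tasks) (Js t.1.1.1.1 t.1.1.1.2 t.1.1.2 t.1.2 t.2 h w +
   Js t.1.1.1.2 t.1.1.1.1 t.1.2 t.1.1.2 t.2 h w) + Jin ex emb L h w.

Lemma tasksP t : t \in tasks -> exists sigma, exists u v,
  u != v /\ t = (u, v, pfst sigma u v, plast sigma u v, midc sigma).
Proof.
case/mapP=> [[[u v] sigma]]; rewrite mem_filter => /andP[/= uv _] ->.
by exists sigma, u, v.
Qed.

Lemma size_tasks : (size tasks <= n * n * s`!)%N.
Proof.
rewrite size_map size_filter; apply: leq_trans (count_size _ _) _.
by rewrite -cardT !card_prod card_ord card_Sn.
Qed.

Lemma Jtot_super : super Jtot.
Proof.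
apply: super_add; last exact: Jin_super.
apply: super_seq => t /tasksP[sigma [u [v [_ ->]]]] /=; have ok := task_okc sigma u v.
by apply: super_add; apply: (Jside_super exD ex_ge emb_inj m_gt0 D_gt0 L Lam_ell ell_ge1 A_ge1) => //; rewrite okc_sym.
Qed.

(** Every component starts at [ex (- L)], and by [n7] there are fewer than [ex L] of them. *)
Lemma Jtot_nil w : Jtot [::] w < 1.
Proof.
have exL : 0 < ex (- L) by exact: ex_gt0.
have Jle (x : V) y p (q : seq Key) cm : (size p + size q <= s)%N -> Js x y p q cm [::] w <= (s * (n + 3))%:R * ex (- L).
  move=> sz; rewrite Jside_nil ler_wpM2r ?(ltW exL) // ler_nat.
  apply: (@leq_trans ((size p + size q) * n.+1 + 1)).
    by rewrite leq_add2r mulnDl leq_add2l leq_pmulr.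
  apply: (@leq_trans (s * n.+1 + s)).
    by rewrite leq_add ?leq_mul // s_gt0.
  by rewrite addnC -mulnS leq_mul2l addn3 leqnSn orbT.
rewrite /Jtot Jin_nil; apply: (@le_lt_trans _ _ ((n * n * s`! * (s * (n + 3) + s * (n + 3)) + s * s.+1 * (s.+1 * m))%:R * ex (- L))); last first.
  by rewrite (exN exD ex_ge) ltr_pdivrMr ?mul1r // (ex_gt0 exD ex_ge).
rewrite (natrD _ (n * n * s`! * _)%N) mulrDl card_prod !card_ord lerD2r.
apply: (@le_trans _ _ (\sum_(t <- tasks) (s * (n + 3) + s * (n + 3))%:R * ex (- L))).
  rewrite big_seq [leRHS]big_seq; apply: ler_sum => t /tasksP[sigma [u [v [_ ->]]]] /=.
  have sz : (size (pfst sigma u v) + size (plast sigma u v) <= s)%N.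
    by rewrite size_pfst size_plast; apply: leq_trans (eq_leq jE).
  by rewrite natrD mulrDl lerD ?Jle // addnC.
rewrite big_const_seq count_predT iter_addr_0 -(mulr_natl (_ * _)) natrM -mulrA ler_wpM2r ?mulr_ge0 ?(ltW exL) //.
by rewrite ler_nat size_tasks.
Qed.

Lemma board_card (f : Edge) : (f \in cboard s n) = (#|f.2| == 2%N).
Proof. by rewrite inE. Qed.

(** The alternatives reflect the two sources of middle edges: the hitting game, and the middle
    boxes. *)
Lemma maker_paths : mwin (cboard s n) b (fun M => forall u v (sigma : {perm 'I_s}), u != v ->
    D%:R ^+ s.-1 <= 128 * b%:R * (ordered_paths_count M u v sigma)%:R :> R \/
    D%:R ^+ s <= 50 * m%:R * (ordered_paths_count M u v sigma)%:R :> R) set0 set0.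
Proof.
have sj : (i + j)%N = s.-1 by rewrite -[in RHS]jE.
have kp r : 0 < kapf D m Lam A r by exact: (kapf_gt0 exD ex_ge m_gt0 D_gt0 Lam_ell A_ge1).
have exL : 0 < ex L by exact: ex_gt0.
apply: (maker_strategy exD ex_ge emb_inj m_gt0 _ b_gt0 (kp i) (kp j) _ n9 (ts := tasks) Jtot_super).
- by move=> f; rewrite board_card => /eqP.
- by rewrite !card_prod !card_ord.
- rewrite -subr_gt0 sub0r -sumrN; apply: (@lt_le_trans _ _ (1 - Jtot [::] [ffun=> Ordinal m_gt0])).
    by rewrite subr_gt0 Jtot_nil.
  rewrite (bigD1 [ffun=> Ordinal m_gt0]) //= opprB lerDl; apply: sumr_ge0 => w _.
  by rewrite opprB subr_ge0 ltW // Jtot_nil.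
move=> h w M B hok hf he J hLp XMB hM u v sigma uv.
set p := pfst sigma u v; set q := plast sigma u v; set cm := midc sigma.
have tin : (u, v, p, q, cm) \in tasks.
  apply/mapP; exists (u, v, sigma) => //.
  by rewrite mem_filter /= uv mem_enum.
have Js0 x y p' (q' : seq Key) cm' : 0 <= Js x y p' q' cm' h w by apply: Jside_ge0.
have Ji0 : 0 <= Jin ex emb L h w by apply: Jin_ge0.
have hJ : Js u v p q cm h w + Js v u q p cm h w <= \sum_(t <- tasks) (Js t.1.1.1.1 t.1.1.1.2 t.1.1.2 t.1.2 t.2 h w +
   Js t.1.1.1.2 t.1.1.1.1 t.1.2 t.1.1.2 t.2 h w).
  apply: (sum_ge_term (F := fun t : Task => Js t.1.1.1.1 t.1.1.1.2 t.1.1.2 t.1.2 t.2 h w +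
   Js t.1.1.1.2 t.1.1.1.1 t.1.2 t.1.1.2 t.2 h w) _ tin) => t; exact: addr_ge0.
have S0 : 0 <= \sum_(t <- tasks) (Js t.1.1.1.1 t.1.1.1.2 t.1.1.2 t.1.2 t.2 h w +
   Js t.1.1.1.2 t.1.1.1.1 t.1.2 t.1.1.2 t.2 h w) by apply: sumr_ge0 => t _; exact: addr_ge0.
have J1 : Js u v p q cm h w < 1.
  apply: le_lt_trans J; rewrite /Jtot; apply: le_trans (lerD hJ Ji0); rewrite addr0 lerDl; exact: Js0.
have J2 : Js v u q p cm h w < 1.
  apply: le_lt_trans J; rewrite /Jtot; apply: le_trans (lerD hJ Ji0); rewrite addr0 lerDr; exact: Js0.
have J3 : Jin ex emb L h w < 1 by apply: le_lt_trans J; rewrite /Jtot lerDr.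
have hM' (e : entry) : e \in ents h -> ~~ wasted e.2 e.1.1 e.1.2 w -> e.1.1.1.1 != tgt w e.1.1 ->
    sedge e.1.1.1 (tgt w e.1.1) \in M.
  by move=> h1 h2 h3; apply: hM => //; rewrite board_card /= cards2 h3.
have hXc (f : Edge) : #|f.2| = 2%N -> (f \in M) || (f \in B).
  by move=> hc; rewrite -in_setU; apply: (subsetP XMB); rewrite board_card hc.
have Lts : (size tasks)%:R <= ex L.
  apply: le_trans (ltW n7); rewrite ler_nat; apply: leq_trans size_tasks _.
  by apply: leq_trans (leq_addr _ _); rewrite leq_pmulr // addn_gt0 muln_gt0 s_gt0 addn3.
have szp : size p = i := size_pfst sigma u v; have szq : size q = j := size_plast sigma u v.
have bound := @task_bound R ex exD ex_ge n s D m emb emb_inj m_gt0 D_gt0 em L L_ge0 Lam ell A Lam_ell ell_ge1 L_le A_ge1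
  h w hok hf J3 LD Dm M B b tasks u v p q cm hM' hXc b_gt0 (task_okc sigma u v).
rewrite szp szq in bound.
have path : npairs R emb h w M u v p q cm <= (ordered_paths_count M u v sigma)%:R.
  apply: (npairs_le_paths R emb_inj D_gt0 hok hf hM' (sigma := sigma)) => //.
  - by move=> k y hk; case/andP: (task_free y hk).
  - by move=> k y hk; case/andP: (task_free y hk).
  - exact: task_clu.
  - by rewrite szp szq jE.
  - exact: task_sp.
  - exact: task_sm.
  - exact: task_sq.
have jg : (0 < j)%N by rewrite subn_gt0.
case: (bound i_gt0 jg (@task_srctgt sigma u v w) J1 J2 tin Lts hLp n1 n2 n3 n3' n4 n4' n5 n6) => hb; [left|right].
  rewrite -sj; apply: le_trans hb _; rewrite ler_wpM2l ?mulr_ge0 //.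
rewrite -[in D%:R ^+ s]jE; apply: le_trans hb _; rewrite ler_wpM2l ?mulr_ge0 //.
Qed.
End Assembly.

(** * Choice of the constants *)

(** If the quotient is at most 4, the base is at most 8 and a constant bound on [b] suffices, whence
    the factor [8 ^ k]. Otherwise the base is at most twice the quotient, hence at most
    [4 * s * n / b./2], and clearing denominators leaves a comparison of [b ^ k] with [n ^ k.-1]. *)
Lemma breaker_numerics (s k n b : nat) : (1 < k)%N -> (0 < s)%N -> (0 < n)%N ->
  ((24 * s * expn 8 k) ^ k * n ^ k.-1 <= b ^ k)%N ->
  (12 * s <= b)%N /\ (8 * s * (4 + (2 * s * n) %/ b./2) ^ k.-1 <= b./2)%N.
Proof.
move=> k1 s0 n0; set C := (24 * s * expn 8 k)%N => hb.
have k0 : (0 < k)%N by apply: ltnW.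
have Cb : (C <= b)%N.
  rewrite -(leq_exp2r _ _ k0); apply: leq_trans hb; rewrite leq_pmulr // expn_gt0 n0 //.
have e8 : (8 <= expn 8 k)%N by rewrite -{1}(expn1 8) leq_exp2l.
have C192 : (192 * s <= C)%N.
  by rewrite /C (_ : 192 = 24 * 8)%N // -mulnA (mulnC 8%N) mulnA leq_mul2l e8 orbT.
have b12 : (12 * s <= b)%N.
  by apply: leq_trans Cb; apply: leq_trans C192; rewrite leq_mul2r orbT.
split=> //; set h := b./2.
have h3 : (b <= 3 * h)%N.
  have b2 : (12 <= b)%N by apply: leq_trans b12; rewrite leq_pmulr.
  have := odd_double_half b; rewrite -/h; move: (odd b) b2 => o; clear; move: o => [] /=; lia.
have h0 : (0 < h)%N.
  by rewrite -(ltn_pmul2l (isT : 0 < 3)%N) muln0; apply: leq_trans h3; apply: leq_trans b12; rewrite muln_gt0.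
case: (leqP ((2 * s * n) %/ h) 4) => hz.
  apply: (@leq_trans (8 * s * expn 8 k.-1)).
    by rewrite leq_mul2l leq_exp2r ?orbT //; [rewrite (_ : 8 = 4 + 4)%N // leq_add2l hz orbT|rewrite -ltnS prednK].
  rewrite -(leq_pmul2l (isT : 0 < 3)%N); apply: leq_trans h3; apply: leq_trans Cb.
  rewrite /C -[in leqRHS](prednK k0) expnS; clear; move: (expn 8 k.-1) => z; nia.
set z := (4 + _)%N.
have zh : (z * h <= 4 * s * n)%N.
  have : ((2 * s * n) %/ h * h <= 2 * s * n)%N by rewrite leq_divM.
  by move: hz; rewrite /z; clear; move: (_ %/ _)%N => y; nia.
have k1' : (0 < k.-1)%N by rewrite -ltnS prednK.
have := zh; rewrite -(leq_exp2r _ _ k1') !expnMn => zhk.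
have p3 : (0 < expn 3 k * expn h k.-1)%N by rewrite muln_gt0 !expn_gt0 h0.
rewrite -(leq_pmul2l p3).
have E : (expn 3 k * expn h k.-1 * h = expn (3 * h) k)%N.
  by rewrite expnMn -mulnA -expnSr prednK.
rewrite E; apply: leq_trans (_ : expn b k <= _)%N; last by rewrite leq_exp2r.
apply: leq_trans hb.
apply: (@leq_trans (8 * s * expn 3 k * (expn (4 * s) k.-1 * expn n k.-1))).
  rewrite (_ : _ * (8 * s * _) = 8 * s * expn 3 k * (expn z k.-1 * expn h k.-1))%N.
    by rewrite leq_mul2l expnMn zhk orbT.
  by clear; ring.
rewrite mulnA leq_mul2r; apply/orP; right.
have -> : (8 * s * expn 3 k * expn (4 * s) k.-1 = 24 * s * expn (12 * s) k.-1)%N.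
  rewrite -[in LHS](prednK k0) expnS (_ : 12 * s = 3 * (4 * s))%N; last by rewrite mulnA.
  by rewrite [in RHS]expnMn; clear; ring.
rewrite -[in leqRHS](prednK k0) expnS; apply: leq_mul.
  by apply: leq_trans C192; rewrite leq_mul2r orbT.
rewrite leq_exp2r //; apply: leq_trans C192; by rewrite leq_mul2r orbT.
Qed.

(** * Inequalities between the parameters of Maker's strategy *)

Section Real.
Variable R : realFieldType.
Implicit Types a c d x y T L : R.

Variables (a1 a2 K c1 Gam gam sp T L x y d M N be : R).
Hypotheses (T1 : 1 <= T) (x1 : 1 <= x) (y1 : 1 <= y) (M1 : 1 <= M) (b1 : 1 <= be).
Hypotheses (MN : M <= N) (NM : N <= 2 * sp * M).
Hypotheses (a1_gt0 : 0 < a1) (a2_gt0 : 0 < a2) (a1K : a1 <= K) (a12K : a1 * a2 <= K).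
Hypotheses (L0 : 0 <= L) (LT : L <= c1 * T) (c1_ge1 : 1 <= c1) (K1 : 1 <= K) (sp1 : 1 <= sp).
Hypotheses (hG : 4000 * (c1 * K) <= Gam) (gam0 : 0 <= gam) (hg : 10000 * (c1 * K * sp) * gam <= 1).
Hypotheses (f1 : Gam * N <= d * x) (f2 : Gam * N <= x * y) (f3 : Gam * T ^+ 4 <= d)
  (f4 : d * be <= N) (f5 : be * T ^+ 4 <= gam * N).

Let M0 : 0 < M. Proof. exact: lt_le_trans M1. Qed.
Let N0 : 0 < N. Proof. exact: lt_le_trans MN. Qed.
Let T0 : 0 < T. Proof. exact: lt_le_trans T1. Qed.
Let be0 : 0 < be. Proof. exact: lt_le_trans b1. Qed.
Let c0 : 0 < c1. Proof. exact: lt_le_trans c1_ge1. Qed.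
Let K0 : 0 < K. Proof. exact: lt_le_trans K1. Qed.
Let x0 : 0 < x. Proof. exact: lt_le_trans x1. Qed.
Let y0 : 0 < y. Proof. exact: lt_le_trans y1. Qed.
Let G0 : 0 < Gam. Proof. by apply: lt_le_trans hG; rewrite !mulr_gt0. Qed.
Let cK1 : 1 <= c1 * K. Proof. by rewrite -[1]mulr1 ler_pM. Qed.
Let KcK : K <= c1 * K. Proof. by rewrite ler_peMl ?(ltW K0). Qed.
Let G1 : 1 <= Gam. Proof. by apply: le_trans hG; move: cK1; lra. Qed.
Let d0 : 0 < d. Proof. by apply: lt_le_trans f3; rewrite mulr_gt0 ?exprn_gt0. Qed.

Let powT r : (r <= 4)%N -> T ^+ r <= T ^+ 4. Proof. by move=> hr; apply: ler_weXn2l. Qed.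
Let beT r : (r <= 4)%N -> be * T ^+ r <= gam * N.
Proof. by move=> hr; apply: le_trans f5; rewrite ler_wpM2l ?(ltW be0) // powT. Qed.
Let GT r : (r <= 4)%N -> Gam * T ^+ r <= d.
Proof. by move=> hr; apply: le_trans f3; rewrite ler_wpM2l ?(ltW G0) // powT. Qed.

Let beTM r : (r <= 4)%N -> 5000 * (c1 * K) * (be * T ^+ r) <= M.
Proof.
move=> hr; apply: (@le_trans _ _ (5000 * (c1 * K) * (gam * (2 * sp * M)))).
  apply: ler_wpM2l; first by rewrite !mulr_ge0 ?ltW //.
  by apply: le_trans (beT hr) _; rewrite ler_wpM2l.
have -> : 5000 * (c1 * K) * (gam * (2 * sp * M)) = (10000 * (c1 * K * sp) * gam) * M by ring.
by rewrite ler_piMl ?(ltW M0).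
Qed.

(** In the application [x = D ^+ i], [y = D ^+ j], [d = D], [M = m], [N = n], [be = b] and
    [T = n^(1/(4k))], so that [a1 * (1 + T * x / M)] is the cap [kapf] for length [i]. The powers of
    [T] lost in these estimates are absorbed by [T ^+ 4 = n^(1/k)] in [f3] and [f5]. *)
Lemma num_saturation : M * (a1 * (1 + T * x / M)) <= d * x.
Proof.
have -> : M * (a1 * (1 + T * x / M)) = a1 * M + a1 * T * x by field; rewrite lt0r_neq0.
have h1 : 4000 * (a1 * M) <= d * x.
  apply: le_trans f1; rewrite mulrA ler_pM ?mulr_ge0 ?(ltW a1_gt0) ?(ltW M0) //.
  by apply: le_trans hG; rewrite ler_wpM2l // (le_trans a1K).
have h2 : 4000 * (a1 * T * x) <= d * x.
  rewrite !mulrA ler_wpM2r ?(ltW x0) //; apply: le_trans (GT (r := 1) isT).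
  rewrite expr1 ler_wpM2r ?(ltW T0) //; apply: le_trans hG.
  by rewrite ler_wpM2l // (le_trans a1K).
have : 0 <= d * x by rewrite mulr_ge0 ?ltW //.
by lra.
Qed.

Lemma num_budget : 32 * be * (a1 * (1 + T * x / M)) <= x.
Proof.
have bx : Gam * be <= x.
  rewrite -(ler_pM2l d0); apply: le_trans f1; rewrite mulrCA ler_wpM2l ?(ltW G0) //.
have h1 : 4000 * (a1 * be) <= x.
  apply: le_trans bx; rewrite mulrA ler_wpM2r ?(ltW be0) //; apply: le_trans hG.
  by rewrite ler_wpM2l // (le_trans a1K).
have h2 : 5000 * (a1 * (be * T)) <= M.
  apply: le_trans (beTM (r := 1) isT); rewrite expr1 -mulrA ler_wpM2l // ler_wpM2r ?mulr_ge0 ?(ltW be0) ?(ltW T0) //.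
  exact: le_trans a1K _.
have h3 : 5000 * (a1 * (be * T)) * (x / M) <= x.
  apply: (@le_trans _ _ (M * (x / M))); last by rewrite mulrCA divff ?mulr1 ?lt0r_neq0.
  by rewrite ler_wpM2r // divr_ge0 ?ltW //.
have -> : 32 * be * (a1 * (1 + T * x / M)) = 32 * (a1 * be) + 32 * (a1 * (be * T) * (x / M)) by ring.
have : 0 <= a1 * (be * T) * (x / M) by rewrite !mulr_ge0 ?invr_ge0 ?ltW //.
by move: x0 h1 h3; lra.
Qed.

Let La : L * (a1 * a2) <= c1 * K * T.
Proof.
have -> : c1 * K * T = c1 * T * K by ring.
by rewrite ler_pM // mulr_ge0 // ltW.
Qed.

Let expand c : c * (L * (a1 * (1 + T * x / M) * (a2 * (1 + T * y / M)))) =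
  L * (a1 * a2) * (c * (1 + T * x / M + T * y / M + T ^+ 2 * (x * y) / M / M)).
Proof. by field; rewrite lt0r_neq0. Qed.

Lemma num_gain : 40 * M * (L * (a1 * (1 + T * x / M) * (a2 * (1 + T * y / M)))) <= d * (x * y).
Proof.
rewrite expand; have xy0 : 0 < x * y by rewrite mulr_gt0.
have -> : 40 * M * (1 + T * x / M + T * y / M + T ^+ 2 * (x * y) / M / M) =
  40 * (M + T * x + T * y + T ^+ 2 * (x * y) / M) by field; rewrite lt0r_neq0.
set S := M + _ + _ + _.
have S0 : 0 <= S by rewrite /S !addr_ge0 ?divr_ge0 ?mulr_ge0 ?exprn_ge0 ?ltW //.
apply: (@le_trans _ _ (c1 * K * T * (40 * S))).
  by rewrite ler_wpM2r ?mulr_ge0.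
have h1 : Gam * T * S <= 4 * (d * (x * y)).
  have t1 : Gam * T * M <= d * (x * y).
    apply: ler_pM; rewrite ?mulr_ge0 ?(ltW G0) ?(ltW T0) ?(ltW M0) //.
      by rewrite -[T]expr1 GT.
    by apply: le_trans MN (le_trans _ f2); rewrite ler_peMl ?(ltW N0).
  have t2 : Gam * T * (T * x) <= d * (x * y).
    have -> : Gam * T * (T * x) = Gam * T ^+ 2 * x by ring.
    apply: ler_pM; rewrite ?mulr_ge0 ?exprn_ge0 ?(ltW G0) ?(ltW T0) ?(ltW x0) ?GT //.
    by rewrite ler_peMr ?(ltW x0).
  have t3 : Gam * T * (T * y) <= d * (x * y).
    have -> : Gam * T * (T * y) = Gam * T ^+ 2 * y by ring.
    apply: ler_pM; rewrite ?mulr_ge0 ?exprn_ge0 ?(ltW G0) ?(ltW T0) ?(ltW y0) ?GT //.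
    by rewrite ler_peMl ?(ltW y0).
  have t4 : Gam * T * (T ^+ 2 * (x * y) / M) <= d * (x * y).
    have -> : Gam * T * (T ^+ 2 * (x * y) / M) = Gam * T ^+ 3 * (x * y / M) by ring.
    apply: ler_pM; rewrite ?mulr_ge0 ?exprn_ge0 ?invr_ge0 ?(ltW G0) ?(ltW T0) ?(ltW xy0) ?(ltW M0) ?GT ?(ltW x0) ?(ltW y0) //.
    by rewrite ler_pdivrMr // ler_peMr ?(ltW xy0).
  by rewrite /S !mulrDr; lra.
have h2 : 4000 * (c1 * K) * (T * S) <= Gam * (T * S).
  by rewrite ler_wpM2r // mulr_ge0 ?(ltW T0).
have := mulr_gt0 d0 xy0.
by move: h1 h2; rewrite !mulrA; lra.
Qed.

Lemma num_hit : 512 * be * (L * (a1 * (1 + T * x / M) * (a2 * (1 + T * y / M)))) <= x * y.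
Proof.
rewrite expand; have xy0 : 0 < x * y by rewrite mulr_gt0.
set S := 1 + _ + _ + _.
have S0 : 0 <= S by rewrite /S !addr_ge0 ?divr_ge0 ?mulr_ge0 ?exprn_ge0 ?ltW //.
apply: (@le_trans _ _ (c1 * K * T * (512 * be * S))).
  by rewrite ler_wpM2r ?mulr_ge0 ?(ltW be0).
have xyM : M <= x * y.
  by apply: le_trans MN (le_trans _ f2); rewrite ler_peMl ?(ltW N0).
have hr r z : (r <= 4)%N -> 0 <= z -> 5000 * (c1 * K) * (be * T ^+ r) * (z / M) <= z.
  move=> h4 z0; apply: (@le_trans _ _ (M * (z / M))); last by rewrite mulrCA divff ?mulr1 ?lt0r_neq0.
  by rewrite ler_wpM2r ?beTM // divr_ge0 ?(ltW M0).
have t1 := le_trans (beTM (r := 1) isT) xyM.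
have t2 := hr 2%N x isT (ltW x0).
have t3 := hr 2%N y isT (ltW y0).
have t4 := hr 3%N (x * y / M) isT (divr_ge0 (ltW xy0) (ltW M0)).
have t5 : x * y / M <= x * y by rewrite ler_pdivrMr // ler_peMr ?(ltW xy0).
have t6 : x <= x * y by rewrite ler_peMr ?(ltW x0).
have t7 : y <= x * y by rewrite ler_peMl ?(ltW y0).
have E : 5000 * (c1 * K * T * (be * S)) = 5000 * (c1 * K) * (be * T ^+ 1) +
   5000 * (c1 * K) * (be * T ^+ 2) * (x / M) + 5000 * (c1 * K) * (be * T ^+ 2) * (y / M) +
   5000 * (c1 * K) * (be * T ^+ 3) * (x * y / M / M).
  by rewrite /S; field; rewrite lt0r_neq0.
have E2 : c1 * K * T * (512 * be * S) = 512 * (c1 * K * T * (be * S)) by ring.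
rewrite E2; move: E t1 t2 t3 t4 t5 t6 t7 xy0; lra.
Qed.
End Real.

Lemma mwin_mono (F : finType) (X : {set F}) b (P Q : {set F} -> Prop) M B :
  (forall M, P M -> Q M) -> mwin X b P M B -> mwin X b Q M B.
Proof.
move=> PQ; elim=> [M0 B0 hX /PQ hQ|M0 B0 x hx _ IH]; first exact: mwin_end.
exact: mwin_step hx IH.
Qed.

(** * Checking the constraints for concrete classes *)

Section Maker.
Variables (R : realFieldType) (ex : R -> R).
Hypotheses (exD : forall x y, ex (x + y) = ex x * ex y) (ex_ge : forall x, 1 + x <= ex x).

Lemma exMn x r : ex (x *+ r) = ex x ^+ r.
Proof. by elim: r => [|r IH]; rewrite ?mulr0n ?(ex0 exD ex_ge) // mulrS exprS exD IH. Qed.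

Variables (s n : nat).
Let m := (n %/ s.+1)%N.

Lemma class_lt (a : 'I_s.+1) (y : 'I_m) : (a * m + y < n)%N.
Proof.
apply: (@leq_trans (a.+1 * m)); first by rewrite mulSn addnC ltn_add2r.
by apply: leq_trans (leq_divM n s.+1); rewrite mulnC leq_mul2l ltn_ord orbT.
Qed.

Definition class_emb (a : 'I_s.+1) (y : 'I_m) : 'I_n := Ordinal (class_lt a y).

Lemma class_emb_inj a y a' y' : class_emb a y = class_emb a' y' -> (a, y) = (a', y').
Proof.
move/(congr1 val) => /= E; have m0 : (0 < m)%N by apply: leq_ltn_trans (ltn_ord y).
have E1 := congr1 (divn^~ m) E; have E2 := congr1 (modn^~ m) E.
rewrite /= !divnMDl // !divn_small ?ltn_ord // !addn0 in E1.
rewrite /= !modnMDl !modn_small ?ltn_ord // in E2.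
by congr (_, _); apply: val_inj.
Qed.

Variables (k b D em : nat) (T ell gam Gam eps : R).
Let c1 : R := (16 * k)%:R.
Let A : R := c1 + 1.
Let K : R := A ^+ s.
Hypotheses (hs : (3 <= s)%N) (ks : (s = k.*2 \/ s.+1 = k.*2)%N) (b_gt0 : (0 < b)%N).
Hypotheses (Tell : ex ell = T) (ell1 : 1 <= ell) (Tn : T ^+ (4 * k) = n%:R).
Hypotheses (epsE : 3000 * (4 ^+ s * (s%:R * s.+1%:R)) * eps = 1).
Hypotheses (hG : 4000 * (c1 * K) <= Gam) (hGs : 400 * (s%:R * c1) <= Gam).
Hypotheses (gam0 : 0 <= gam) (hg : 10000 * (c1 * K * s.+1%:R) * gam <= 1) (hge : 64 * c1 * gam <= eps).
Hypotheses (hD1 : Gam * T ^+ 4 <= D%:R) (hD2 : Gam * n%:R <= D%:R ^+ k) (hD3 : D%:R * b%:R <= eps / 64 * n%:R).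
Hypotheses (hem1 : em%:R <= eps * n%:R) (hem2 : eps * n%:R / 2 <= em%:R).
Hypothesis hbT : b%:R * T ^+ 4 <= gam * n%:R.
Hypothesis hn : (8 * s * s`! + s * s.+1 * s.+1 + 3 < n)%N.

Let k1 : (1 < k)%N. Proof. by move: hs ks; clear; lia. Qed.
Let k_lt : (k < s)%N. Proof. by move: hs ks; clear; lia. Qed.
Let i := (s - k)%N.
Let j := (s.-1 - i)%N.
Let jE : j = k.-1. Proof. by rewrite /j /i; move: hs ks; clear; lia. Qed.
Let ij : (i + j)%N = s.-1. Proof. by rewrite jE /i; move: hs ks; clear; lia. Qed.
Let ki : (k <= i.+1)%N. Proof. by rewrite /i; move: hs ks; clear; lia. Qed.
Let kj : (k <= j.+1)%N. Proof. by rewrite jE; move: k1; clear; lia. Qed.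
Let kij : (k <= i + j)%N. Proof. by rewrite ij; move: k_lt; clear; lia. Qed.
Let s0 : (0 < s)%N. Proof. exact: leq_trans hs. Qed.
Let sn : (s.+1 <= n)%N.
Proof.
have h1 : (s <= s * s.+1 * s.+1)%N by rewrite -mulnA leq_pmulr.
by move: h1 hn; move: (s * s.+1 * s.+1)%N (8 * s * s`!)%N; clear; lia.
Qed.
Let n0 : (0 < n)%N. Proof. exact: leq_ltn_trans sn. Qed.
Let m_gt0 : (0 < m)%N. Proof. by rewrite divn_gt0. Qed.
Let NM : n%:R <= 2 * s.+1%:R * m%:R :> R.
Proof.
rewrite -!natrM ler_nat {1}(divn_eq n s.+1) -/m.
have := ltn_pmod n (ltn0Sn s); have : (s.+1 <= s.+1 * m)%N by rewrite leq_pmulr.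
by rewrite -mulnA mul2n -addnn mulnC leq_add2l => h1 h2; apply: leq_trans (ltnW h2) h1.
Qed.
Let MN : m%:R <= n%:R :> R. Proof. by rewrite ler_nat leq_div. Qed.
Let M1 : 1 <= m%:R :> R. Proof. by rewrite ler1n. Qed.
Let M0 : 0 < m%:R :> R. Proof. by rewrite ltr0n. Qed.
Let N0 : 0 < n%:R :> R. Proof. by rewrite ltr0n. Qed.
Let c1_ge1 : 1 <= c1. Proof. by rewrite ler1n muln_gt0 (ltnW k1). Qed.
Let A1 : 1 <= A. Proof. by rewrite /A lerDr; apply: le_trans c1_ge1. Qed.
Let K1 : 1 <= K. Proof. exact: exprn_ege1. Qed.
Let T1 : 1 <= T. Proof. by rewrite -Tell; have := ex_ge ell; move: ell1; lra. Qed.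
Let T0 : 0 < T. Proof. exact: lt_le_trans T1. Qed.
Let ellT : ell <= T. Proof. by rewrite -Tell; have := ex_ge ell; lra. Qed.
(** Then [ex L = T ^+ (16 * k) = n ^ 4], beyond the number of potentials, which is of order [n ^ 3];
    and [L / ell] is the constant [A - 1]. *)
Let L : R := ell *+ (16 * k).
Let LE : L = c1 * ell. Proof. by rewrite /L -mulr_natl. Qed.
Let L0 : 0 <= L. Proof. by rewrite LE mulr_ge0 ?ler0n // (le_trans _ ell1). Qed.
Let LT : L <= c1 * T. Proof. by rewrite LE ler_wpM2l // ler0n. Qed.
Let c1K1 : 1 <= c1 * K. Proof. by rewrite -[1]mulr1 ler_pM. Qed.
Let G0 : 0 < Gam. Proof. by apply: lt_le_trans hG; apply: mulr_gt0 => //; apply: lt_le_trans c1K1. Qed.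
Let c1G : c1 <= Gam.
Proof.
apply: le_trans hG; have : c1 <= c1 * K by rewrite ler_peMr // (le_trans _ c1_ge1).
by have : 0 <= c1 * K by [exact: le_trans c1K1]; lra.
Qed.
Let T4 : T <= T ^+ 4. Proof. by apply: ler_eXnr. Qed.
Let GT : Gam * T <= D%:R. Proof. by apply: le_trans hD1; rewrite ler_wpM2l // ltW. Qed.
Let D0 : (0 < D)%N.
Proof. by rewrite -(ltr0n R); apply: lt_le_trans GT; rewrite mulr_gt0. Qed.
Let D1 r : 1 <= D%:R ^+ r :> R. Proof. by rewrite exprn_ege1 // ler1n. Qed.
Let LD : L <= D%:R. Proof. by apply: le_trans LT (le_trans _ GT); rewrite ler_wpM2r // ltW. Qed.
Let b1 : 1 <= b%:R :> R. Proof. by rewrite ler1n. Qed.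
Let sR1 : 1 <= s%:R :> R. Proof. by rewrite ler1n. Qed.
Let s1R1 : 1 <= s.+1%:R :> R. Proof. by rewrite ler1n. Qed.
Let q1 : 1 <= 4 ^+ s :> R. Proof. by rewrite exprn_ege1 // ler1n. Qed.
Let eps0 : 0 < eps.
Proof.
have h : 0 < 3000 * (4 ^+ s * (s%:R * s.+1%:R)) :> R by rewrite !mulr_gt0 ?exprn_gt0 ?ltr0n.
by rewrite -(pmulr_rgt0 _ h) epsE.
Qed.
Let ss_eps : s%:R * s.+1%:R * eps <= 1 / 3000.
Proof.
have h : 0 <= s%:R * s.+1%:R * eps by rewrite !mulr_ge0 ?ler0n ?(ltW eps0).
have h2 : s%:R * s.+1%:R * eps <= 4 ^+ s * (s%:R * s.+1%:R * eps) by rewrite ler_peMl.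
have : 3000 * (4 ^+ s * (s%:R * s.+1%:R * eps)) = 1 by apply: etrans epsE; rewrite !mulrA.
lra.
Qed.
Let q_eps : 4 ^+ s * (s%:R * s.+1%:R * eps) = 1 / 3000.
Proof.
have : 3000 * (4 ^+ s * (s%:R * s.+1%:R * eps)) = 1 by apply: etrans epsE; rewrite !mulrA.
lra.
Qed.
Let s1_eps : s.+1%:R * eps <= 1 / 3000.
Proof.
apply: le_trans ss_eps; rewrite -mulrA ler_peMl // mulr_ge0 ?ler0n // ltW //.
Qed.
(** Walks of length at least [k] outnumber the vertices by the factor [Gam]. By [ki] and [kj] this
    covers the walks of either side prolonged by a middle slot. *)
Let f1 r : (k <= r.+1)%N -> Gam * n%:R <= D%:R * D%:R ^+ r.
Proof. by move=> kr; apply: le_trans hD2 _; rewrite -exprS; apply: ler_weXn2l; rewrite ?ler1n. Qed.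
Let f2 : Gam * n%:R <= D%:R ^+ i * D%:R ^+ j.
Proof. by apply: le_trans hD2 _; rewrite -exprD; apply: ler_weXn2l; rewrite ?ler1n. Qed.
Let f4 : D%:R * b%:R <= n%:R :> R.
Proof.
apply: le_trans hD3 _; rewrite ler_piMl ?(ltW N0) //.
have : eps <= s.+1%:R * eps by rewrite ler_peMl // ltW.
by move: s1_eps; lra.
Qed.
Let DdN : D%:R <= eps / 64 * n%:R.
Proof. by apply: le_trans hD3; rewrite ler_peMr // ler0n. Qed.
Let emM : em%:R / m%:R <= 2 * (s.+1%:R * eps).
Proof.
rewrite ler_pdivrMr //; apply: le_trans hem1 _; apply: le_trans (ler_wpM2l (ltW eps0) NM) _.
by rewrite le_eqVlt; apply/orP; left; apply/eqP; ring.
Qed.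
Let DM : D%:R / m%:R <= 1 / 32 * (s.+1%:R * eps).
Proof.
rewrite ler_pdivrMr //; apply: le_trans DdN _.
have e64 : 0 <= eps / 64 by rewrite divr_ge0 // ltW.
apply: le_trans (ler_wpM2l e64 NM) _.
by rewrite le_eqVlt; apply/orP; left; apply/eqP; field.
Qed.
Let LDs : s%:R * (L / D%:R) <= 1 / 400.
Proof.
rewrite mulrA ler_pdivrMr ?ltr0n //.
have h1 : s%:R * L <= s%:R * (c1 * T) by rewrite ler_wpM2l // ler0n.
have h2 : 400 * (s%:R * c1) * T <= Gam * T by rewrite ler_wpM2r // ltW.
by move: GT h1 h2; lra.
Qed.
Let Dm : (D <= m)%N.
Proof.
rewrite -(ler_nat R) -[leRHS]mul1r -ler_pdivrMr //; apply: le_trans DM _.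
by move: s1_eps; lra.
Qed.
Let si : (i + j)%:R <= s%:R :> R. Proof. by rewrite ler_nat ij leq_pred. Qed.

Let n1 : (i + j)%:R * (3 * waste_bound R D m em + L / D%:R) <= 1 / 200.
Proof.
have W0 : 0 <= 3 * waste_bound R D m em + L / D%:R.
  by apply: addr_ge0; [apply: mulr_ge0 => //; apply: divr_ge0|apply: divr_ge0].
apply: le_trans (ler_wpM2r W0 si) _.
rewrite mulrDr /waste_bound natrD mulrDl.
have h1 : s%:R * (em%:R / m%:R) <= s%:R * (2 * (s.+1%:R * eps)) by rewrite ler_wpM2l // ler0n.
have h2 : s%:R * (D%:R / m%:R) <= s%:R * (1 / 32 * (s.+1%:R * eps)) by rewrite ler_wpM2l // ler0n.
have e1 : s%:R * (2 * (s.+1%:R * eps)) = 2 * (s%:R * s.+1%:R * eps) by ring.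
have e2 : s%:R * (1 / 32 * (s.+1%:R * eps)) = 1 / 32 * (s%:R * s.+1%:R * eps) by ring.
rewrite e1 in h1; rewrite e2 in h2; move: h1 h2 LDs ss_eps; rewrite !mulrDr; lra.
Qed.

Let n2 : (i + j)%:R * (3 * (em%:R / m%:R * 4 ^+ s) + L / D%:R) <= 1 / 8.
Proof.
have e0 : 0 <= em%:R / m%:R * 4 ^+ s :> R by rewrite mulr_ge0 ?divr_ge0 ?exprn_ge0.
have W0 : 0 <= 3 * (em%:R / m%:R * 4 ^+ s) + L / D%:R.
  by apply: addr_ge0; [apply: mulr_ge0|apply: divr_ge0].
apply: le_trans (ler_wpM2r W0 si) _; rewrite mulrDr.
have h1 : s%:R * (em%:R / m%:R * 4 ^+ s) <= s%:R * (2 * (s.+1%:R * eps) * 4 ^+ s).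
  by rewrite ler_wpM2l ?ler0n // ler_wpM2r // exprn_ge0.
have e1 : s%:R * (2 * (s.+1%:R * eps) * 4 ^+ s) = 2 * (4 ^+ s * (s%:R * s.+1%:R * eps)) by ring.
rewrite e1 q_eps in h1; move: h1 LDs; lra.
Qed.

Let exL : ex L = n%:R ^+ 4.
Proof. by rewrite /L exMn Tell -Tn -exprM; congr (_ ^+ _); rewrite mulnAC. Qed.

Let n7 : (n * n * s`! * (s * (n + 3) + s * (n + 3)) + s * s.+1 * (s.+1 * m))%:R < ex L.
Proof.
rewrite exL -natrX ltr_nat.
have n3 : (3 <= n)%N by apply: leq_trans sn; apply: leqW.
apply: (@leq_ltn_trans (n ^ 3 * (8 * s * s`! + s * s.+1 * s.+1))%N); last first.
  rewrite (expnSr n 3) ltn_pmul2l ?expn_gt0 ?n0 //; apply: leq_ltn_trans hn; exact: leq_addr.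
rewrite [leqRHS]mulnDr leq_add //.
  have h : (s * (n + 3) + s * (n + 3) <= 8 * s * n)%N by move: n3; clear; nia.
  apply: leq_trans (leq_mul (leqnn _) h) _; rewrite !expnS expn0 muln1.
  by apply: eq_leq; clear; ring.
rewrite mulnA mulnC; apply: leq_mul => //.
by apply: leq_trans (leq_div n s.+1) _; rewrite -{1}(expn1 n) leq_pexp2l.
Qed.

Let n8 : 2 * (n * (s * s.+1))%:R <= ex L.
Proof.
rewrite exL -natrX -natrM ler_nat.
apply: (@leq_trans (n * n)).
  rewrite mulnCA leq_mul2l; apply/orP; right; apply: leq_trans (ltnW hn).
  have : (2 * (s * s.+1) <= s * s.+1 * s.+1)%N by rewrite mulnC leq_mul2l ltnS s0 orbT.
  by move: (8 * s * s`!)%N (s * s.+1 * s.+1)%N (2 * _)%N; clear; lia.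
by rewrite -[(n * n)%N]/(n ^ 2)%N leq_pexp2l.
Qed.

Let n9 : 16 * b%:R * (D%:R + L) <= em%:R.
Proof.
apply: le_trans hem2; rewrite mulrDr.
have h1 : b%:R * L <= b%:R * (c1 * T ^+ 4).
  by rewrite ler_wpM2l ?ler0n //; apply: le_trans LT _; rewrite ler_wpM2l // ler0n.
have h2 : c1 * (b%:R * T ^+ 4) <= c1 * (gam * n%:R) by rewrite ler_wpM2l // ler0n.
have h3 : 64 * c1 * gam * n%:R <= eps * n%:R by rewrite ler_wpM2r.
by move: hD3 h1 h2 h3; lra.
Qed.

Let aK r : (r <= s)%N -> A ^+ r <= K. Proof. by move=> h; apply: ler_weXn2l. Qed.
Let a0 r : 0 < A ^+ r. Proof. by rewrite exprn_gt0 // (lt_le_trans _ A1). Qed.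
Let i_le : (i <= s)%N. Proof. exact: leq_subr. Qed.
Let js : (j <= s)%N. Proof. by rewrite /j (leq_trans (leq_subr _ _)) // leq_pred. Qed.
Let aij : A ^+ i * A ^+ j <= K. Proof. by rewrite -exprD aK // ij leq_pred. Qed.

Lemma maker_wins_paths : mwin (cboard s n) b (fun M => forall u v (sigma : {perm 'I_s}), u != v ->
    D%:R ^+ s.-1 <= 128 * b%:R * (ordered_paths_count M u v sigma)%:R :> R \/
    D%:R ^+ s <= 50 * n%:R * (ordered_paths_count M u v sigma)%:R :> R) set0 set0.
Proof.
apply: (mwin_mono (P := fun M => forall u v (sigma : {perm 'I_s}), u != v ->
    D%:R ^+ s.-1 <= 128 * b%:R * (ordered_paths_count M u v sigma)%:R :> R \/
    D%:R ^+ s <= 50 * m%:R * (ordered_paths_count M u v sigma)%:R :> R)).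
  move=> M hM u v sigma /(hM u v sigma)[|h]; first by left.
  by right; apply: le_trans h _; rewrite ler_wpM2r ?ler0n // ler_wpM2l.
have ell0 : 0 < ell by apply: lt_le_trans ell1.
have i0 : (0 < i)%N by rewrite subn_gt0.
have il : (i < s.-1)%N by rewrite /i; move: hs ks; clear; lia.
have sat r : (k <= r.+1)%N -> (r <= s)%N -> m%:R * kapf D m T A r <= D%:R ^+ r.+1.
  move=> kr rs; rewrite exprS; apply: (num_saturation T1 (D1 r) M1 MN (a0 r) (aK rs) c1_ge1 K1 hG (f1 kr) hD1).
have bud r : (k <= r.+1)%N -> (r <= s)%N -> 32 * b%:R * kapf D m T A r <= D%:R ^+ r.
  move=> kr rs; apply: (num_budget T1 (D1 r) M1 b1 NM (a0 r) (aK rs) c1_ge1 K1 hG gam0 hg (f1 kr) hD1 f4 hbT).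
apply: (maker_paths exD ex_ge (emb := class_emb) class_emb_inj m_gt0 D0 L0 Tell ell1 _ A1 i0 il b_gt0 LD Dm n1 n2
   (sat i ki i_le) (sat j kj js) (bud i ki i_le) (bud j kj js) _ _ n7 n8 n9).
- by rewrite LE /A addrK.
- have := num_gain T1 (D1 i) (D1 j) M1 MN (a0 i) (a0 j) aij L0 LT c1_ge1 K1 hG f2 hD1.
  by rewrite exprS exprD.
have := num_hit T1 (D1 i) (D1 j) M1 b1 MN NM (a0 i) (a0 j) aij L0 LT c1_ge1 K1 hG gam0 hg f2 hbT.
by rewrite exprD.
Qed.
End Maker.

(** * Return to the original game and to real exponents *)

Lemma count_rainbow (s n : nat) (M : {set ('I_s * {set 'I_n})}) (u v : 'I_n) (sigma : 'S_s) :
  (0 < ordered_paths_count M u v sigma)%N -> exists w c, rainbow_path M u v w c.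
Proof.
case/card_gt0P => f; rewrite inE => /and4P[/eqP fu /eqP fv /injectiveP fi /forallP fM].
pose w := [seq f (lift ord0 j) | j <- enum 'I_s].
exists w, [seq sigma j | j <- enum 'I_s].
have uw : u :: w = map f (enum 'I_s.+1) by rewrite enum_ordSl /= fu -map_comp.
have nw (i : nat) : (i < s.+1)%N -> nth u (u :: w) i = f (inord i).
  move=> hi; rewrite uw (nth_map ord0) ?size_enum_ord //; congr (f _).
  by apply: val_inj; rewrite /= nth_enum_ord // inordK.
have sw : size w = s by rewrite size_map size_enum_ord.
apply/and5P; split.
- by rewrite sw size_map size_enum_ord.
- by rewrite uw map_inj_uniq ?enum_uniq.
- rewrite (last_nth u) sw nw // -fv; apply/eqP; congr (f _).
  by apply: val_inj; rewrite /= inordK.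
- by rewrite map_inj_uniq ?enum_uniq //; exact: perm_inj.
have [E|[i0 _]] : enum 'I_s = [::] \/ exists i0 : 'I_s, True.
  by case: (enum 'I_s) => [|i0 r]; [left|right; exists i0].
  by rewrite E; case: (zip (u :: w) w).
apply/(all_nthP (sigma i0, (u, u))) => i.
rewrite size_zip size_map size_enum_ord size_zip /= sw (minn_idPr (leqnSn s)) minnn => hi.
rewrite nth_zip ?size_map ?size_enum_ord ?size_zip /= ?sw ?(minn_idPr (leqnSn s)) //.
rewrite nth_zip_cond size_zip /= sw (minn_idPr (leqnSn s)) hi /=.
rewrite (nth_map (Ordinal hi)) ?size_enum_ord //.
have -> : nth (Ordinal hi) (enum 'I_s) i = Ordinal hi by apply: val_inj; rewrite /= nth_enum_ord.
have e1 := nw i (leqW hi); have e2 := nw i.+1 hi; rewrite [nth u (u :: w) i.+1]/= in e2.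
  by rewrite e1 e2; exact: fM (Ordinal hi).
by rewrite -enumT size_enum_ord.
Qed.

(** Taking powers of exponent [uphalf s] turns the bounds on the bias into inequalities without real
    exponents. *)
Lemma thr_pow (s n : nat) : (0 < n)%N -> (0 < uphalf s)%N ->
  thr s n ^+ (uphalf s) = n%:R ^+ (uphalf s).-1.
Proof.
move=> n0 k0; rewrite /thr; move: (uphalf s) k0 => k k0.
have nR : Rlt (IZR 0) (INR n) by rewrite INRE; apply/RltP; rewrite ltr0n.
have E : exp (ln (INR n)) = n%:R :> R by rewrite exp_ln // INRE.
rewrite /Rpower expRX -[in RHS]E expRX; congr exp.
have -> : Rmult (Rminus (IZR 1) (Rinv (INR k))) (ln (INR n)) = (1 - k%:R^-1) * ln (INR n).
  by rewrite -INRE.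
set X := ln _; rewrite -(mulr_natl ((1 - k%:R^-1) * X) k) -(mulr_natl X k.-1) mulrA; congr (_ * _).
rewrite mulrBr mulr1 divff ?pnatr_eq0 -?lt0n //.
by rewrite -[in LHS](prednK k0) -natr1 addrK.
Qed.

Lemma maker_side (RR : archiRealFieldType) (ex : RR -> RR) (s k : nat) :
  (forall x y, ex (x + y) = ex x * ex y) -> (forall x, 1 + x <= ex x) ->
  (forall x, 0 < x -> exists l, ex l = x) -> (3 <= s)%N -> (s = k.*2 \/ s.+1 = k.*2)%N ->
  exists beta gam : RR, [/\ 0 < beta, 0 < gam & exists N : nat, forall n, (N <= n)%N ->
    forall b, (0 < b)%N -> b%:R ^+ k <= gam ^+ k * n%:R ^+ k.-1 ->
    mwin (cboard s n) b (fun M => forall u v (sigma : {perm 'I_s}), u != v ->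
      beta * n%:R ^+ s.-1 / b%:R ^+ s <= (ordered_paths_count M u v sigma)%:R) set0 set0].
Proof.
move=> exD ex_ge ex_surj hs ks.
have k0 : (0 < k)%N by move: hs ks; clear; lia.
have s0 : (0 < s)%N by apply: leq_trans hs.
pose c1 : RR := (16 * k)%:R; pose K : RR := (c1 + 1) ^+ s.
(* With this [eps] the ratio [em / m], at most [2 * (s + 1) * eps], is small against
   [1 / (s * 4 ^ s)], as the bounds on waste and on bad pairs demand. *)
pose q : RR := 3000 * (4 ^+ s * (s%:R * s.+1%:R)); pose eps := q^-1.
(* [gam] is such that [b * T ^+ 4 <= gam * n] makes [eps / 64 * n / b] at least [2 * Gam * T ^+ 4];
   the factor 2 pays for rounding [D]. *)
pose Gam : RR := 4000 * (c1 * K) * s%:R; pose gam := eps / (128 * Gam).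
have c1_ge1 : 1 <= c1 by rewrite ler1n muln_gt0.
have c1_gt0 : 0 < c1 by apply: lt_le_trans c1_ge1.
have K1 : 1 <= K by rewrite exprn_ege1 // lerDr ltW.
have K0 : 0 < K by apply: lt_le_trans K1.
have sR1 : 1 <= s%:R :> RR by rewrite ler1n.
have sR0 : 0 < s%:R :> RR by rewrite ltr0n.
have s1R1 : 1 <= s.+1%:R :> RR by rewrite ler1n.
have q1 : 1 <= 4 ^+ s :> RR by rewrite exprn_ege1 // ler1n.
have q0 : 0 < q.
  apply: mulr_gt0; first by rewrite ltr0n.
  apply: mulr_gt0; first by apply: lt_le_trans q1.
  by apply: mulr_gt0; rewrite ltr0n.
have q_ge1 : 3000 * s.+1%:R <= q.
  have qs : 1 <= 4 ^+ s * s%:R :> RR by apply: (le_trans q1); rewrite ler_peMr // (le_trans _ q1).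
  by rewrite /q ler_wpM2l // mulrA ler_peMl ?ler0n.
have eps0 : 0 < eps by rewrite invr_gt0.
have epsE : q * eps = 1 by rewrite /eps divff // lt0r_neq0.
have eps1 : eps <= 1 by rewrite invf_le1 //; apply: le_trans q_ge1; move: s1R1; clear; lra.
have cK1 : 1 <= c1 * K by rewrite -[1]mulr1 ler_pM.
have hG : 4000 * (c1 * K) <= Gam by rewrite /Gam ler_peMr // mulr_ge0 // (le_trans _ cK1).
have hGs : 400 * (s%:R * c1) <= Gam.
  have h : s%:R * c1 <= c1 * K * s%:R by rewrite mulrC ler_wpM2r ?ler0n // ler_peMr // ltW.
  have : 0 <= s%:R * c1 by rewrite mulr_ge0 ?ltW.
  by rewrite /Gam -mulrA; move: h; clear; lra.
have G0 : 0 < Gam by apply: lt_le_trans hG; rewrite !mulr_gt0.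
have G1 : 1 <= Gam by apply: le_trans hG; move: cK1; clear; lra.
have gam0 : 0 < gam by rewrite divr_gt0 // mulr_gt0.
have gamE : 128 * Gam * gam = eps by rewrite /gam mulrC divfK // lt0r_neq0 // mulr_gt0.
have cKgam : 100 * (5000 * (c1 * K * gam)) <= eps.
  rewrite -gamE; have : 4000 * (c1 * K) * gam <= Gam * gam by rewrite ler_wpM2r // ltW.
  have : 0 <= c1 * K * gam by rewrite mulr_ge0 ?(ltW gam0) // (le_trans _ cK1).
  by clear; lra.
have hg : 10000 * (c1 * K * s.+1%:R) * gam <= 1.
  have h := ler_wpM2l (ler0n RR s.+1) cKgam.
  have h2 : 3000 * s.+1%:R * eps <= 1.
    by apply: le_trans (ler_wpM2r (ltW eps0) q_ge1) _; rewrite epsE.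
  have -> : 10000 * (c1 * K * s.+1%:R) * gam = 10000 * (s.+1%:R * (c1 * K * gam)).
    by rewrite -mulrA (mulrAC (c1 * K)) (mulrC s.+1%:R).
  have : 0 <= s.+1%:R * (c1 * K * gam).
    by apply: mulr_ge0; rewrite ?ler0n // mulr_ge0 ?(ltW gam0) // (le_trans _ cK1).
  move: h h2; rewrite [s.+1%:R * (100 * _)]mulrCA [s.+1%:R * (5000 * _)]mulrCA; clear; lra.
have hge : 64 * c1 * gam <= eps.
  apply: le_trans cKgam; have : c1 * gam <= c1 * K * gam by rewrite ler_wpM2r ?(ltW gam0) // ler_peMr // ltW.
  have : 0 <= c1 * gam by rewrite mulr_ge0 ?ltW.
  clear; lra.
(* Rounding loses at most half, so [D] will be at least [e * n / b]. *)
pose e := eps / 128; have e0 : 0 < e by rewrite divr_gt0.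
have e1 : e <= 1 by rewrite /e; move: eps1; clear; lra.
exists (e ^+ s / 128), gam; split=> //; first by rewrite divr_gt0 // exprn_gt0.
pose N1 := (Num.truncn (ex (4 * k)%:R)).+1; pose N2 := (Num.truncn (2 / eps : RR)).+1.
exists (maxn (8 * s * s`! + s * s.+1 * s.+1 + 4) (maxn N1 N2)) => n.
rewrite !geq_max => /and3P[hn hN1 hN2] b b_gt0 hb.
have n0 : (0 < n)%N by apply: leq_trans hN1.
have nR0 : 0 < n%:R :> RR by rewrite ltr0n.
have bR0 : 0 < b%:R :> RR by rewrite ltr0n.
have trunc_lt (x : RR) (r : nat) : 0 <= x -> ((Num.truncn x).+1 <= r)%N -> x <= r%:R.
  move=> x0 hr; have /andP[_ h] := truncn_itv x0; apply: le_trans (ltW h) _.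
  by rewrite ler_nat.
have trunc_half (x : RR) : 2 <= x -> x / 2 <= (Num.truncn x)%:R <= x.
  move=> x2; have x0 : 0 <= x by move: x2; clear; lra.
  have /andP[h1 h2] := truncn_itv x0; rewrite h1 andbT.
  by move: h2 x2; rewrite -natr1; clear; lra.
have expk : ex (4 * k)%:R <= n%:R.
  by apply: trunc_lt => //; apply: ltW; apply: ex_gt0.
have epsn : 2 <= eps * n%:R.
  rewrite mulrC -ler_pdivrMr //; apply: trunc_lt => //; by rewrite divr_ge0 // ltW.
have [ln lnE] := ex_surj _ nR0.
pose ell : RR := ln / (4 * k)%:R; pose T := ex ell.
have k4 : 0 < (4 * k)%:R :> RR by rewrite ltr0n muln_gt0.
have Tn : T ^+ (4 * k) = n%:R.
  by rewrite /T -(exMn exD ex_ge) /ell -(mulr_natr (ln / _) (4 * k)%N) divfK ?lt0r_neq0.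
have ell1 : 1 <= ell.
  rewrite ler_pdivlMr // mul1r leNgt; apply/negP=> h.
  by have := ex_lt exD ex_ge h; rewrite lnE ltNge expk.
have T0 : 0 < T by apply: ex_gt0.
have T1 : 1 <= T by apply: le_trans (ex_ge ell); move: ell1; clear; lra.
have hbT : b%:R * T ^+ 4 <= gam * n%:R.
  have h1 : 0 <= b%:R * T ^+ 4 by rewrite mulr_ge0 ?ler0n ?exprn_ge0 ?(ltW T0).
  have h2 : 0 <= gam * n%:R by apply: mulr_ge0; [exact: ltW|exact: ler0n].
  rewrite -(ler_pXn2r k0) ?nnegrE // exprMn [in leRHS]exprMn -exprM Tn -[in n%:R ^+ k](prednK k0) exprSr mulrA ler_wpM2r ?ler0n //.
(* The box game needs [16 * b * D] well below [em]; this choice makes it at most [eps * n / 4]. *)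
pose z := eps / 64 * n%:R / b%:R; pose D := Num.truncn z; pose em := Num.truncn (eps * n%:R).
have zG : 2 * (Gam * T ^+ 4) <= z.
  rewrite /z ler_pdivlMr //; have h := ler_wpM2l (ltW G0) hbT.
  have h2 : 128 * Gam * gam * n%:R = eps * n%:R by rewrite gamE.
  by move: h h2; clear; lra.
have GT1 : 1 <= Gam * T ^+ 4 by rewrite -[1]mulr1 ler_pM // exprn_ege1.
have /andP[zD Dz] : z / 2 <= D%:R <= z by apply: trunc_half; move: zG GT1; clear; lra.
have /andP[em2 em1] := trunc_half _ epsn.
have hD1 : Gam * T ^+ 4 <= D%:R by move: zG zD; clear; lra.
have hD2 : Gam * n%:R <= D%:R ^+ k.
  apply: (@le_trans _ _ ((Gam * T ^+ 4) ^+ k)).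
    by rewrite exprMn -exprM Tn ler_wpM2r ?ler0n //; apply: ler_eXnr.
  by rewrite ler_pXn2r ?nnegrE ?ler0n // (le_trans _ GT1).
have hD3 : D%:R * b%:R <= eps / 64 * n%:R by rewrite -ler_pdivlMr.
have hn' : (8 * s * s`! + s * s.+1 * s.+1 + 3 < n)%N by rewrite -addnS.
apply: mwin_mono (maker_wins_paths exD ex_ge hs ks b_gt0 (erefl T) ell1 Tn epsE hG hGs (ltW gam0) hg hge
  hD1 hD2 hD3 em1 em2 hbT hn') => M hM u v sigma uv.
pose Z : RR := n%:R ^+ s.-1 / b%:R ^+ s; set c : RR := (ordered_paths_count _ _ _ _)%:R.
have c0 : 0 <= c by rewrite ler0n.
have Z0 : 0 <= Z by rewrite divr_ge0 ?exprn_ge0 ?ler0n.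
have yD : e * n%:R / b%:R <= D%:R by apply: le_trans zD; rewrite le_eqVlt; apply/orP; left; apply/eqP; rewrite /e /z; field; rewrite lt0r_neq0.
have y0 : 0 <= e * n%:R / b%:R.
  by apply: divr_ge0; [apply: mulr_ge0; [exact: ltW|exact: ler0n]|exact: ler0n].
have yX r : (e * n%:R / b%:R) ^+ r <= D%:R ^+ r by apply: lerXn2r; rewrite ?nnegrE ?ler0n.
have es : e ^+ s <= e ^+ s.-1 by rewrite -[in leLHS](prednK s0) exprS ler_piMl ?exprn_ge0 // ltW.
have -> : e ^+ s / 128 * n%:R ^+ s.-1 / b%:R ^+ s = e ^+ s * Z / 128 by rewrite /Z; field; rewrite lt0r_neq0 // exprn_gt0.
(* Both alternatives have the same order, since [D ^+ s.-1 / b] and [D ^+ s / n] are each at least a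
   constant times [n ^ (s - 1) / b ^ s]. *)
case: (hM u v sigma uv) => h; have {h} := le_trans (yX _) h.
  have -> : (e * n%:R / b%:R) ^+ s.-1 = b%:R * (e ^+ s.-1 * Z).
    rewrite /Z -[in b%:R ^+ s](prednK s0) exprS exprMn exprMn exprVn.
    have F (x1 x2 x3 x4 : RR) : x3 != 0 -> x4 != 0 -> x1 * x2 / x3 = x4 * (x1 * (x2 / (x4 * x3))).
      by clear=> h3 h4; field; rewrite h3 h4.
    by apply: F; rewrite lt0r_neq0 // exprn_gt0.
  have -> : 128 * b%:R * c = b%:R * (128 * c) by rewrite mulrCA mulrA.
  rewrite ler_pM2l // => h.
  by have := ler_wpM2r Z0 es; move: h; clear; lra.
have -> : (e * n%:R / b%:R) ^+ s = n%:R * (e ^+ s * Z).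
  rewrite /Z exprMn exprMn exprVn -[in n%:R ^+ s](prednK s0) exprS.
  by rewrite -!mulrA mulrCA.
have -> : 50 * n%:R * c = n%:R * (50 * c) by rewrite mulrCA mulrA.
rewrite ler_pM2l // => h.
by move: h c0; clear; lra.
Qed.

Delimit Scope R_scope with R.

Theorem theorem1p4 (s : nat) (hs : (3 <= s)%N) :
  exists C beta gamma : R, (0 < C)%R /\ (0 < beta)%R /\ (0 < gamma)%R /\
  exists N : nat, forall n : nat, (N <= n)%N ->
    (* (a) Breaker wins *)
    (forall b : nat, (C * thr s n <= INR b)%R ->
       ~ maker_wins (cboard s n) b (@rainbow_connected s n)) /\
    (* (b) Maker wins, with a strategy also giving many ordered rainbow paths *)
    (forall b : nat, (0 < b)%N -> (INR b <= gamma * thr s n)%R ->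
       maker_wins (cboard s n) b
         (fun M => rainbow_connected M /\ many_paths beta b M)).
Proof.
set k := uphalf s.
have ks : (s = k.*2 \/ s.+1 = k.*2)%N.
  rewrite /k uphalf_half; have := odd_double_half s.
  by move: (s./2) (odd s) => r [] /=; clear; lia.
have k1 : (1 < k)%N by move: hs ks; clear; lia.
have k0 := ltnW k1; have s0 : (0 < s)%N by apply: leq_trans hs.
have [||x x0|beta [gam [beta0 gam0 [N hN]]]] := @maker_side Rdefinitions.R exp s k _ _ _ hs ks.
- by move=> x y; rewrite expRD.
- by move=> x; apply/RleP; exact: exp_ineq1_le.
- by exists (ln x); apply: exp_ln; apply/RltP.
pose C := (24 * s * expn 8 k)%N.
have C0 : (0 < C)%N by rewrite !muln_gt0 s0 expn_gt0.
have thr0 (n : nat) : (0 : Rdefinitions.R) <= thr s n by apply: ltW; apply/RltP; exact: exp_pos.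
exists (INR C), beta, gam; split; first by rewrite INRE; apply/RltP; rewrite ltr0n.
split; first exact/RltP. split; first exact/RltP.
exists (maxn N 4) => n; rewrite geq_max => /andP[nN n4].
have n0 : (0 < n)%N by apply: leq_trans n4.
split=> b.
  move/RleP; rewrite INRE INRE => hb.
  have {hb} : (C ^ k * n ^ k.-1 <= b ^ k)%N.
    have hC : (0 : Rdefinitions.R) <= C%:R * thr s n by rewrite mulr_ge0 ?ler0n.
    have := lerXn2r k (x := C%:R * thr s n) (y := b%:R); rewrite !nnegrE hC ler0n => /(_ isT isT hb).
    by rewrite exprMn thr_pow // -!natrX -natrM ler_nat.
  case/(breaker_numerics k1 s0 n0) => h12 h8; apply: (breaker_wins (k := k)) => //.
  by move: ks; clear; lia.
move=> b0 /RleP; rewrite INRE => hb; apply: mwin_mono (hN n nN b b0 _).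
  move=> M hM; split=> [u v uv|u v uv sigma]; last first.
    by apply/RleP; have := hM u v sigma uv; rewrite !RpowE !INRE.
  (* One ordering of the colours is enough here, as the lower bound on the count is positive. *)
  apply: (count_rainbow (sigma := 1%g)); rewrite -(ltr0n Rdefinitions.R).
  apply: lt_le_trans (hM u v 1%g uv); apply: divr_gt0; last by rewrite exprn_gt0 // ltr0n.
  by apply: mulr_gt0 => //; rewrite exprn_gt0 // ltr0n.
have hg : (0 : Rdefinitions.R) <= gam * thr s n by apply: mulr_ge0 => //; exact: ltW.
have := lerXn2r k (x := b%:R) (y := gam * thr s n); rewrite !nnegrE hg ler0n => /(_ isT isT hb).
by rewrite exprMn thr_pow.
Qed.
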